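(* Consider any of the three cases (i) global center, (ii) truncated pendulum, (iii) eight loop, one of its period annuli, and an analytic one-parameter deformation $X_{\lambda(\varepsilon)}$ of $X_0$ with $\lambda(0)=0$. Let $M_n(h)$ be the first nonzero coefficient in the expansion of the displacement function at $H=h$, namely $$d(h,\varepsilon)=M_n(h)\varepsilon^n+M_{n+1}(h)\varepsilon^{n+1}+\cdots,\qquad n\in\mathbb{N}.$$ Then, with $m$ denoting a natural number, $M_n(h)$ has for any of the three cases the form $$M_n(h)=(p_{2n}^1h^2+p_{1n}^1h+p_{0n}^1)I_2(h)+(q_{2n}^1h^2+q_{1n}^1h+q_{0n}^1)I_0(h)\quad\text{if } n=3m,$$ $$M_n(h)=(p_{1n}^0h+p_{0n}^0)I_2(h)+(q_{2n}^0h^2+q_{1n}^0h+q_{0n}^0)I_0(h)\quad\text{if } n\neq 3m,$$ with real constants $p^i_{jn}$ and $q^i_{jn}$ explicitly determined by the coefficients of the perturbed equation (that is, by the Taylor coefficients of the functions $\lambda_j(\varepsilon)$).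
   Context: The three cases are (i) global center: $H=\frac12y^2+\frac12x^2+\frac14x^4$, $h>0$; (ii) truncated pendulum: $H=\frac12y^2+\frac12x^2-\frac14x^4$, $0<h<\frac14$; (iii) eight loop: $H=\frac12y^2-\frac12x^2+\frac14x^4$, $h\in(-\frac14,0)$ (either of the two interior period annuli) or $h>0$ (the exterior period annulus). In each case $h$ parametrizes the nested ovals of $\{H=h\}$ forming a period annulus of $X_0:\ \dot x=H_y,\ \dot y=-H_x$. The perturbed system is $$X_\lambda:\quad \dot x=H_y,\qquad \dot y=-H_x+(\lambda_1+\lambda_2x^2+\lambda_3y^2+\lambda_4x^4+\lambda_5y^4+\lambda_6x^6)\,y,$$ equivalent to $\ddot x+ax+bx^3-(\lambda_1+\lambda_2x^2+\lambda_3\dot x^2+\lambda_4x^4+\lambda_5\dot x^4+\lambda_6x^6)\dot x=0$ with $(a,b)=(1,1),(1,-1),(-1,1)$ respectively. The deformation is along an analytic arc $\varepsilon\mapsto\lambda(\varepsilon)$, $\lambda(0)=0$, $\lambda_j(\varepsilon)=\sum_{k\ge1}\lambda_{jk}\varepsilon^k$, $1\le j\le6$. The displacement function is $d(h,\varepsilon)=P(h,\varepsilon)-h$, where $P(\cdot,\varepsilon)$ is the first return map of $X_{\lambda(\varepsilon)}$ on a cross-section to the periodic orbits of the annulus, parametrized by the value $h$ of $H$; it is analytic in $h$ and $\varepsilon$ and expands as $d(h,\varepsilon)=M_1(h)\varepsilon+M_2(h)\varepsilon^2+\cdots$. $I_0(h)=\int_{H=h}y\,dx$ and $I_2(h)=\int_{H=h}x^2y\,dx$,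 the integrals being taken over the oval of $\{H=h\}$ in the period annulus considered, oriented by the flow of $X_0$. *)

(* Defs.v *)
From Stdlib Require Import Reals.
From Coquelicot Require Import Coquelicot.
Open Scope R_scope.

Inductive annulus : Set :=
  | GlobalCenter
  | TruncatedPendulum
  | EightInteriorLeft
  | EightInteriorRight
  | EightExterior.

Definition coef_a (A : annulus) : R :=
  match A with
  | GlobalCenter | TruncatedPendulum => 1
  | EightInteriorLeft | EightInteriorRight | EightExterior => -1
  end.

Definition coef_b (A : annulus) : R :=
  match A with
  | TruncatedPendulum => -1
  | GlobalCenter | EightInteriorLeft | EightInteriorRight | EightExterior => 1
  end.

Definition Ham (A : annulus) (x y : R) : R :=
  y ^ 2 / 2 + coef_a A * x ^ 2 / 2 + coef_b A * x ^ 4 / 4.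

Definition level (A : annulus) (h : R) : Prop :=
  match A with
  | GlobalCenter | EightExterior => 0 < h
  | TruncatedPendulum => 0 < h < 1 / 4
  | EightInteriorLeft | EightInteriorRight => - (1 / 4) < h < 0
  end.

(** The oval of [{H = h}] in the annulus.  The side conditions discard the two
    unbounded branches (where [|x| > 1]) in the truncated pendulum case, and
    the other loop in the interior eight-loop case. *)
Definition oval (A : annulus) (h x y : R) : Prop :=
  Ham A x y = h /\
  match A with
  | GlobalCenter | EightExterior => True
  | TruncatedPendulum => Rabs x < 1
  | EightInteriorLeft => x < 0
  | EightInteriorRight => 0 < x
  end.

Inductive param : Set := L1 | L2 | L3 | L4 | L5 | L6.

Definition damping (l : param -> R) (x y : R) : R :=
  l L1 + l L2 * x ^ 2 + l L3 * y ^ 2 + l L4 * x ^ 4 + l L5 * y ^ 4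
  + l L6 * x ^ 6.

(** Solutions on [[0, T]] of [x' = H_y, y' = - H_x + damping * y]. *)
Definition solution (A : annulus) (l : param -> R) (x y : R -> R) (T : R)
    : Prop :=
  forall t, 0 <= t <= T ->
    is_derive x t (y t) /\
    is_derive y t (- (coef_a A * x t + coef_b A * x t ^ 3)
                   + damping l (x t) (y t) * y t).

(** [(x, y)] runs exactly once around the oval of level [h] during [[0, T)],
    following the flow of [X_0]. *)
Definition oval_parametrization (A : annulus) (h : R) (x y : R -> R) (T : R)
    : Prop :=
  0 < T /\
  solution A (fun _ => 0) x y T /\
  x T = x 0 /\ y T = y 0 /\
  (forall t1 t2, 0 <= t1 < T -> 0 <= t2 < T ->
     x t1 = x t2 -> y t1 = y t2 -> t1 = t2) /\
  (forall u v, oval A h u v <-> exists t, 0 <= t < T /\ x t = u /\ y t = v).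

(** [v] is the line integral of [x^k y dx] over the oval of level [h],
    oriented by the flow of [X_0]. *)
Definition is_oval_integral (A : annulus) (k : nat) (h v : R) : Prop :=
  exists (x y : R -> R) (T : R),
    oval_parametrization A h x y T /\
    is_RInt (fun t => x t ^ k * y t * Derive x t) 0 T v.

Definition analytic_at (f : R -> R) (x0 : R) : Prop :=
  exists a : nat -> R, locally x0 (fun x => is_pseries a (x - x0) (f x)).

(** An analytic arc [e |-> lam e] through [0], given near [0] by its Taylor
    coefficients [c j k = lambda_{jk}]. *)
Definition analytic_arc (lam : param -> R -> R) (c : param -> nat -> R)
    : Prop :=
  forall j, c j O = 0 /\ locally 0 (fun e => is_pseries (c j) e (lam j e)).

(** A cross-section parametrized by the value [h] of [H].  Transversality to
    the ovals is automatic: differentiating [H (sx h, sy h) = h] gives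
    [dH (sx' h, sy' h) = 1]. *)
Definition cross_section (A : annulus) (sx sy : R -> R) : Prop :=
  forall h, level A h ->
    oval A h (sx h) (sy h) /\ analytic_at sx h /\ analytic_at sy h.

(** The positive orbit of [X_l] from the point of the section with parameter
    [h] meets the section again, for the first time, at parameter [h']. *)
Definition first_return (A : annulus) (sx sy : R -> R) (l : param -> R)
    (h h' : R) : Prop :=
  exists (x y : R -> R) (T : R),
    0 < T /\
    solution A l x y T /\
    x 0 = sx h /\ y 0 = sy h /\
    level A h' /\ x T = sx h' /\ y T = sy h' /\
    (forall t h'', 0 < t < T -> level A h'' ->
       ~ (x t = sx h'' /\ y t = sy h'')).

(** [d h e = P h e - h].  The range of [e] for which the return map is defined
    depends on [h], since the annulus is not compact. *)
Definition is_displacement (A : annulus) (sx sy : R -> R)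
    (lam : param -> R -> R) (d : R -> R -> R) : Prop :=
  forall h, level A h ->
    locally 0 (fun e =>
      first_return A sx sy (fun j => lam j e) h (h + d h e)).

(** [d h e = M_n h * e^n + M_{n+1} h * e^{n+1} + ...] near [e = 0], where [M_n]
    does not vanish identically on the annulus. *)
Definition first_coefficient (A : annulus) (d : R -> R -> R)
    (M : nat -> R -> R) (n : nat) : Prop :=
  (forall h, level A h ->
     locally 0 (fun e => is_pseries (fun k => M k h) e (d h e))) /\
  (forall k h, (k < n)%nat -> level A h -> M k h = 0) /\
  (exists h, level A h /\ M n h <> 0).

(** Formulas for constants that are explicitly determined by the Taylor
    coefficients [lambda_{jk}] (written [Coef j k]). *)
Inductive coef_expr : Type :=
  | Cst (r : R)
  | Coef (j : param) (k : nat)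
  | Add (s t : coef_expr)
  | Mul (s t : coef_expr).

Fixpoint eval_coef (c : param -> nat -> R) (t : coef_expr) : R :=
  match t with
  | Cst r => r
  | Coef j k => c j k
  | Add t1 t2 => eval_coef c t1 + eval_coef c t2
  | Mul t1 t2 => eval_coef c t1 * eval_coef c t2
  end.

(* Main.v *)
From Stdlib Require Import Reals Ranalysis5 Lra Lia Psatz List.
From Coquelicot Require Import Coquelicot.
Require Import Defs.
Open Scope R_scope.

(** The proof computes the displacement along a perturbed orbit, and expands it on
    the generators of the Bautin ideal of the family.

    Along a solution, [H] has derivative [damping * y^2], so that the displacement is
    the integral of [damping y dx] over the perturbed orbit.  One direction of the
    parameter space, [y^2 - 3 a x^2 - 3 b x^4] with coordinate [v = lambda_3], is
    invisible at first order: it equals [d exact1 + cof1 dH].  Replacing [dH] by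
    [damping y dx] gives a form of second order, which is again exact modulo [dH],
    and hence a form of third order.  With [v_i] the five other coordinates and [h']
    the level after one turn, this gives the exact identity [displacement_identity],
    from which

      [h' - h = sum_i v_i (F_i(h) + o(1)) + v^3 (G(h) + o(1))]

    as the parameters tend to 0 ([displacement_expansion]).  Here [F_i] and [G] are
    integrals over the closed orbit of level [h]; they are combinations of [I_0] and
    [I_2] with polynomial coefficients in [h], and [h^2 I_2] occurs only in [G].  The
    passage to the limit needs that the perturbed orbit and its return time converge
    to the closed orbit and its period ([return_close]).

    The six functions [h^i I_0], [h^i I_2], [i <= 2], are linearly independent, hence
    so are the [F_i] and [G].  Therefore, as long as the coefficients of the
    displacement vanish, the [v_i] vanish to the same order, and [v] to a third of
    that order ([generators_vanish]).  The first nonzero coefficient [M_n] is then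
    the combination of the [F_i] with the coefficients of [e^n] in the [v_i], plus,
    when [n = 3 m], the cube of the coefficient of [e^m] in [v] times [G].

    The independence uses neither derivatives in [h] nor asymptotic expansions.  On
    the unbounded annuli [I_2 / I_0] is of the order [sqrt h], which no rational
    function is.  On the bounded ones the period divided by [I_0] is a rational
    function of [h] and [I_2 / I_0]; near the saddle level it tends to infinity, but
    more slowly than the inverse of the distance to that level, which again no
    rational function does.  All the bounds come from integrating exact forms over
    the closed orbit. *)

(** * Calculus on the line and power series *)

Lemma derive_continuous (f : R -> R) x l : is_derive f x l -> continuous f x.
Proof. intros H. exact (ex_derive_continuous f x (ex_intro _ l H)). Qed.

Lemma continuous_eps (f : R -> R) x : continuous f x ->
  forall eps, 0 < eps -> exists del, 0 < del /\
    forall y, Rabs (y - x) < del -> Rabs (f y - f x) < eps.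
Proof.
intros Hf eps He.
destruct (proj1 (filterlim_locally f (f x)) Hf (mkposreal eps He)) as [d Hd].
exists d; split; [apply cond_pos|]. intros y Hy. apply Hd. exact Hy.
Qed.

Lemma derive_lipschitz (f : R -> R) x l : is_derive f x l ->
  exists del K, 0 < del /\ 0 <= K /\
    forall y, Rabs (y - x) < del -> Rabs (f y - f x) <= K * Rabs (y - x).
Proof.
intros [_ H].
destruct (H x (fun P HP => HP) (mkposreal 1 Rlt_0_1)) as [d Hd].
exists d, (Rabs l + 1); split; [apply cond_pos|]. split; [pose proof (Rabs_pos l); lra|].
intros y Hy. specialize (Hd y Hy). simpl in Hd.
unfold minus, plus, opp, scal, norm, mult in Hd; simpl in Hd.
unfold norm, mult in Hd; simpl in Hd. unfold abs in Hd; simpl in Hd.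
replace (f y - f x) with ((f y + - f x + - ((y + - x) * l)) + (y - x) * l) by ring.
eapply Rle_trans; [apply Rabs_triang|]. rewrite Rabs_mult.
unfold Rminus in *. nra.
Qed.

Lemma derive_bound (f df : R -> R) a b K : a <= b ->
  (forall t, a <= t <= b -> is_derive f t (df t)) ->
  (forall t, a <= t <= b -> df t <= K) -> f b - f a <= K * (b - a).
Proof.
intros Hab Hd HK.
destruct (MVT_gen f a b df) as [c [Hc He]].
- intros t Ht. apply Hd. rewrite Rmin_left, Rmax_right in Ht by lra. lra.
- intros t Ht. apply continuity_pt_filterlim.
  apply (derive_continuous f t (df t)), Hd. rewrite Rmin_left, Rmax_right in Ht by lra. lra.
- rewrite Rmin_left, Rmax_right in Hc by lra. rewrite He.
  apply Rmult_le_compat_r; [lra|]. now apply HK.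
Qed.

Lemma derive_bound_below (f df : R -> R) a b K : a <= b ->
  (forall t, a <= t <= b -> is_derive f t (df t)) ->
  (forall t, a <= t <= b -> K <= df t) -> K * (b - a) <= f b - f a.
Proof.
intros Hab Hd HK.
pose proof (derive_bound (fun t => - f t) (fun t => - df t) a b (- K) Hab) as H.
assert (- f b - - f a <= - K * (b - a)); [apply H|lra].
- intros t Ht. apply (is_derive_opp f t (df t)). now apply Hd.
- intros t Ht. specialize (HK t Ht). lra.
Qed.

(** The witness is the supremum of the times up to which [u <= 1] has held. *)
Lemma first_exit (u : R -> R) t1 : 0 <= t1 ->
  (forall t, 0 <= t <= t1 -> continuous u t) -> u 0 <= 1 -> 1 < u t1 ->
  exists t, 0 <= t <= t1 /\ 1 <= u t /\ forall s, 0 <= s <= t -> u s <= 1.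
Proof.
intros H0 Hc Hu0 Hu1.
set (S := fun t => 0 <= t <= t1 /\ forall s, 0 <= s <= t -> u s <= 1).
destruct (completeness S) as [m [Hub Hlub]].
- exists t1. intros t [Ht _]. lra.
- exists 0. split; [lra|]. intros s Hs. now replace s with 0 by lra.
- assert (Hm0 : 0 <= m).
  { apply Hub. split; [lra|]. intros s Hs. now replace s with 0 by lra. }
  assert (Hm1 : m <= t1). { apply Hlub. intros t [Ht _]. lra. }
  assert (Hlt : forall s, 0 <= s < m -> u s <= 1).
  { intros s Hs. destruct (Rle_lt_dec (u s) 1) as [|Hbad]; [easy|exfalso].
    assert (m <= s); [|lra]. apply Hlub. intros t [Ht Hts].
    destruct (Rle_lt_dec t s); [easy|]. specialize (Hts s). lra. }
  assert (Hum : u m <= 1).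
  { destruct (Rle_lt_dec (u m) 1) as [|Hbad]; [easy|exfalso].
    destruct (Req_dec m 0) as [->|Hmn]; [lra|].
    destruct (continuous_eps u m (Hc m ltac:(lra)) (u m - 1)) as [d [Hd Hdd]]; [lra|].
    set (s := Rmax 0 (m - d / 2)).
    assert (Hs : 0 <= s < m /\ m - s < d).
    { unfold s. split; [split; [apply Rmax_l|apply Rmax_lub_lt; lra]|].
      pose proof (Rmax_r 0 (m - d/2)). lra. }
    specialize (Hlt s (proj1 Hs)).
    assert (Hb : Rabs (u s - u m) < u m - 1). { apply Hdd. rewrite Rabs_left1; lra. }
    apply Rabs_def2 in Hb. lra. }
  exists m. split; [lra|]. split.
  + destruct (Rle_lt_dec 1 (u m)) as [|Hbad]; [easy|exfalso].
    destruct (continuous_eps u m (Hc m ltac:(lra)) (1 - u m)) as [d [Hd Hdd]]; [lra|].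
    assert (Hmt : m <> t1). { intros ->. lra. }
    set (s := Rmin t1 (m + d / 2)).
    assert (Hs : m < s <= t1 /\ s - m < d).
    { unfold s. split; [split; [apply Rmin_glb_lt; lra|apply Rmin_l]|].
      pose proof (Rmin_r t1 (m + d/2)). lra. }
    assert (s <= m); [|lra]. apply Hub. split; [lra|].
    intros r Hr. destruct (Rle_lt_dec r m) as [Hrm|Hrm].
    * destruct Hrm as [Hrm|Hrm]; [apply Hlt; lra | now rewrite Hrm].
    * assert (Hb : Rabs (u r - u m) < 1 - u m). { apply Hdd. rewrite Rabs_right; lra. }
      apply Rabs_def2 in Hb. lra.
  + intros s Hs. destruct (Rle_lt_or_eq_dec s m) as [Hsm|Hsm]; [lra|apply Hlt; lra|now rewrite Hsm].
Qed.

(** Gronwall's inequality for a vector field that is only locally Lipschitz: the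
    growth bound is known only where [u <= 1].  As long as this has held,
    [(u + m) exp (- K t)] decreases, so that [u] stays below the bound, which is
    less than 1, and the condition cannot fail later. *)
Lemma gronwall (u du : R -> R) (K m tau : R) :
  0 <= K -> 0 <= m -> u 0 = 0 ->
  (forall t, 0 <= t <= tau -> is_derive u t (du t)) ->
  (forall t, 0 <= t <= tau -> u t <= 1 -> du t <= K * (u t + m)) ->
  m * exp (K * tau) < 1 ->
  forall t, 0 <= t <= tau -> u t <= m * exp (K * tau).
Proof.
intros HK Hm H0 Hd Hu Hsmall.
assert (Hstep : forall t, 0 <= t <= tau -> (forall s, 0 <= s <= t -> u s <= 1) ->
                  u t + m <= m * exp (K * tau)).
{ intros t Ht Hs.
  set (w := fun s => (u s + m) * exp (- K * s)).
  assert (Hw : w t - w 0 <= 0 * (t - 0)).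
  { apply derive_bound with (df := fun s => (du s - K * (u s + m)) * exp (- K * s)); [lra| |].
    - intros s Hst. unfold w.
      assert (Hds : is_derive u s (du s)) by (apply Hd; lra).
      auto_derive; [now exists (du s)|].
      replace (Derive (fun r => u r) s) with (du s) by (symmetry; now apply is_derive_unique).
      ring.
    - intros s Hst. pose proof (exp_pos (- K * s)).
      assert (du s <= K * (u s + m)) by (apply Hu; [lra|apply Hs; lra]). nra. }
  unfold w in Hw. rewrite H0, Rmult_0_r, exp_0 in Hw.
  assert (He : exp (- K * t) * exp (K * t) = 1).
  { rewrite <- exp_plus. replace (- K * t + K * t) with 0 by ring. apply exp_0. }
  pose proof (exp_pos (K * t)) as Hp.
  assert (u t + m <= m * exp (K * t)).
  { replace (u t + m) with ((u t + m) * exp (- K * t) * exp (K * t))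
      by (rewrite Rmult_assoc, He; ring). nra. }
  assert (exp (K * t) <= exp (K * tau)).
  { destruct (Rle_lt_or_eq_dec (K * t) (K * tau)) as [Hl|Hl]; [nra| |now rewrite Hl; right].
    left. now apply exp_increasing. }
  nra. }
assert (Hall : forall t, 0 <= t <= tau -> u t <= 1).
{ intros t Ht. destruct (Rle_lt_dec (u t) 1) as [|Hbad]; [easy|exfalso].
  destruct (first_exit u t) as [s [Hs [Hs1 Hs2]]]; [lra| |lra|easy|].
  - intros r Hr. apply (derive_continuous u r (du r)), Hd. lra.
  - specialize (Hstep s ltac:(lra) Hs2). lra. }
intros t Ht. specialize (Hstep t Ht (fun s Hs => Hall s ltac:(lra))). lra.
Qed.

Lemma pseries_radius (a : nat -> R) (f : R -> R) x0 :
  locally x0 (fun x => is_pseries a (x - x0) (f x)) -> Rbar_lt 0 (CV_radius a).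
Proof.
intros [d Hd].
destruct (Rbar_lt_le_dec 0 (CV_radius a)) as [|Hbad]; [easy|exfalso].
pose proof (cond_pos d) as Hp.
assert (Hs : is_pseries a (d / 2) (f (x0 + d / 2))).
{ replace (d / 2) with (x0 + d / 2 - x0) at 1 by ring. apply Hd.
  unfold ball; simpl; unfold AbsRing_ball, abs, minus, plus, opp; simpl.
  rewrite Rabs_right; lra. }
apply (CV_disk_outside a (d / 2)).
- eapply Rbar_le_lt_trans; [exact Hbad|]. simpl. rewrite Rabs_right; lra.
- apply ex_series_lim_0. exists (f (x0 + d / 2)).
  apply is_pseries_R in Hs. exact Hs.
Qed.

Lemma analytic_is_derive f x0 : analytic_at f x0 -> exists l, is_derive f x0 l.
Proof.
intros [a Ha]. pose proof (pseries_radius a f x0 Ha) as Hr.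
exists (PSeries (PS_derive a) 0 * 1).
apply (is_derive_ext_loc (fun x => PSeries a (x - x0))).
- revert Ha. apply filter_imp. intros x Hx. now apply is_pseries_unique.
- assert (Hc : is_derive (PSeries a) (x0 - x0) (PSeries (PS_derive a) 0)).
  { rewrite Rminus_diag. apply is_derive_PSeries. now rewrite Rabs_R0. }
  pose proof (is_derive_comp (PSeries a) (fun x => x - x0) x0 _ 1 Hc) as H.
  unfold scal in H; simpl in H; unfold mult in H; simpl in H. rewrite Rmult_comm. apply H.
  auto_derive; [easy|ring].
Qed.

Lemma radius_decr_n (a : nat -> R) n : CV_radius (PS_decr_n a n) = CV_radius a.
Proof.
induction n as [|n IH].
- now apply CV_radius_ext.
- rewrite <- IH, <- (CV_radius_decr_1 (PS_decr_n a n)).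
  apply CV_radius_ext. intros k. unfold PS_decr_1, PS_decr_n. f_equal. lia.
Qed.

(** The quotient by [e^N] is again a power series, of the same radius of
    convergence, hence continuous at 0. *)
Lemma pseries_leading (a : nat -> R) (f : R -> R) N :
  locally 0 (fun e => is_pseries a e (f e)) ->
  (forall k, (k < N)%nat -> a k = 0) ->
  filterlim (fun e => f e / e ^ N) (at_right 0) (locally (a N)).
Proof.
intros Ha Hz.
assert (Hr : Rbar_lt 0 (CV_radius a)).
{ apply (pseries_radius a f 0). revert Ha. apply filter_imp. intros e. now rewrite Rminus_0_r. }
assert (Hr' : Rbar_lt 0 (CV_radius (PS_decr_n a N))) by now rewrite radius_decr_n.
assert (Hlim : filterlim (PSeries (PS_decr_n a N)) (at_right 0) (locally (a N))).
{ replace (a N) with (PSeries (PS_decr_n a N) 0)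
    by (rewrite PSeries_0; unfold PS_decr_n; f_equal; lia).
  eapply filterlim_filter_le_1; [apply filter_le_within|].
  apply (ex_derive_continuous (PSeries (PS_decr_n a N))), ex_derive_PSeries. now rewrite Rabs_R0. }
revert Hlim. apply filterlim_ext_loc.
unfold at_right, within. revert Ha. apply filter_imp. intros e He Hpos.
rewrite <- (is_pseries_unique _ _ _ He).
rewrite (PSeries_decr_n_aux a N e Hz).
field. apply pow_nonzero. lra.
Qed.

(** * Polynomials along orbits, and continuous dependence on the parameters *)

(** Polynomials in the two phase variables, kept as syntax: integrability along
    orbits, Lipschitz bounds and time derivatives then follow by induction, once
    for all integrands. *)
Inductive bipoly : Type :=
  | Const (r : R)
  | X
  | Y
  | Sum (P Q : bipoly)
  | Prod (P Q : bipoly)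
  | Pow (P : bipoly) (n : nat).

Declare Scope bipoly_scope.
Delimit Scope bipoly_scope with P.
Bind Scope bipoly_scope with bipoly.
Infix "+" := Sum : bipoly_scope.
Infix "*" := Prod : bipoly_scope.
Infix "^" := Pow : bipoly_scope.
Notation "- P" := (Prod (Const (-1)) P) : bipoly_scope.
Notation "P - Q" := (Sum P (Prod (Const (-1)) Q)) : bipoly_scope.

Fixpoint ev (P : bipoly) (u w : R) : R :=
  match P with
  | Const r => r
  | X => u
  | Y => w
  | Sum P Q => ev P u w + ev Q u w
  | Prod P Q => ev P u w * ev Q u w
  | Pow P n => ev P u w ^ n
  end.

(** The derivative along the vector field with parameter [l]. *)
Fixpoint lie (A : annulus) (l : param -> R) (P : bipoly) (u w : R) : R :=
  match P with
  | Const _ => 0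
  | X => w
  | Y => - (coef_a A * u + coef_b A * u ^ 3) + damping l u w * w
  | Sum P Q => lie A l P u w + lie A l Q u w
  | Prod P Q => lie A l P u w * ev Q u w + ev P u w * lie A l Q u w
  | Pow P n => INR n * ev P u w ^ pred n * lie A l P u w
  end.

Definition null : param -> R := fun _ => 0.

Lemma damping_null u w : damping null u w = 0.
Proof. unfold damping, null. ring. Qed.

Lemma ev_derive A l x y T P t : solution A l x y T -> 0 <= t <= T ->
  is_derive (fun s => ev P (x s) (y s)) t (lie A l P (x t) (y t)).
Proof.
intros Hs Ht. destruct (Hs t Ht) as [Hx Hy].
induction P as [r| | |P IHP Q IHQ|P IHP Q IHQ|P IHP n]; simpl.
- apply (is_derive_const r).
- exact Hx.
- exact Hy.
- now apply (is_derive_plus (fun s => ev P (x s) (y s))).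
- apply (is_derive_mult (fun s => ev P (x s) (y s)) (fun s => ev Q (x s) (y s))); trivial.
  intros; apply Rmult_comm.
- replace (INR n * ev P (x t) (y t) ^ Init.Nat.pred n * lie A l P (x t) (y t))
    with (INR n * lie A l P (x t) (y t) * ev P (x t) (y t) ^ Init.Nat.pred n) by ring.
  now apply (is_derive_pow (fun s => ev P (x s) (y s))).
Qed.

Lemma ev_continuous A l x y T P t : solution A l x y T -> 0 <= t <= T ->
  continuous (fun s => ev P (x s) (y s)) t.
Proof. intros Hs Ht. eapply derive_continuous, ev_derive; eassumption. Qed.

(** The bound on the values accompanies the Lipschitz bound because the
    induction needs both at a product. *)
Lemma ev_lipschitz P B : exists K, 0 <= K /\ forall u w u' w',
  Rabs u <= B -> Rabs w <= B -> Rabs u' <= B -> Rabs w' <= B ->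
  Rabs (ev P u w - ev P u' w') <= K * (Rabs (u - u') + Rabs (w - w')) /\
  Rabs (ev P u w) <= K.
Proof.
assert (Hprod : forall P Q,
  (exists K, 0 <= K /\ forall u w u' w',
    Rabs u <= B -> Rabs w <= B -> Rabs u' <= B -> Rabs w' <= B ->
    Rabs (ev P u w - ev P u' w') <= K * (Rabs (u - u') + Rabs (w - w')) /\
    Rabs (ev P u w) <= K) ->
  (exists K, 0 <= K /\ forall u w u' w',
    Rabs u <= B -> Rabs w <= B -> Rabs u' <= B -> Rabs w' <= B ->
    Rabs (ev Q u w - ev Q u' w') <= K * (Rabs (u - u') + Rabs (w - w')) /\
    Rabs (ev Q u w) <= K) ->
  exists K, 0 <= K /\ forall u w u' w',
    Rabs u <= B -> Rabs w <= B -> Rabs u' <= B -> Rabs w' <= B ->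
    Rabs (ev P u w * ev Q u w - ev P u' w' * ev Q u' w')
      <= K * (Rabs (u - u') + Rabs (w - w')) /\
    Rabs (ev P u w * ev Q u w) <= K).
{ clear P. intros P Q [K [HK HP]] [L [HL HQ]].
  exists (2 * K * L). split; [nra|].
  intros u w u' w' Hu Hw Hu' Hw'.
  destruct (HP u w u' w' Hu Hw Hu' Hw') as [HP1 HP2].
  destruct (HQ u w u' w' Hu Hw Hu' Hw') as [HQ1 HQ2].
  destruct (HP u' w' u w Hu' Hw' Hu Hw) as [_ HP3].
  pose proof (Rabs_pos (u - u')). pose proof (Rabs_pos (w - w')).
  pose proof (Rabs_pos (ev P u w)). pose proof (Rabs_pos (ev Q u w)).
  pose proof (Rabs_pos (ev P u' w')).
  pose proof (Rabs_pos (ev P u w - ev P u' w')).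
  pose proof (Rabs_pos (ev Q u w - ev Q u' w')).
  split.
  - replace (ev P u w * ev Q u w - ev P u' w' * ev Q u' w')
      with ((ev P u w - ev P u' w') * ev Q u w + ev P u' w' * (ev Q u w - ev Q u' w')) by ring.
    eapply Rle_trans; [apply Rabs_triang|]. rewrite !Rabs_mult.
    set (s := Rabs (u - u') + Rabs (w - w')) in *.
    assert (Rabs (ev P u w - ev P u' w') * Rabs (ev Q u w) <= K * s * L)
      by (apply Rmult_le_compat; lra).
    assert (Rabs (ev P u' w') * Rabs (ev Q u w - ev Q u' w') <= K * (L * s))
      by (apply Rmult_le_compat; lra).
    lra.
  - rewrite Rabs_mult.
    assert (Rabs (ev P u w) * Rabs (ev Q u w) <= K * L) by (apply Rmult_le_compat; lra).
    nra. }
induction P as [r| | |P IHP Q IHQ|P IHP Q IHQ|P IHP n]; simpl.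
- exists (Rabs r). split; [apply Rabs_pos|]. intros u w u' w' _ _ _ _.
  rewrite Rminus_diag, Rabs_R0. pose proof (Rabs_pos (u - u')). pose proof (Rabs_pos (w - w')).
  pose proof (Rabs_pos r). split; [nra|lra].
- exists (1 + Rabs B). pose proof (Rabs_pos B). pose proof (Rle_abs B). split; [lra|].
  intros u w u' w' Hu _ _ _.
  pose proof (Rabs_pos (u - u')). pose proof (Rabs_pos (w - w')). split; [nra|lra].
- exists (1 + Rabs B). pose proof (Rabs_pos B). pose proof (Rle_abs B). split; [lra|].
  intros u w u' w' _ Hw _ _.
  pose proof (Rabs_pos (u - u')). pose proof (Rabs_pos (w - w')). split; [nra|lra].
- destruct IHP as [K [HK HP]], IHQ as [L [HL HQ]].
  exists (K + L). split; [lra|]. intros u w u' w' Hu Hw Hu' Hw'.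
  destruct (HP u w u' w' Hu Hw Hu' Hw') as [HP1 HP2].
  destruct (HQ u w u' w' Hu Hw Hu' Hw') as [HQ1 HQ2].
  split.
  + replace (ev P u w + ev Q u w - (ev P u' w' + ev Q u' w'))
      with ((ev P u w - ev P u' w') + (ev Q u w - ev Q u' w')) by ring.
    eapply Rle_trans; [apply Rabs_triang|]. lra.
  + eapply Rle_trans; [apply Rabs_triang|]. lra.
- now apply Hprod.
- induction n as [|n IHn]; simpl.
  + exists 1. split; [lra|]. intros u w u' w' _ _ _ _.
    rewrite Rminus_diag, Rabs_R0, Rabs_R1. pose proof (Rabs_pos (u - u')).
    pose proof (Rabs_pos (w - w')). split; lra.
  + exact (Hprod P (Pow P n) IHP IHn).
Qed.

Lemma solution_bounded A l x y T : 0 <= T -> solution A l x y T ->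
  exists B, 0 <= B /\ forall t, 0 <= t <= T -> Rabs (x t) <= B /\ Rabs (y t) <= B.
Proof.
intros HT Hs.
destruct (continuity_ab_maj (fun t => ev (X ^ 2 + Y ^ 2)%P (x t) (y t)) 0 T HT) as [m [Hm _]].
{ intros t Ht. apply continuity_pt_filterlim. eapply ev_continuous; eassumption. }
simpl in Hm. set (M := x m * (x m * 1) + y m * (y m * 1)) in Hm.
exists (M + 1). assert (0 <= M) by (unfold M; nra).
split; [lra|].
intros t Ht. specialize (Hm t Ht). simpl in Hm. split; apply Rabs_le; nra.
Qed.

Lemma damping_bound B : 0 <= B -> exists C, 0 <= C /\ forall l mu u w,
  (forall j, Rabs (l j) <= mu) -> Rabs u <= B -> Rabs w <= B ->
  Rabs (damping l u w * w) <= C * mu.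
Proof.
intros HB.
exists ((1 + B ^ 2 + B ^ 2 + B ^ 4 + B ^ 4 + B ^ 6) * B).
assert (forall k, 0 <= B ^ k) by (intros; now apply pow_le).
split. { apply Rmult_le_pos; [|easy]. pose proof (H 2%nat). pose proof (H 4%nat). pose proof (H 6%nat). lra. }
intros l mu u w Hl Hu Hw.
assert (Ht : forall j v k, Rabs v <= B -> Rabs (l j * v ^ k) <= mu * B ^ k).
{ intros j v k Hv. rewrite Rabs_mult, <- RPow_abs.
  apply Rmult_le_compat; [apply Rabs_pos| |easy|].
  - apply pow_le, Rabs_pos.
  - apply pow_incr. split; [apply Rabs_pos|easy]. }
rewrite Rabs_mult.
replace ((1 + B ^ 2 + B ^ 2 + B ^ 4 + B ^ 4 + B ^ 6) * B * mu)
  with ((mu + mu * B ^ 2 + mu * B ^ 2 + mu * B ^ 4 + mu * B ^ 4 + mu * B ^ 6) * B) by ring.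
apply Rmult_le_compat; [apply Rabs_pos|apply Rabs_pos| |easy].
unfold damping.
repeat (eapply Rle_trans; [apply Rabs_triang|]; apply Rplus_le_compat; [|now apply Ht]).
apply Hl.
Qed.

Lemma abs_lt_of_sq p eps : 0 < eps -> p ^ 2 < eps ^ 2 -> Rabs p < eps.
Proof.
intros He Hp. rewrite <- (pow2_abs p) in Hp. pose proof (Rabs_pos p).
destruct (Rlt_le_dec (Rabs p) eps); [easy|nra].
Qed.

(** Gronwall's inequality for the squared distance; the estimate of the vector
    field holds on the unit neighbourhood of the unperturbed orbit, which the
    perturbed orbit does not leave when the parameters are small. *)
Lemma solutions_close A x y T : 0 <= T -> solution A null x y T ->
  forall eps, 0 < eps -> exists mu, 0 < mu /\ forall l x' y' T',
    (forall j, Rabs (l j) <= mu) -> T' <= T -> solution A l x' y' T' ->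
    x' 0 = x 0 -> y' 0 = y 0 ->
    forall t, 0 <= t <= T' -> Rabs (x' t - x t) < eps /\ Rabs (y' t - y t) < eps.
Proof.
intros HT Hs eps Heps.
destruct (solution_bounded _ _ _ _ _ HT Hs) as [B [HB HxB]].
set (F := (- (Const (coef_a A) * X + Const (coef_b A) * X ^ 3))%P).
destruct (ev_lipschitz F (B + 1)) as [K1 [HK1 HF]].
destruct (damping_bound (B + 1)) as [C [HC HD]]; [lra|].
set (K := 2 + 3 * K1 + C ^ 2).
assert (HK : 0 <= K) by (unfold K; pose proof (pow2_ge_0 C); lra).
pose proof (exp_pos (K * T)) as HE.
set (mu := Rmin 1 (Rmin 1 (eps ^ 2) / (2 * exp (K * T)))).
assert (Hmin : 0 < Rmin 1 (eps ^ 2)) by (apply Rmin_glb_lt; [lra|nra]).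
assert (Hmu : 0 < mu).
{ apply Rmin_glb_lt; [lra|]. apply Rdiv_lt_0_compat; lra. }
assert (Hmu1 : mu <= 1) by apply Rmin_l.
assert (HmuE : mu * exp (K * T) < Rmin 1 (eps ^ 2)).
{ assert (Hr : mu <= Rmin 1 (eps ^ 2) / (2 * exp (K * T))) by apply Rmin_r.
  apply Rle_lt_trans with (Rmin 1 (eps ^ 2) / (2 * exp (K * T)) * exp (K * T)).
  - apply Rmult_le_compat_r; lra.
  - replace (Rmin 1 (eps ^ 2) / (2 * exp (K * T)) * exp (K * T)) with (Rmin 1 (eps ^ 2) / 2)
      by (field; lra). lra. }
exists mu. split; [easy|].
intros l x' y' T' Hl HT' Hs' Hx0 Hy0 t Ht.
set (u := fun s => (x' s - x s) ^ 2 + (y' s - y s) ^ 2).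
set (du := fun s => 2 * (x' s - x s) * (y' s - y s) + 2 * (y' s - y s) *
   ((ev F (x' s) (y' s) + damping l (x' s) (y' s) * y' s) - ev F (x s) (y s))).
assert (HexpT : exp (K * T') <= exp (K * T)).
{ destruct (Rle_lt_or_eq_dec (K * T') (K * T)) as [Hl'|Hl']; [nra| |now rewrite Hl'; right].
  left. now apply exp_increasing. }
assert (Hbound : u t <= mu * exp (K * T')).
{ apply gronwall with (du := du); try easy.
  - lra.
  - unfold u. rewrite Hx0, Hy0. ring.
  - intros s Hst. destruct (Hs s ltac:(lra)) as [Hdx Hdy].
    destruct (Hs' s Hst) as [Hdx' Hdy'].
    unfold u. auto_derive.
    + repeat split; eexists; eassumption.
    + replace (Derive (fun r => x r) s) with (y s) by (symmetry; now apply is_derive_unique).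
      replace (Derive (fun r => x' r) s) with (y' s) by (symmetry; now apply is_derive_unique).
      replace (Derive (fun r => y r) s) with (- (coef_a A * x s + coef_b A * x s ^ 3)
        + damping null (x s) (y s) * y s) by (symmetry; now apply is_derive_unique).
      replace (Derive (fun r => y' r) s) with (- (coef_a A * x' s + coef_b A * x' s ^ 3)
        + damping l (x' s) (y' s) * y' s) by (symmetry; now apply is_derive_unique).
      rewrite damping_null. unfold du, F. simpl. ring.
  - intros s Hst Hu1. unfold u in *.
    destruct (HxB s ltac:(lra)) as [Hbx Hby].
    set (p := x' s - x s) in *. set (q := y' s - y s) in *.
    assert (Hp1 : Rabs p <= 1) by (apply Rabs_le; nra).
    assert (Hq1 : Rabs q <= 1) by (apply Rabs_le; nra).
    assert (Hbx' : Rabs (x' s) <= B + 1).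
    { replace (x' s) with (x s + p) by (unfold p; ring).
      eapply Rle_trans; [apply Rabs_triang|]. lra. }
    assert (Hby' : Rabs (y' s) <= B + 1).
    { replace (y' s) with (y s + q) by (unfold q; ring).
      eapply Rle_trans; [apply Rabs_triang|]. lra. }
    destruct (HF (x' s) (y' s) (x s) (y s)) as [HF1 _]; [lra|lra|lra|lra|].
    specialize (HD l mu (x' s) (y' s) Hl Hbx' Hby').
    set (f := ev F (x' s) (y' s) - ev F (x s) (y s)) in *.
    set (g := damping l (x' s) (y' s) * y' s) in *.
    unfold du. fold p q g.
    replace (ev F (x' s) (y' s) + g - ev F (x s) (y s)) with (f + g) by (unfold f; ring).
    fold p q in HF1.
    assert (Hfg : q * (f + g) <= Rabs q * (K1 * (Rabs p + Rabs q) + C * mu)).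
    { eapply Rle_trans; [apply Rle_abs|]. rewrite Rabs_mult.
      apply Rmult_le_compat_l; [apply Rabs_pos|].
      eapply Rle_trans; [apply Rabs_triang|]. lra. }
    assert (Hpq : p * q <= Rabs p * Rabs q) by (rewrite <- Rabs_mult; apply Rle_abs).
    pose proof (Rabs_pos p). pose proof (Rabs_pos q).
    rewrite <- (pow2_abs p), <- (pow2_abs q).
    set (ap := Rabs p) in *. set (aq := Rabs q) in *. unfold K.
    assert (H1 : 2 * (ap * aq) <= ap ^ 2 + aq ^ 2) by (pose proof (pow2_ge_0 (ap - aq)); nra).
    assert (H2 : 2 * (aq * (C * mu)) <= aq ^ 2 + C ^ 2 * mu).
    { assert (2 * (aq * (C * mu)) <= aq ^ 2 + (C * mu) ^ 2)
        by (pose proof (pow2_ge_0 (aq - C * mu)); nra).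
      assert ((C * mu) ^ 2 <= C ^ 2 * mu).
      { replace ((C * mu) ^ 2) with (C ^ 2 * (mu * mu)) by ring.
        apply Rmult_le_compat_l; [apply pow2_ge_0|nra]. }
      lra. }
    assert (H3 : K1 * (2 * (ap * aq)) <= K1 * (ap ^ 2 + aq ^ 2)) by (apply Rmult_le_compat_l; lra).
    assert (0 <= C ^ 2 * (ap ^ 2 + aq ^ 2)) by (apply Rmult_le_pos; [apply pow2_ge_0|nra]).
    assert (0 <= K1 * ap ^ 2) by (apply Rmult_le_pos; [easy|apply pow2_ge_0]).
    assert (0 <= K1 * mu) by nra.
    pose proof (pow2_ge_0 ap). pose proof (pow2_ge_0 aq).
    nra.
  - apply Rle_lt_trans with (mu * exp (K * T)); [apply Rmult_le_compat_l; lra|].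
    pose proof (Rmin_l 1 (eps ^ 2)). lra. }
assert (Hu : u t < eps ^ 2).
{ apply Rle_lt_trans with (mu * exp (K * T)).
  - eapply Rle_trans; [exact Hbound|]. apply Rmult_le_compat_l; lra.
  - pose proof (Rmin_r 1 (eps ^ 2)). lra. }
unfold u in Hu.
pose proof (pow2_ge_0 (x' t - x t)). pose proof (pow2_ge_0 (y' t - y t)).
split; apply abs_lt_of_sq; lra.
Qed.

(** * Closed orbits *)

Definition glue (f g : R -> R) (a t : R) : R := if Rle_dec t a then f t else g (t - a).

Lemma glue_left f g a t : t <= a -> glue f g a t = f t.
Proof. intros H. unfold glue. destruct (Rle_dec t a); [easy|lra]. Qed.

Lemma glue_right f g a t : f a = g 0 -> a <= t -> glue f g a t = g (t - a).
Proof.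
intros Hfg H. unfold glue. destruct (Rle_dec t a) as [Hle|]; [|easy].
replace t with a by lra. now rewrite Rminus_diag.
Qed.

Lemma is_derive_shift (g : R -> R) a t l :
  is_derive g (t - a) l -> is_derive (fun s => g (s - a)) t l.
Proof.
intros H. pose proof (is_derive_comp g (fun s => s - a) t l 1 H) as Hc.
replace l with (scal 1 l) by (unfold scal; simpl; unfold mult; simpl; ring).
apply Hc. auto_derive; [easy|ring].
Qed.

Lemma glue_derive (f g : R -> R) a t l : f a = g 0 ->
  (t <= a -> is_derive f t l) -> (a <= t -> is_derive g (t - a) l) ->
  is_derive (glue f g a) t l.
Proof.
intros Hfg Hf Hg.
destruct (Rtotal_order t a) as [Hlt|[Heq|Hgt]].
- apply (is_derive_ext_loc f); [|apply Hf; lra].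
  assert (Hp : 0 < a - t) by lra. exists (mkposreal _ Hp). intros s Hs.
  symmetry. apply glue_left.
  unfold ball in Hs; simpl in Hs; unfold AbsRing_ball, abs, minus, plus, opp in Hs; simpl in Hs.
  apply Rabs_def2 in Hs. lra.
- subst t. specialize (Hf (Rle_refl a)). specialize (Hg (Rle_refl a)).
  apply is_derive_shift in Hg.
  split; [apply (proj1 Hf)|].
  intros c Hc eps.
  assert (Hca : c = a) by (symmetry; now apply (is_filter_lim_locally_unique (V := R_NormedModule))).
  subst c.
  destruct Hf as [_ Hf], Hg as [_ Hg].
  specialize (Hf a (fun P HP => HP) eps). specialize (Hg a (fun P HP => HP) eps).
  generalize (filter_and _ _ Hf Hg). apply filter_imp.
  intros s [H1 H2].
  rewrite (glue_left f g a a (Rle_refl a)).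
  destruct (Rle_dec s a) as [Hs|Hs].
  + now rewrite glue_left.
  + rewrite glue_right by (easy || lra). rewrite Hfg.
    rewrite Rminus_diag in H2. exact H2.
- apply (is_derive_ext_loc (fun s => g (s - a))); [|apply is_derive_shift, Hg; lra].
  assert (Hp : 0 < t - a) by lra. exists (mkposreal _ Hp). intros s Hs.
  symmetry. apply glue_right; [easy|].
  unfold ball in Hs; simpl in Hs; unfold AbsRing_ball, abs, minus, plus, opp in Hs; simpl in Hs.
  apply Rabs_def2 in Hs. lra.
Qed.

Lemma solution_glue A l x y T x' y' T' : 
  solution A l x y T -> solution A l x' y' T' -> x T = x' 0 -> y T = y' 0 ->
  solution A l (glue x x' T) (glue y y' T) (T + T').
Proof.
intros Hs Hs' Hx Hy t Ht.
destruct (Rle_lt_dec t T) as [Hle|Hlt].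
- rewrite !(glue_left _ _ _ _ Hle).
  split; apply glue_derive; trivial.
  + intros _. apply Hs. lra.
  + intros Hge. assert (t = T) as -> by lra. rewrite Rminus_diag, Hy. apply Hs'. lra.
  + intros _. apply Hs. lra.
  + intros Hge. assert (t = T) as -> by lra. rewrite Rminus_diag, Hx, Hy. apply Hs'. lra.
- rewrite !glue_right by (easy || lra).
  split; apply glue_derive; trivial; intros; try lra; apply Hs'; lra.
Qed.

Lemma solution_shift A l x y T s : 0 <= s -> solution A l x y (s + T) ->
  solution A l (fun t => x (t + s)) (fun t => y (t + s)) T.
Proof.
intros Hs0 Hs t Ht. destruct (Hs (t + s)) as [Hx Hy]; [lra|].
split.
- apply (is_derive_ext (fun r => x (r - - s))); [intros r; f_equal; ring|].
  apply is_derive_shift. now replace (t - - s) with (t + s) by ring.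
- apply (is_derive_ext (fun r => y (r - - s))); [intros r; f_equal; ring|].
  apply is_derive_shift. now replace (t - - s) with (t + s) by ring.
Qed.

Lemma solution_restrict A l x y T T' : T' <= T -> solution A l x y T -> solution A l x y T'.
Proof. intros HT Hs t Ht. apply Hs. lra. Qed.

(** The periodic orbit of level [h] through [(p, q)], of minimal period [T].  It
    is followed for two periods, since a perturbed orbit may return after [T]. *)
Definition loop (A : annulus) (h : R) (x y : R -> R) (T p q : R) : Prop :=
  0 < T /\ solution A null x y (2 * T) /\
  x 0 = p /\ y 0 = q /\ x T = p /\ y T = q /\
  (forall t, 0 < t < T -> ~ (x t = p /\ y t = q)) /\
  (forall t, 0 <= t <= 2 * T -> oval A h (x t) (y t)).

Definition integral (x y : R -> R) (T : R) (P : bipoly) : R :=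
  RInt (fun t => ev P (x t) (y t)) 0 T.

Lemma is_RInt_shift (f : R -> R) a b c v :
  is_RInt f (a + c) (b + c) v -> is_RInt (fun t => f (t + c)) a b v.
Proof.
intros H.
apply (is_RInt_ext (fun t => scal 1 (f (1 * t + c)))).
- intros t _. unfold scal; simpl; unfold mult; simpl. rewrite Rmult_1_l. f_equal. ring.
- apply (is_RInt_comp_lin f 1 c a b). now rewrite !Rmult_1_l.
Qed.

Lemma periodic_integral (f : R -> R) T t0 : 0 <= t0 <= T ->
  (forall t, 0 <= t <= T -> f (t + T) = f t) -> ex_RInt f 0 (T + t0) ->
  RInt (fun t => f (t + t0)) 0 T = RInt f 0 T.
Proof.
intros Ht Hper Hex.
assert (Hex1 : ex_RInt f 0 T) by (apply (ex_RInt_Chasles_1 (V := R_CompleteNormedModule) f 0 T (T + t0)); [lra|easy]).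
assert (Ha : is_RInt f 0 t0 (RInt f 0 t0)).
{ apply (RInt_correct (V := R_CompleteNormedModule)). now apply (ex_RInt_Chasles_1 (V := R_CompleteNormedModule) f 0 t0 T). }
assert (Hb : is_RInt f t0 T (RInt f t0 T)).
{ apply (RInt_correct (V := R_CompleteNormedModule)). now apply (ex_RInt_Chasles_2 (V := R_CompleteNormedModule) f 0 t0 T). }
assert (Hc : is_RInt f T (T + t0) (RInt f T (T + t0))).
{ apply (RInt_correct (V := R_CompleteNormedModule)). apply (ex_RInt_Chasles_2 (V := R_CompleteNormedModule) f 0 T (T + t0)); [lra|easy]. }
assert (Hca : RInt f T (T + t0) = RInt f 0 t0).
{ symmetry. apply (is_RInt_unique (V := R_CompleteNormedModule)).
  apply (is_RInt_ext (fun t => f (t + T))).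
  - intros t Hrt. apply Hper. rewrite Rmin_left, Rmax_right in Hrt by lra. lra.
  - apply is_RInt_shift. now rewrite Rplus_0_l, (Rplus_comm t0). }
rewrite (is_RInt_unique _ _ _ _ (is_RInt_Chasles _ _ _ _ _ _ Ha Hb)).
apply (is_RInt_unique (V := R_CompleteNormedModule)), is_RInt_shift. rewrite Rplus_0_l.
rewrite plus_comm, <- Hca. now apply (is_RInt_Chasles f t0 T (T + t0)).
Qed.

Lemma ev_integrable A l x y T P a b : solution A l x y T -> 0 <= a <= b -> b <= T ->
  ex_RInt (fun t => ev P (x t) (y t)) a b.
Proof.
intros Hs Ha Hb. apply (ex_RInt_continuous (V := R_CompleteNormedModule)).
intros t Ht. rewrite Rmin_left, Rmax_right in Ht by lra.
apply (ev_continuous A l x y T); [easy|lra].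
Qed.

(** A parametrization of the oval starts anywhere and lasts one period.  Three
    copies of it, glued and shifted, give the orbit from the required point for
    two periods. *)
Lemma loop_of_parametrization A h x y T p q :
  oval_parametrization A h x y T -> oval A h p q ->
  exists x' y', loop A h x' y' T p q /\
    forall P, integral x' y' T P = integral x y T P.
Proof.
intros (HT & Hs & Hx & Hy & Hinj & Hov) Hpq.
apply Hov in Hpq. destruct Hpq as [t0 [Ht0 [Hp Hq]]].
set (x3 := glue x (glue x x T) T). set (y3 := glue y (glue y y T) T).
assert (Hs3 : solution A null x3 y3 (T + (T + T))).
{ apply solution_glue; [easy|now apply solution_glue| |]; rewrite glue_left; lra. }
assert (Hx1 : forall t, t <= T -> x3 t = x t) by (intros t Ht; now apply glue_left).
assert (Hy1 : forall t, t <= T -> y3 t = y t) by (intros t Ht; now apply glue_left).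
assert (Hx2 : forall t, T <= t <= T + T -> x3 t = x (t - T)).
{ intros t Ht. unfold x3. rewrite glue_right, glue_left; try lra. rewrite glue_left; lra. }
assert (Hy2 : forall t, T <= t <= T + T -> y3 t = y (t - T)).
{ intros t Ht. unfold y3. rewrite glue_right, glue_left; try lra. rewrite glue_left; lra. }
assert (Hx3 : forall t, T + T <= t -> x3 t = x (t - T - T)).
{ intros t Ht. unfold x3. rewrite (glue_right x), glue_right; try lra. rewrite glue_left; lra. }
assert (Hy3 : forall t, T + T <= t -> y3 t = y (t - T - T)).
{ intros t Ht. unfold y3. rewrite (glue_right y), glue_right; try lra. rewrite glue_left; lra. }
assert (Hov1 : forall t, 0 <= t <= T -> oval A h (x t) (y t)).
{ intros t Ht. apply Hov. destruct (Req_dec t T) as [->|].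
  - exists 0. repeat split; try lra; congruence.
  - exists t. repeat split; lra. }
assert (Hper : forall t, 0 <= t <= T -> x3 (t + T) = x3 t /\ y3 (t + T) = y3 t).
{ intros t Ht. rewrite Hx2, Hy2, Hx1, Hy1 by lra. now replace (t + T - T) with t by ring. }
exists (fun t => x3 (t + t0)), (fun t => y3 (t + t0)). split.
- split; [easy|]. split.
  { apply solution_shift; [lra|]. apply (solution_restrict _ _ _ _ (T + (T + T))); [lra|easy]. }
  rewrite !Rplus_0_l, !Hx1, !Hy1 by lra.
  split; [easy|]. split; [easy|].
  rewrite Hx2, Hy2 by lra. replace (T + t0 - T) with t0 by ring.
  split; [easy|]. split; [easy|]. split.
  + intros t Ht [Htx Hty]. rewrite <- Hp in Htx. rewrite <- Hq in Hty.
    destruct (Rtotal_order (t + t0) T) as [Hlt|[Heq|Hgt]].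
    * rewrite Hx1 in Htx by lra. rewrite Hy1 in Hty by lra.
      specialize (Hinj (t + t0) t0 ltac:(lra) ltac:(lra) Htx Hty). lra.
    * rewrite Heq, Hx1, Hx in Htx by lra. rewrite Heq, Hy1, Hy in Hty by lra.
      specialize (Hinj 0 t0 ltac:(lra) ltac:(lra) Htx Hty). lra.
    * rewrite Hx2 in Htx by lra. rewrite Hy2 in Hty by lra.
      specialize (Hinj (t + t0 - T) t0 ltac:(lra) ltac:(lra) Htx Hty). lra.
  + intros t Ht.
    destruct (Rle_lt_dec (t + t0) T) as [Hlt|Hgt].
    * rewrite Hx1, Hy1 by easy. apply Hov1. lra.
    * destruct (Rle_lt_dec (t + t0) (T + T)).
      -- rewrite Hx2, Hy2 by lra. apply Hov1. lra.
      -- rewrite Hx3, Hy3 by lra. apply Hov1. lra.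
- intros P. unfold integral.
  rewrite (periodic_integral (fun t => ev P (x3 t) (y3 t)) T t0); [|lra| |].
  + apply RInt_ext. intros t Ht. rewrite Rmin_left, Rmax_right in Ht by lra.
    rewrite Hx1, Hy1; lra.
  + intros t Ht. destruct (Hper t Ht) as [Hpx Hpy]. now rewrite Hpx, Hpy.
  + apply (ev_integrable A null _ _ (T + (T + T))); [easy|lra|lra].
Qed.

(** [solutions_close] with zero perturbation. *)
Lemma solution_unique A x y x' y' T T' : 0 <= T' <= T ->
  solution A null x y T -> solution A null x' y' T' ->
  x' 0 = x 0 -> y' 0 = y 0 ->
  forall t, 0 <= t <= T' -> x' t = x t /\ y' t = y t.
Proof.
intros HT Hs Hs' Hx Hy t Ht.
assert (H : forall eps, 0 < eps -> Rabs (x' t - x t) < eps /\ Rabs (y' t - y t) < eps).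
{ intros eps He. destruct (solutions_close A x y T ltac:(lra) Hs eps He) as [mu [Hmu Hc]].
  apply (Hc null x' y' T'); trivial; [|lra].
  intros j. unfold null. rewrite Rabs_R0. lra. }
split.
- destruct (Req_dec (x' t) (x t)) as [|Hne]; [easy|exfalso].
  destruct (H (Rabs (x' t - x t))) as [H1 _]; [apply Rabs_pos_lt; lra|lra].
- destruct (Req_dec (y' t) (y t)) as [|Hne]; [easy|exfalso].
  destruct (H (Rabs (y' t - y t))) as [_ H1]; [apply Rabs_pos_lt; lra|lra].
Qed.

Lemma loop_period_le A h x y T x' y' T' p q :
  loop A h x y T p q -> loop A h x' y' T' p q -> T <= T'.
Proof.
intros (HT & Hs & Hx0 & Hy0 & HxT & HyT & Hno & _) (HT' & Hs' & Hx0' & Hy0' & HxT' & HyT' & Hno' & _).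
destruct (Rle_lt_dec T T') as [|Hlt]; [easy|exfalso].
destruct (solution_unique A x y x' y' (2 * T) (2 * T')) with (t := T') as [Hx Hy];
  try easy; try lra; try congruence.
apply (Hno T'); [lra|]. split; congruence.
Qed.

Lemma loop_integral_unique A h x y T x' y' T' p q P :
  loop A h x y T p q -> loop A h x' y' T' p q ->
  integral x' y' T' P = integral x y T P.
Proof.
intros H H'.
assert (HT : T' = T).
{ apply Rle_antisym; eapply loop_period_le; eassumption. }
subst T'. apply RInt_ext. intros t Ht.
destruct H as (HT & Hs & Hx0 & Hy0 & _), H' as (HT' & Hs' & Hx0' & Hy0' & _).
rewrite Rmin_left, Rmax_right in Ht by lra.
destruct (solution_unique A x y x' y' (2 * T) (2 * T)) with (t := t) as [-> ->];
  try easy; try lra; congruence.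
Qed.

Lemma oval_integral_on_parametrization A k h v : is_oval_integral A k h v ->
  exists x y T, oval_parametrization A h x y T /\ integral x y T (X ^ k * Y ^ 2)%P = v.
Proof.
intros (x & y & T & Hpar & Hint). exists x, y, T. split; [easy|].
apply (is_RInt_unique (V := R_CompleteNormedModule)). revert Hint. apply is_RInt_ext. intros t Ht.
destruct Hpar as (HT & Hs & _). rewrite Rmin_left, Rmax_right in Ht by lra.
destruct (Hs t) as [Hx _]; [lra|]. rewrite (is_derive_unique _ _ _ Hx). simpl. ring.
Qed.

Lemma integral_ext x y T P Q : 0 <= T ->
  (forall t, 0 <= t <= T -> ev P (x t) (y t) = ev Q (x t) (y t)) ->
  integral x y T P = integral x y T Q.
Proof.
intros HT H. apply RInt_ext. intros t Ht. rewrite Rmin_left, Rmax_right in Ht by lra.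
apply H. lra.
Qed.

(** The parametrizations behind the two oval integrals may differ; both are
    carried to the orbit from [(p, q)], which is unique. *)
Lemma loop_of_integrals A h p q v0 v2 :
  is_oval_integral A 0 h v0 -> is_oval_integral A 2 h v2 -> oval A h p q ->
  exists x y T, loop A h x y T p q /\
    integral x y T (X ^ 0 * Y ^ 2)%P = v0 /\ integral x y T (X ^ 2 * Y ^ 2)%P = v2.
Proof.
intros H0 H2 Hpq.
destruct (oval_integral_on_parametrization _ _ _ _ H0) as (x & y & T & Hpar & <-).
destruct (oval_integral_on_parametrization _ _ _ _ H2) as (x' & y' & T' & Hpar' & <-).
destruct (loop_of_parametrization _ _ _ _ _ _ _ Hpar Hpq) as (u & w & Hl & HP).
destruct (loop_of_parametrization _ _ _ _ _ _ _ Hpar' Hpq) as (u' & w' & Hl' & HP').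
exists u, w, T. split; [easy|]. split.
- apply HP.
- rewrite <- HP'. symmetry. now apply (loop_integral_unique A h u w T u' w' T' p q).
Qed.

(** * The return time *)

(** One number [z] meets all the smallness conditions [K z < b] of a proof. *)
Lemma choose_small (l : list (R * R)%type) :
  List.Forall (fun Kb => 0 < snd Kb) l ->
  exists z, 0 < z /\ forall z', 0 <= z' <= z -> List.Forall (fun Kb => fst Kb * z' < snd Kb) l.
Proof.
induction 1 as [|[K b] l Hb _ [z [Hz IH]]].
- exists 1. split; [lra|constructor].
- simpl in Hb. pose proof (Rabs_pos K). pose proof (Rle_abs K).
  assert (Hq : 0 < b / (Rabs K + 1)) by (apply Rdiv_lt_0_compat; lra).
  exists (Rmin z (b / (Rabs K + 1) / 2)). split; [apply Rmin_glb_lt; lra|].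
  intros z' Hz'. pose proof (Rmin_l z (b / (Rabs K + 1) / 2)).
  pose proof (Rmin_r z (b / (Rabs K + 1) / 2)).
  constructor; [|apply IH; lra]. simpl.
  assert (He : (Rabs K + 1) * (b / (Rabs K + 1)) = b) by (field; lra).
  nra.
Qed.

Lemma oval_regular A h p q : level A h -> oval A h p q ->
  0 < q ^ 2 + (coef_a A * p + coef_b A * p ^ 3) ^ 2.
Proof.
intros Hl [HH Hs]. unfold Ham in HH.
set (f := coef_a A * p + coef_b A * p ^ 3).
pose proof (pow2_ge_0 q). pose proof (pow2_ge_0 f).
destruct (Rle_lt_dec (q ^ 2 + f ^ 2) 0) as [Hbad|]; [exfalso|easy].
assert (Hq : q = 0) by nra. assert (Hf : f = 0) by nra.
subst q. unfold f in Hf.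
destruct A; simpl in *;
  try (assert (p = 0) by nra; subst p; lra);
  (assert (Hc : p = 0 \/ p ^ 2 = 1) by
    (destruct (Req_dec p 0); [now left|right; apply Rmult_eq_reg_l with p; [lra|easy]]);
   destruct Hc as [->|Hc]; [lra|]; replace (p ^ 4) with ((p ^ 2) ^ 2) in HH by ring;
   simpl in HH; rewrite ?Rmult_1_r in *; nra).
Qed.

(** Two points with the same coordinate along the Hamiltonian vector field
    [(q, - f)] differ by a multiple of the gradient [(f, q)], along which the
    Hamiltonian is strictly monotone near a regular point. *)
Lemma level_transversal A p q (f := coef_a A * p + coef_b A * p ^ 3) :
  0 < q ^ 2 + f ^ 2 ->
  exists rho, 0 < rho /\ forall u w u' w',
    Rabs (u - p) < rho -> Rabs (w - q) < rho -> Rabs (u' - p) < rho -> Rabs (w' - q) < rho ->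
    Ham A u w = Ham A u' w' -> (u - u') * q + (w - w') * - f = 0 ->
    u = u' /\ w = w'.
Proof.
intros HN. set (N := q ^ 2 + f ^ 2) in *.
set (W := (Const (coef_a A / 2) * (X + Y)
           + Const (coef_b A / 4) * ((X + Y) * (X ^ 2 + Y ^ 2)))%P).
destruct (ev_lipschitz W (Rabs p + 1)) as [K [HK HW]].
destruct (choose_small ((1, 1) :: (Rabs q + 2 * K * Rabs f, N) :: nil)) as [rho [Hrho Hsm]].
{ repeat constructor; simpl; lra. }
exists rho. split; [easy|].
intros u w u' w' Hu Hw Hu' Hw' HH Hperp.
specialize (Hsm rho ltac:(lra)). inversion_clear Hsm as [|? ? H1 Hsm'].
inversion_clear Hsm' as [|? ? H2 _]. simpl in H1, H2.
assert (Hbox : forall v, Rabs (v - p) < rho -> Rabs v <= Rabs p + 1).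
{ intros v Hv. replace v with (p + (v - p)) by ring. eapply Rle_trans; [apply Rabs_triang|]. lra. }
pose proof (Hbox u Hu) as Hbu. pose proof (Hbox u' Hu') as Hbu'.
assert (Hbp : Rabs p <= Rabs p + 1) by lra.
destruct (HW u u' p p Hbu Hbu' Hbp Hbp) as [HW1 _].
replace (ev W p p) with f in HW1 by (unfold W, f; simpl; field).
set (k := ((u - u') * f + (w - w') * q) / N).
assert (HE : (u - u') * q = (w - w') * f) by lra.
assert (Hku : u - u' = k * f).
{ apply Rmult_eq_reg_r with N; [|lra].
  replace (k * f * N) with (((u - u') * f + (w - w') * q) * f) by (unfold k; field; lra).
  replace ((u - u') * N) with ((u - u') * q * q + (u - u') * f ^ 2) by (unfold N; ring).
  rewrite HE. ring. }
assert (Hkw : w - w' = k * q).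
{ apply Rmult_eq_reg_r with N; [|lra].
  replace (k * q * N) with (((u - u') * f + (w - w') * q) * q) by (unfold k; field; lra).
  replace ((w - w') * N) with ((w - w') * f * f + (w - w') * q ^ 2) by (unfold N; ring).
  rewrite <- HE. ring. }
assert (Hz : k * (q * ((w + w') / 2) + f * ev W u u') = 0).
{ replace (k * (q * ((w + w') / 2) + f * ev W u u'))
    with ((k * q) * ((w + w') / 2) + (k * f) * ev W u u') by ring.
  rewrite <- Hku, <- Hkw. unfold Ham in HH. unfold W. simpl.
  replace (u ^ 4) with (u * u * u * u) in HH by ring.
  replace (u' ^ 4) with (u' * u' * u' * u') in HH by ring.
  simpl in HH. nra. }
assert (Hk : k = 0).
{ apply Rmult_integral in Hz. destruct Hz as [|Hz]; [easy|exfalso].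
  set (d := ev W u u' - f) in *. set (e := (w + w') / 2 - q).
  assert (He : Rabs e <= rho) by (unfold e; apply Rabs_le; apply Rabs_def2 in Hw; apply Rabs_def2 in Hw'; lra).
  assert (Hd : Rabs d <= 2 * K * rho) by (eapply Rle_trans; [exact HW1|]; nra).
  assert (HzN : N = - (q * e + f * d)).
  { unfold N. replace (ev W u u') with (d + f) in Hz by (unfold d; ring).
    replace ((w + w') / 2) with (e + q) in Hz by (unfold e; ring). nra. }
  assert (N <= Rabs q * Rabs e + Rabs f * Rabs d).
  { rewrite HzN at 1. rewrite <- !Rabs_mult. eapply Rle_trans; [apply Rle_abs|].
    rewrite Rabs_Ropp. apply Rabs_triang. }
  pose proof (Rabs_pos q). pose proof (Rabs_pos f).
  assert (Rabs q * Rabs e <= Rabs q * rho) by (apply Rmult_le_compat_l; lra).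
  assert (Rabs f * Rabs d <= Rabs f * (2 * K * rho)) by (apply Rmult_le_compat_l; lra).
  nra. }
rewrite Hk in Hku, Hkw. lra.
Qed.

Lemma level_open A h : level A h -> exists d, 0 < d /\ forall h', Rabs (h' - h) < d -> level A h'.
Proof.
intros Hl.
destruct A; simpl in *.
- exists h. split; [easy|]. intros h' H. apply Rabs_def2 in H. lra.
- exists (Rmin h (1 / 4 - h)). split; [apply Rmin_glb_lt; lra|]. intros h' H.
  pose proof (Rmin_l h (1 / 4 - h)). pose proof (Rmin_r h (1 / 4 - h)). apply Rabs_def2 in H. lra.
- exists (Rmin (- h) (1 / 4 + h)). split; [apply Rmin_glb_lt; lra|]. intros h' H.
  pose proof (Rmin_l (- h) (1 / 4 + h)). pose proof (Rmin_r (- h) (1 / 4 + h)). apply Rabs_def2 in H. lra.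
- exists (Rmin (- h) (1 / 4 + h)). split; [apply Rmin_glb_lt; lra|]. intros h' H.
  pose proof (Rmin_l (- h) (1 / 4 + h)). pose proof (Rmin_r (- h) (1 / 4 + h)). apply Rabs_def2 in H. lra.
- exists h. split; [easy|]. intros h' H. apply Rabs_def2 in H. lra.
Qed.

Definition HamP (A : annulus) : bipoly :=
  (Y ^ 2 * Const (/ 2) + Const (coef_a A / 2) * X ^ 2 + Const (coef_b A / 4) * X ^ 4)%P.

Lemma ev_HamP A u w : ev (HamP A) u w = Ham A u w.
Proof. unfold HamP, Ham. simpl. field. Qed.

Lemma lie_HamP A l u w : lie A l (HamP A) u w = damping l u w * w * w.
Proof. unfold HamP. simpl. field. Qed.

Definition returns (A : annulus) (sx sy : R -> R) (l : param -> R) (h h' : R)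
    (x y : R -> R) (T : R) : Prop :=
  0 < T /\ solution A l x y T /\ x 0 = sx h /\ y 0 = sy h /\
  level A h' /\ x T = sx h' /\ y T = sy h' /\
  (forall t h'', 0 < t < T -> level A h'' -> ~ (x t = sx h'' /\ y t = sy h'')).

Lemma section_lipschitz A sx sy h : cross_section A sx sy -> level A h ->
  exists d K, 0 < d /\ 0 <= K /\ forall h', Rabs (h' - h) < d ->
    Rabs (sx h' - sx h) <= K * Rabs (h' - h) /\ Rabs (sy h' - sy h) <= K * Rabs (h' - h).
Proof.
intros Hcs Hl. destruct (Hcs h Hl) as (_ & Hax & Hay).
destruct (analytic_is_derive _ _ Hax) as [lx Hx]. destruct (analytic_is_derive _ _ Hay) as [ly Hy].
destruct (derive_lipschitz _ _ _ Hx) as (dx & Kx & Hdx & HKx & Hlx).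
destruct (derive_lipschitz _ _ _ Hy) as (dy & Ky & Hdy & HKy & Hly).
exists (Rmin dx dy), (Kx + Ky). split; [now apply Rmin_glb_lt|]. split; [lra|].
intros h' Hh'. pose proof (Rmin_l dx dy). pose proof (Rmin_r dx dy).
specialize (Hlx h' ltac:(lra)). specialize (Hly h' ltac:(lra)).
pose proof (Rabs_pos (h' - h)). split; nra.
Qed.

Lemma Rabs_mult_le a b c d : Rabs a <= c -> Rabs b <= d -> Rabs (a * b) <= c * d.
Proof.
intros Ha Hb. rewrite Rabs_mult. apply Rmult_le_compat; trivial; apply Rabs_pos.
Qed.

(** As the parameters tend to 0, the orbit of the first return converges
    uniformly to the closed orbit, and the return time [T'] to its period [T].
    The level varies along the perturbed orbit by [O(mu t)], so that a point of
    the section met at time [t] lies within [O(mu t)] of the starting point.  This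
    excludes small [T'], because the orbit leaves its starting point with nonzero
    speed, and it excludes the times in between, because the closed orbit is then
    away from that point.  Conversely the coordinate along the flow, relative to
    the point of the section on the same level, changes sign near time [T]; where
    it vanishes the orbit is on the section, by [level_transversal], so that [T']
    cannot be larger than that. *)
Lemma return_close A sx sy h x y T : cross_section A sx sy -> level A h ->
  loop A h x y T (sx h) (sy h) ->
  forall eps, 0 < eps -> exists mu, 0 < mu /\ forall l h' x' y' T',
    (forall j, Rabs (l j) <= mu) -> returns A sx sy l h h' x' y' T' ->
    Rabs (T' - T) < eps /\ T' <= 2 * T /\
    forall t, 0 <= t <= T' -> Rabs (x' t - x t) < eps /\ Rabs (y' t - y t) < eps.
Proof.
intros Hcs Hlev (HT & Hs & Hx0 & Hy0 & HxT & HyT & Hno & Hov) eps Heps.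
set (p := sx h) in *. set (q := sy h) in *.
destruct (Hcs h Hlev) as (Hpq & _ & _). fold p q in Hpq.
pose proof (oval_regular A h p q Hlev Hpq) as HN.
set (f := coef_a A * p + coef_b A * p ^ 3) in *. set (N := q ^ 2 + f ^ 2) in *.
destruct (level_transversal A p q HN) as (rho & Hrho & Htr). fold f in Htr.
destruct (section_lipschitz A sx sy h Hcs Hlev) as (ds & L & Hds & HL & Hsl). fold p q in Hsl.
destruct (level_open A h Hlev) as (dl & Hdl & Hlo).
destruct (solution_bounded A null x y (2 * T) ltac:(lra) Hs) as (B & HB & HxB).
destruct (damping_bound (B + 1) ltac:(lra)) as (C & HC & HD).
set (F := (- (Const (coef_a A) * X + Const (coef_b A) * X ^ 3))%P).
destruct (ev_lipschitz F (B + 1)) as (K1 & HK1 & HF).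
set (S := Rabs q + Rabs f + 1).
assert (HS : 1 <= S) by (unfold S; pose proof (Rabs_pos q); pose proof (Rabs_pos f); lra).
assert (HtS : forall u w r, Rabs u <= r -> Rabs w <= r -> Rabs (u * q + w * - f) <= S * r).
{ intros u w r Hu Hw. eapply Rle_trans; [apply Rabs_triang|]. rewrite !Rabs_mult, Rabs_Ropp.
  assert (0 <= r) by (pose proof (Rabs_pos u); lra).
  pose proof (Rabs_pos q). pose proof (Rabs_pos f). unfold S. nra. }
set (G := (Const q * (X - Const p) + Const (- f) * (Y - Const q))%P).
assert (HGd : forall t, 0 <= t <= 2 * T -> is_derive (fun s => ev G (x s) (y s)) t
           (y t * q + ev F (x t) (y t) * - f)).
{ intros t Ht. pose proof (ev_derive A null x y (2 * T) G t Hs Ht) as Hd.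
  replace (y t * q + ev F (x t) (y t) * - f) with (lie A null G (x t) (y t)); [easy|].
  unfold G, F. simpl. rewrite damping_null. ring. }
assert (HNT : y T * q + ev F (x T) (y T) * - f = N).
{ rewrite HxT, HyT. unfold F, N, f. simpl. ring. }
assert (HN0 : y 0 * q + ev F (x 0) (y 0) * - f = N).
{ rewrite Hx0, Hy0. unfold F, N, f. simpl. ring. }
assert (HVc : forall t, 0 <= t <= 2 * T ->
          continuous (fun s => y s * q + ev F (x s) (y s) * - f) t).
{ intros t Ht. apply (continuous_ext (fun s => ev (Y * Const q + F * Const (- f))%P (x s) (y s))).
  - intros s. reflexivity.
  - now apply (ev_continuous A null x y (2 * T)). }
destruct (continuous_eps _ T (HVc T ltac:(lra)) (N / 2)) as (d1 & Hd1 & HV1); [lra|].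
destruct (continuous_eps _ 0 (HVc 0 ltac:(lra)) (N / 4)) as (d0 & Hd0 & HV0); [lra|].
destruct (continuous_eps x T) with (eps := rho / 2) as (d2 & Hd2 & Hcx); [|lra|].
{ apply (ev_continuous A null x y (2 * T) X T Hs). lra. }
destruct (continuous_eps y T) with (eps := rho / 2) as (d3 & Hd3 & Hcy); [|lra|].
{ apply (ev_continuous A null x y (2 * T) Y T Hs). lra. }
destruct (choose_small ((2, T) :: (1, eps) :: (1, d1) :: (1, d2) :: (1, d3) :: nil))
  as (del & Hdel & Hsm).
{ repeat constructor; simpl; lra. }
specialize (Hsm del ltac:(lra)). rewrite !Forall_cons_iff in Hsm. simpl in Hsm.
destruct Hsm as (HdT & Hdeps & Hdd1 & Hdd2 & Hdd3 & _).
destruct (choose_small ((2, T) :: (1, d0) :: nil)) as (del' & Hdel' & Hsm).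
{ repeat constructor; simpl; lra. }
specialize (Hsm del' ltac:(lra)). rewrite !Forall_cons_iff in Hsm. simpl in Hsm.
destruct Hsm as (Hd'T & Hd'0 & _).
assert (HGr : N / 2 * del <= ev G (x (T + del)) (y (T + del))).
{ assert (Hb : N / 2 * (T + del - T) <= ev G (x (T + del)) (y (T + del)) - ev G (x T) (y T)).
  { apply derive_bound_below with (f := fun s => ev G (x s) (y s))
      (df := fun s => y s * q + ev F (x s) (y s) * - f); [lra| |].
    - intros t Ht. apply HGd. lra.
    - intros t Ht. assert (Ht' : Rabs (t - T) < d1) by (apply Rabs_def1; lra).
      specialize (HV1 t Ht'). rewrite HNT in HV1. apply Rabs_def2 in HV1. lra. }
  assert (HGT : ev G (x T) (y T) = 0) by (rewrite HxT, HyT; unfold G; simpl; ring). lra. }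
assert (HGl : ev G (x (T - del)) (y (T - del)) <= - (N / 2 * del)).
{ assert (Hb : N / 2 * (T - (T - del)) <= ev G (x T) (y T) - ev G (x (T - del)) (y (T - del))).
  { apply derive_bound_below with (f := fun s => ev G (x s) (y s))
      (df := fun s => y s * q + ev F (x s) (y s) * - f); [lra| |].
    - intros t Ht. apply HGd. lra.
    - intros t Ht. assert (Ht' : Rabs (t - T) < d1) by (apply Rabs_def1; lra).
      specialize (HV1 t Ht'). rewrite HNT in HV1. apply Rabs_def2 in HV1. lra. }
  assert (HGT : ev G (x T) (y T) = 0) by (rewrite HxT, HyT; unfold G; simpl; ring). lra. }
assert (Hfar : exists r, 0 < r /\ forall t, del' <= t <= T - del ->
          ~ (Rabs (x t - p) < r /\ Rabs (y t - q) < r)).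
{ set (D2 := ((X - Const p) ^ 2 + (Y - Const q) ^ 2)%P).
  destruct (continuity_ab_min (fun t => ev D2 (x t) (y t)) del' (T - del)) as [tm [Hmin Htm]]; [lra| |].
  { intros t Ht. apply continuity_pt_filterlim.
    apply (ev_continuous A null x y (2 * T)); [easy|lra]. }
  assert (Hm : 0 < ev D2 (x tm) (y tm)).
  { destruct (Rle_lt_dec (ev D2 (x tm) (y tm)) 0) as [Hbad|]; [exfalso|easy].
    unfold D2 in Hbad. simpl in Hbad.
    set (u := x tm + -1 * p) in *. set (w := y tm + -1 * q) in *.
    assert (Hu : u = 0) by nra. assert (Hw : w = 0) by nra.
    apply (Hno tm); [lra|]. unfold u, w in *. lra. }
  set (m := ev D2 (x tm) (y tm)) in *.
  exists (Rmin 1 (m / 2)). split; [apply Rmin_glb_lt; lra|].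
  intros t Ht [Hx Hy]. specialize (Hmin t Ht). cbv beta in Hmin.
  pose proof (Rmin_l 1 (m / 2)). pose proof (Rmin_r 1 (m / 2)).
  fold m in Hmin. unfold D2 in Hmin. simpl in Hmin.
  assert (Hsq : forall z, Rabs z < 1 -> Rabs z < m / 2 -> z ^ 2 < m / 2).
  { intros z H1 H2. rewrite <- pow2_abs. pose proof (Rabs_pos z). nra. }
  assert ((x t - p) ^ 2 < m / 2) by (apply Hsq; lra).
  assert ((y t - q) ^ 2 < m / 2) by (apply Hsq; lra).
  nra. }
destruct Hfar as (r & Hr & Hfar).
destruct (choose_small ((1, eps) :: (1, 1) :: (2, rho) :: (2, r) :: (S * 4, N * del)
    :: (S * (1 + 2 * K1) * 8, N) :: nil)) as (z & Hz & Hsm).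
{ repeat constructor; simpl; nra. }
specialize (Hsm z ltac:(lra)). rewrite !Forall_cons_iff in Hsm. simpl in Hsm.
destruct Hsm as (Hz1 & Hz2 & Hz3 & Hz4 & Hz5 & Hz6 & _).
destruct (solutions_close A x y (2 * T) ltac:(lra) Hs z Hz) as (mu0 & Hmu0 & Hclose).
set (C' := C * (B + 1) * (2 * T)).
assert (HBT : 0 < (B + 1) * (2 * T)) by nra.
assert (HC' : 0 <= C') by (unfold C'; rewrite Rmult_assoc; nra).
destruct (choose_small ((1, mu0) :: (C', ds) :: (C', dl) :: (L * C', z) :: (S * C * 8, N)
    :: (S * (L * (C * (B + 1))) * 2, N) :: nil)) as (mu & Hmu & Hsm).
{ repeat constructor; simpl; lra. }
specialize (Hsm mu ltac:(lra)). rewrite !Forall_cons_iff in Hsm. simpl in Hsm.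
destruct Hsm as (Hm1 & Hm2 & Hm3 & Hm4 & Hm5 & Hm6 & _).
exists mu. split; [easy|].
intros l h' x' y' T' Hlmu (HT' & Hs' & Hx0' & Hy0' & Hlev' & HxT' & HyT' & Hno').
fold p in Hx0'. fold q in Hy0'.
assert (Hcl : forall t, 0 <= t <= T' -> t <= 2 * T ->
          Rabs (x' t - x t) < z /\ Rabs (y' t - y t) < z).
{ intros t Ht Ht2. apply (Hclose l x' y' t); try lra; try congruence.
  - intros j. specialize (Hlmu j). lra.
  - apply (solution_restrict _ _ _ _ T'); [lra|easy]. }
assert (HBB : forall t, 0 <= t <= T' -> t <= 2 * T ->
          Rabs (x' t) <= B + 1 /\ Rabs (y' t) <= B + 1).
{ intros t Ht Ht2. destruct (Hcl t Ht Ht2) as [H1 H2]. destruct (HxB t) as [H3 H4]; [lra|].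
  split.
  - replace (x' t) with (x t + (x' t - x t)) by ring. eapply Rle_trans; [apply Rabs_triang|]. lra.
  - replace (y' t) with (y t + (y' t - y t)) by ring. eapply Rle_trans; [apply Rabs_triang|]. lra. }
assert (HH : forall t, 0 <= t <= T' -> t <= 2 * T ->
          Rabs (Ham A (x' t) (y' t) - h) <= C * (B + 1) * mu * t).
{ intros t Ht Ht2.
  assert (Hh0 : Ham A (x' 0) (y' 0) = h) by (rewrite Hx0', Hy0'; apply Hpq).
  assert (Hd : forall s, 0 <= s <= t -> is_derive (fun s => ev (HamP A) (x' s) (y' s)) s
            (damping l (x' s) (y' s) * y' s * y' s)).
  { intros s Hst. rewrite <- (lie_HamP A). apply (ev_derive A l x' y' T'); [easy|lra]. }
  assert (Hb : forall s, 0 <= s <= t ->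
            Rabs (damping l (x' s) (y' s) * y' s * y' s) <= C * (B + 1) * mu).
  { intros s Hst. destruct (HBB s) as [H1 H2]; [lra|lra|].
    specialize (HD l mu (x' s) (y' s) Hlmu H1 H2).
    replace (C * (B + 1) * mu) with (C * mu * (B + 1)) by ring. now apply Rabs_mult_le. }
  pose proof (derive_bound (fun s => ev (HamP A) (x' s) (y' s)) _ 0 t (C * (B + 1) * mu) (proj1 Ht) Hd) as Hu.
  pose proof (derive_bound_below (fun s => ev (HamP A) (x' s) (y' s)) _ 0 t (- (C * (B + 1) * mu)) (proj1 Ht) Hd) as Hl.
  cbv beta in Hu, Hl. rewrite !ev_HamP, Hh0 in Hu, Hl.
  apply Rabs_le. split.
  - assert (- (C * (B + 1) * mu) * (t - 0) <= Ham A (x' t) (y' t) - h); [|lra].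
    apply Hl. intros s Hst. specialize (Hb s Hst). apply Rabs_le_between in Hb. lra.
  - assert (Ham A (x' t) (y' t) - h <= C * (B + 1) * mu * (t - 0)); [|lra].
    apply Hu. intros s Hst. specialize (Hb s Hst). apply Rabs_le_between in Hb. lra. }
assert (Hsec : forall t, 0 <= t <= T' -> t <= 2 * T ->
          level A (Ham A (x' t) (y' t)) /\
          Rabs (sx (Ham A (x' t) (y' t)) - p) <= L * (C * (B + 1) * mu * t) /\
          Rabs (sy (Ham A (x' t) (y' t)) - q) <= L * (C * (B + 1) * mu * t) /\
          L * (C * (B + 1) * mu * t) < z).
{ intros t Ht Ht2. specialize (HH t Ht Ht2).
  assert (H0 : C * (B + 1) * mu * t <= C' * mu).
  { unfold C'. replace (C * (B + 1) * (2 * T) * mu) with (C * (B + 1) * mu * (2 * T)) by ring.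
    apply Rmult_le_compat_l; [|easy]. apply Rmult_le_pos; [apply Rmult_le_pos|]; lra. }
  split; [apply Hlo; lra|].
  destruct (Hsl (Ham A (x' t) (y' t))) as [H1 H2]; [lra|].
  assert (L * Rabs (Ham A (x' t) (y' t) - h) <= L * (C * (B + 1) * mu * t))
    by (apply Rmult_le_compat_l; lra).
  split; [lra|]. split; [lra|].
  apply Rle_lt_trans with (L * (C' * mu)); [apply Rmult_le_compat_l; lra|lra]. }
assert (Hupper : T' <= T + del).
{ destruct (Rle_lt_dec T' (T + del)) as [|Hlt]; [easy|exfalso].
  set (g := fun t => (x' t - sx (Ham A (x' t) (y' t))) * q
                     + (y' t - sy (Ham A (x' t) (y' t))) * - f).
  assert (HgG : forall t, T - del <= t <= T + del ->
            Rabs (g t - ev G (x t) (y t)) <= S * (2 * z)).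
  { intros t Ht.
    destruct (Hcl t) as [H1 H2]; [lra|lra|].
    destruct (Hsec t) as (_ & H3 & H4 & H5); [lra|lra|].
    replace (g t - ev G (x t) (y t)) with
      (((x' t - x t) - (sx (Ham A (x' t) (y' t)) - p)) * q
       + ((y' t - y t) - (sy (Ham A (x' t) (y' t)) - q)) * - f)
      by (unfold g, G; simpl; ring).
    apply HtS; (eapply Rle_trans; [apply Rabs_triang|]; rewrite Rabs_Ropp; lra). }
  assert (Hg1 : g (T - del) < 0).
  { specialize (HgG (T - del) ltac:(lra)). apply Rabs_le_between in HgG. nra. }
  assert (Hg2 : 0 < g (T + del)).
  { specialize (HgG (T + del) ltac:(lra)). apply Rabs_le_between in HgG. nra. }
  destruct (Ranalysis5.IVT_interv g (T - del) (T + del)) as [t [Ht Hgt]]; [|lra|easy|easy|].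
  { intros t Ht. apply continuity_pt_filterlim.
    destruct (Hsec t) as (Hl & _); [lra|lra|].
    destruct (Hcs _ Hl) as (_ & Hax & Hay).
    destruct (analytic_is_derive _ _ Hax) as [lx Hlx]. destruct (analytic_is_derive _ _ Hay) as [ly Hly].
    assert (HcH : continuous (fun s => Ham A (x' s) (y' s)) t).
    { apply (continuous_ext (fun s => ev (HamP A) (x' s) (y' s))); [intros s; apply ev_HamP|].
      apply (ev_continuous A l x' y' T'); [easy|lra]. }
    apply (continuous_plus (V := R_NormedModule)).
    - apply (continuous_mult (K := R_AbsRing)); [|apply continuous_const].
      apply (continuous_minus (V := R_NormedModule)).
      + apply (ev_continuous A l x' y' T' X); [easy|lra].
      + apply (continuous_comp (fun s => Ham A (x' s) (y' s)) sx); [easy|].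
        now apply (derive_continuous sx _ lx).
    - apply (continuous_mult (K := R_AbsRing)); [|apply continuous_const].
      apply (continuous_minus (V := R_NormedModule)).
      + apply (ev_continuous A l x' y' T' Y); [easy|lra].
      + apply (continuous_comp (fun s => Ham A (x' s) (y' s)) sy); [easy|].
        now apply (derive_continuous sy _ ly). }
  destruct (Hsec t) as (Hl & H3 & H4 & H5); [lra|lra|].
  destruct (Hcl t) as [H1 H2]; [lra|lra|].
  assert (Htd : Rabs (t - T) <= del) by (apply Rabs_le; lra).
  specialize (Hcx t ltac:(lra)). specialize (Hcy t ltac:(lra)). rewrite HxT in Hcx. rewrite HyT in Hcy.
  apply (Hno' t (Ham A (x' t) (y' t))); [lra|easy|].
  apply Htr; try lra.
  - replace (x' t - p) with ((x' t - x t) + (x t - p)) by ring.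
    eapply Rle_lt_trans; [apply Rabs_triang|]. lra.
  - replace (y' t - q) with ((y' t - y t) + (y t - q)) by ring.
    eapply Rle_lt_trans; [apply Rabs_triang|]. lra.
  - symmetry. apply (Hcs _ Hl).
  - exact Hgt. }
assert (HT2 : T' <= 2 * T) by lra.
assert (HhT : Ham A (x' T') (y' T') = h').
{ rewrite HxT', HyT'. apply (Hcs _ Hlev'). }
destruct (Hsec T') as (_ & H3 & H4 & H5); [lra|lra|]. rewrite HhT, <- HxT', <- HyT' in *.
assert (Hlower : T - del < T').
{ destruct (Rlt_le_dec (T - del) T') as [|Hle]; [easy|exfalso].
  destruct (Rle_lt_dec del' T') as [Hge|Hlt].
  - apply (Hfar T'); [lra|]. destruct (Hcl T') as [H1 H2]; [lra|lra|].
    rewrite Rabs_minus_sym in H1, H2.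
    split.
    + replace (x T' - p) with ((x T' - x' T') + (x' T' - p)) by ring.
      eapply Rle_lt_trans; [apply Rabs_triang|]. lra.
    + replace (y T' - q) with ((y T' - y' T') + (y' T' - q)) by ring.
      eapply Rle_lt_trans; [apply Rabs_triang|]. lra.
  - assert (Hfwd : N / 2 * (T' - 0) <= ev G (x' T') (y' T') - ev G (x' 0) (y' 0)).
    { apply derive_bound_below with (f := fun s => ev G (x' s) (y' s))
        (df := fun s => lie A l G (x' s) (y' s)); [lra| |].
      - intros t Ht. now apply (ev_derive A l x' y' T').
      - intros t Ht.
        assert (Ht' : Rabs (t - 0) < d0) by (apply Rabs_def1; lra).
        specialize (HV0 t Ht'). rewrite HN0 in HV0. apply Rabs_def2 in HV0.
        destruct (Hcl t) as [H1 H2]; [lra|lra|]. destruct (HBB t) as [H6 H7]; [lra|lra|].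
        destruct (HxB t) as [H8 H9]; [lra|].
        destruct (HF (x' t) (y' t) (x t) (y t)) as [HF1 _]; try lra.
        specialize (HD l mu (x' t) (y' t) Hlmu H6 H7).
        assert (Hdiff : Rabs (lie A l G (x' t) (y' t) - (y t * q + ev F (x t) (y t) * - f))
                  <= S * (z + 2 * K1 * z + C * mu)).
        { replace (lie A l G (x' t) (y' t) - (y t * q + ev F (x t) (y t) * - f)) with
            ((y' t - y t) * q + ((ev F (x' t) (y' t) - ev F (x t) (y t))
               + damping l (x' t) (y' t) * y' t) * - f) by (unfold G, F; simpl; ring).
          assert (0 <= K1 * z) by (apply Rmult_le_pos; lra).
          assert (0 <= C * mu) by (apply Rmult_le_pos; lra).
          assert (K1 * (Rabs (x' t - x t) + Rabs (y' t - y t)) <= K1 * (2 * z))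
            by (apply Rmult_le_compat_l; lra).
          apply HtS; [lra|]. eapply Rle_trans; [apply Rabs_triang|]. lra. }
        apply Rabs_le_between in Hdiff. lra. }
    assert (HG0 : ev G (x' 0) (y' 0) = 0) by (rewrite Hx0', Hy0'; unfold G; simpl; ring).
    assert (HGT : Rabs (ev G (x' T') (y' T')) <= S * (L * (C * (B + 1) * mu * T'))).
    { replace (ev G (x' T') (y' T')) with ((x' T' - p) * q + (y' T' - q) * - f)
        by (unfold G; simpl; ring). now apply HtS. }
    assert (S * (L * (C * (B + 1))) * 2 * mu * T' < N * T') by (apply Rmult_lt_compat_r; lra).
    apply Rabs_le_between in HGT. lra. }
split; [apply Rabs_def1; lra|]. split; [easy|].
intros t Ht. destruct (Hcl t Ht) as [H1 H2]; lra.
Qed.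

(** * Integrals over the closed orbit *)

Lemma integral_correct A l x y T P : 0 <= T -> solution A l x y T ->
  is_RInt (fun t => ev P (x t) (y t)) 0 T (integral x y T P).
Proof.
intros HT Hs. apply (RInt_correct (V := R_CompleteNormedModule)).
apply (ev_integrable A l x y T); [easy|lra|lra].
Qed.

Lemma integral_lie A l x y T P Q : 0 <= T -> solution A l x y T ->
  (forall t, 0 <= t <= T -> ev P (x t) (y t) = lie A l Q (x t) (y t)) ->
  integral x y T P = ev Q (x T) (y T) - ev Q (x 0) (y 0).
Proof.
intros HT Hs HPQ. apply (is_RInt_unique (V := R_CompleteNormedModule)).
apply (is_RInt_derive (V := R_CompleteNormedModule) (fun t => ev Q (x t) (y t)) (fun t => ev P (x t) (y t)));
  intros t Ht; rewrite Rmin_left, Rmax_right in Ht by lra.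
- rewrite HPQ by easy. now apply (ev_derive A l x y T).
- now apply (ev_continuous A l x y T).
Qed.

Lemma integral_plus A l x y T P Q : 0 <= T -> solution A l x y T ->
  integral x y T (P + Q)%P = integral x y T P + integral x y T Q.
Proof.
intros HT Hs. apply (is_RInt_unique (V := R_CompleteNormedModule)).
apply (is_RInt_plus (V := R_CompleteNormedModule) (fun t => ev P (x t) (y t)) (fun t => ev Q (x t) (y t)));
  now apply (integral_correct A l).
Qed.

Lemma integral_scal A l x y T c P : 0 <= T -> solution A l x y T ->
  integral x y T (Const c * P)%P = c * integral x y T P.
Proof.
intros HT Hs. apply (is_RInt_unique (V := R_CompleteNormedModule)).
apply (is_RInt_scal (V := R_CompleteNormedModule) (fun t => ev P (x t) (y t))).
now apply (integral_correct A l).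
Qed.

Lemma integral_le A l x y T P Q : 0 <= T -> solution A l x y T ->
  (forall t, 0 <= t <= T -> ev P (x t) (y t) <= ev Q (x t) (y t)) ->
  integral x y T P <= integral x y T Q.
Proof.
intros HT Hs H. apply RInt_le; [easy| | |].
- apply (ev_integrable A l x y T); [easy|lra|lra].
- apply (ev_integrable A l x y T); [easy|lra|lra].
- intros t Ht. apply H. lra.
Qed.

Lemma integral_const x y T c : integral x y T (Const c) = c * T.
Proof.
unfold integral. simpl. rewrite RInt_const. unfold scal; simpl; unfold mult; simpl. ring.
Qed.

Lemma loop_solution A h x y T p q : loop A h x y T p q -> solution A null x y T.
Proof. intros (HT & Hs & _). apply (solution_restrict _ _ _ _ (2 * T)); [lra|easy]. Qed.

Lemma loop_exact A h x y T p q Q P : loop A h x y T p q ->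
  (forall u w, oval A h u w -> ev P u w = lie A null Q u w) -> integral x y T P = 0.
Proof.
intros Hl H. pose proof (loop_solution _ _ _ _ _ _ _ Hl) as Hs.
destruct Hl as (HT & _ & Hx0 & Hy0 & HxT & HyT & _ & Hov).
rewrite (integral_lie A null x y T P Q); [rewrite HxT, HyT, Hx0, Hy0; ring|lra|easy|].
intros t Ht. apply H, Hov. lra.
Qed.

Lemma loop_ext A h x y T p q P Q : loop A h x y T p q ->
  (forall u w, oval A h u w -> ev P u w = ev Q u w) -> integral x y T P = integral x y T Q.
Proof.
intros (HT & _ & _ & _ & _ & _ & _ & Hov) H.
apply integral_ext; [lra|]. intros t Ht. apply H, Hov. lra.
Qed.

Lemma loop_le A h x y T p q P Q : loop A h x y T p q ->
  (forall u w, oval A h u w -> ev P u w <= ev Q u w) -> integral x y T P <= integral x y T Q.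
Proof.
intros Hl H. pose proof (loop_solution _ _ _ _ _ _ _ Hl) as Hs.
destruct Hl as (HT & _ & _ & _ & _ & _ & _ & Hov).
apply (integral_le A null); [lra|easy|]. intros t Ht. apply H, Hov. lra.
Qed.

Lemma loop_plus A h x y T p q P Q : loop A h x y T p q ->
  integral x y T (P + Q)%P = integral x y T P + integral x y T Q.
Proof.
intros Hl. apply (integral_plus A null); [destruct Hl; lra|]. eapply loop_solution, Hl.
Qed.

Lemma loop_scal A h x y T p q c P : loop A h x y T p q ->
  integral x y T (Const c * P)%P = c * integral x y T P.
Proof.
intros Hl. apply (integral_scal A null); [destruct Hl; lra|]. eapply loop_solution, Hl.
Qed.

Lemma coef_b_sq A : coef_b A ^ 2 = 1.
Proof. destruct A; simpl; ring. Qed.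

Definition moment (x y : R -> R) (T : R) (k : nat) : R := integral x y T (X ^ k * Y ^ 2)%P.

(** Exactness of [d (x^(k+1) y^3)], reduced by the equation of the oval. *)
Lemma moment_recurrence A h x y T p q k : loop A h x y T p q ->
  2 * h * INR (S k) * moment x y T k
  - coef_a A * INR (k + 4) * moment x y T (k + 2)
  - coef_b A * (INR (k + 7) / 2) * moment x y T (k + 4) = 0.
Proof.
intros Hl.
pose proof (loop_exact A h x y T p q (X ^ (S k) * Y ^ 3)%P
  (Const (2 * h * INR (S k)) * (X ^ k * Y ^ 2)
   + (Const (- (coef_a A * INR (k + 4))) * (X ^ (k + 2) * Y ^ 2)
   + Const (- (coef_b A * (INR (k + 7) / 2))) * (X ^ (k + 4) * Y ^ 2)))%P Hl) as H.
rewrite !(loop_plus _ _ _ _ _ _ _ _ _ Hl), !(loop_scal _ _ _ _ _ _ _ _ _ Hl) in H.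
unfold moment. rewrite <- H; [ring|].
intros u w [Hh _]. cbn [ev lie]. rewrite damping_null, <- Hh.
replace (Init.Nat.pred (S k)) with k by lia. replace (Init.Nat.pred 3) with 2%nat by lia.
rewrite !pow_add. replace (u ^ S k) with (u * u ^ k) by (simpl; ring).
rewrite !plus_INR, S_INR. unfold Ham. simpl INR. field.
Qed.

Lemma moment_step A h x y T p q k : loop A h x y T p q ->
  moment x y T (k + 4) = coef_b A / INR (k + 7) *
    (4 * h * INR (S k) * moment x y T k - 2 * coef_a A * INR (k + 4) * moment x y T (k + 2)).
Proof.
intros Hl. pose proof (moment_recurrence A h x y T p q k Hl) as H.
assert (Hk : 0 < INR (k + 7)) by (apply lt_0_INR; lia).
assert (Hb : moment x y T (k + 4) = coef_b A * (coef_b A * moment x y T (k + 4))).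
{ rewrite <- Rmult_assoc. replace (coef_b A * coef_b A) with (coef_b A ^ 2) by ring.
  rewrite coef_b_sq. ring. }
rewrite Hb.
replace (coef_b A * moment x y T (k + 4)) with
  (2 / INR (k + 7) * (coef_b A * (INR (k + 7) / 2) * moment x y T (k + 4))) by (field; lra).
replace (coef_b A * (INR (k + 7) / 2) * moment x y T (k + 4)) with
  (2 * h * INR (S k) * moment x y T k - coef_a A * INR (k + 4) * moment x y T (k + 2)) by lra.
field. lra.
Qed.

Lemma moment4 A h x y T p q : loop A h x y T p q ->
  moment x y T 4 = 4 / 7 * coef_b A * h * moment x y T 0
                   - 8 / 7 * (coef_a A * coef_b A) * moment x y T 2.
Proof.
intros Hl. rewrite (moment_step A h x y T p q 0 Hl : moment x y T 4 = _). simpl INR. simpl Nat.add. field.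
Qed.

Lemma moment6 A h x y T p q : loop A h x y T p q ->
  moment x y T 6 = - (16 / 21) * coef_a A * h * moment x y T 0
                   + (4 / 3 * coef_b A * h + 32 / 21) * moment x y T 2.
Proof.
intros Hl. rewrite (moment_step A h x y T p q 2 Hl : moment x y T 6 = _). simpl INR. simpl Nat.add.
rewrite (moment4 A h x y T p q Hl). destruct A; simpl; field.
Qed.

Lemma moment_y4 A h x y T p q : loop A h x y T p q ->
  integral x y T (Y ^ 4 * Y ^ 2)%P =
    (240 / 77 * h ^ 2 + 20 / 231 * coef_b A * h) * moment x y T 0
    - (320 / 231 * coef_a A * h + 40 / 231 * (coef_a A * coef_b A)) * moment x y T 2.
Proof.
intros Hl.
rewrite (loop_ext A h x y T p q _
  (Const (4 * h ^ 2) * (X ^ 0 * Y ^ 2) + (Const (- (4 * coef_a A * h)) * (X ^ 2 * Y ^ 2)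
   + (Const (1 - 2 * coef_b A * h) * (X ^ 4 * Y ^ 2)
   + (Const (coef_a A * coef_b A) * (X ^ 6 * Y ^ 2)
   + Const (/ 4) * (X ^ 8 * Y ^ 2)))))%P Hl).
- rewrite !(loop_plus _ _ _ _ _ _ _ _ _ Hl), !(loop_scal _ _ _ _ _ _ _ _ _ Hl).
  fold (moment x y T 0) (moment x y T 2) (moment x y T 4) (moment x y T 6) (moment x y T 8).
  rewrite (moment_step A h x y T p q 4 Hl : moment x y T 8 = _). simpl INR. simpl Nat.add.
  rewrite (moment6 A h x y T p q Hl), (moment4 A h x y T p q Hl).
  destruct A; simpl; field.
- intros u w [Hh _]. rewrite <- Hh. unfold Ham. destruct A; simpl; field.
Qed.


(** * Exactness up to third order in the kernel direction *)

(** The damping whose first Melnikov function vanishes: modulo exact forms,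
    [kernel_damping y dx] is a multiple of [dH], because
    [d (x y^3) = y^3 dx + 3 x y^2 dy] and [y dy = dH - (a x + b x^3) dx]. *)
Definition kernel_damping (A : annulus) : bipoly :=
  (Y ^ 2 + (Const (- 3 * coef_a A) * X ^ 2 + Const (- 3 * coef_b A) * X ^ 4))%P.

(** Two steps of Francoise's algorithm:
    [kernel_damping y dx = d exact1 + cof1 dH] and
    [cof1 kernel_damping y dx = d exact2 + cof2 dH]. *)
Definition exact1 : bipoly := (X * Y ^ 3)%P.

Definition cof1 : bipoly := (Const (- 3) * (X * Y))%P.

Definition exact2 (A : annulus) : bipoly :=
  (Const (- (9 / 4)) * (X ^ 2 * Y ^ 4)
   + (Const 3 * (HamP A ^ 2 * X ^ 2)
   + (Const (- (3 / 2)) * (HamP A * (Const (coef_a A) * X ^ 4 + Const (coef_b A / 3) * X ^ 6))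
   + (Const (coef_a A ^ 2 / 4) * X ^ 6 + (Const (3 / 16 * coef_a A * coef_b A) * X ^ 8
   + Const (3 / 80 * coef_b A ^ 2) * X ^ 10)))))%P.

Definition cof2 (A : annulus) : bipoly :=
  (Const 9 * (X ^ 2 * Y ^ 2) + (Const (- 6) * (HamP A * X ^ 2)
   + (Const (3 / 2 * coef_a A) * X ^ 4 + Const (coef_b A / 2) * X ^ 6)))%P.

Lemma francoise_step1 A l u w :
  lie A l exact1 u w + ev cof1 u w * lie A l (HamP A) u w = ev (kernel_damping A) u w * w ^ 2.
Proof. unfold kernel_damping, exact1, cof1, HamP. simpl. field. Qed.

Lemma francoise_step2 A l u w :
  lie A l (exact2 A) u w + ev (cof2 A) u w * lie A l (HamP A) u w
  = ev cof1 u w * (ev (kernel_damping A) u w * w ^ 2).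
Proof. unfold kernel_damping, exact2, cof1, cof2, HamP. simpl. field. Qed.

(** The coefficient of [h^2 I_2] does not vanish, while [h^2 I_2] does not occur
    in the integrals of first order. *)
Lemma third_order_integral A h x y T p q : loop A h x y T p q ->
  integral x y T (cof2 A * kernel_damping A * Y ^ 2)%P =
    (- (32 / 13) * h ^ 2 - 1448 / 1001 * coef_b A * h - 192 / 1001) * moment x y T 2
    + (640 / 1001 * (coef_a A * coef_b A) * h ^ 2 + 96 / 1001 * coef_a A * h) * moment x y T 0.
Proof.
intros Hl.
rewrite (loop_ext A h x y T p q _
  (Const (24 * h ^ 2) * (X ^ 2 * Y ^ 2) + (Const (- (63 * coef_a A * h)) * (X ^ 4 * Y ^ 2)
   + (Const (30 - 50 * coef_b A * h) * (X ^ 6 * Y ^ 2)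
   + (Const (169 / 4 * (coef_a A * coef_b A)) * (X ^ 8 * Y ^ 2)
   + Const 14 * (X ^ 10 * Y ^ 2)))))%P Hl).
- rewrite !(loop_plus _ _ _ _ _ _ _ _ _ Hl), !(loop_scal _ _ _ _ _ _ _ _ _ Hl).
  fold (moment x y T 2) (moment x y T 4) (moment x y T 6) (moment x y T 8) (moment x y T 10).
  rewrite (moment_step A h x y T p q 6 Hl : moment x y T 10 = _).
  simpl INR. simpl Nat.add.
  rewrite (moment_step A h x y T p q 4 Hl : moment x y T 8 = _). simpl INR. simpl Nat.add.
  rewrite (moment6 A h x y T p q Hl), (moment4 A h x y T p q Hl).
  destruct A; simpl; field.
- intros u w [Hh _]. rewrite <- Hh. unfold cof2, kernel_damping, HamP, Ham. destruct A; simpl; field.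
Qed.

(** * Linear independence of the integrals *)

Fixpoint horner (l : list R) (E : R) : R :=
  match l with nil => 0 | c :: l => c + E * horner l E end.

Lemma horner_bounded l : exists C, 0 <= C /\ forall E, 0 <= E <= 1 -> Rabs (horner l E) <= C.
Proof.
induction l as [|c l [C [HC IH]]]; simpl.
- exists 0. split; [lra|]. intros. rewrite Rabs_R0. lra.
- exists (Rabs c + C). split; [pose proof (Rabs_pos c); lra|].
  intros E HE. eapply Rle_trans; [apply Rabs_triang|]. apply Rplus_le_compat_l.
  replace C with (1 * C) by ring. apply Rabs_mult_le; [apply Rabs_le; lra|now apply IH].
Qed.

(** A function that tends to infinity at [0+], but more slowly than [1 / E], is
    not a quotient of polynomials: comparing both sides of [la r = lb] at [0+]
    shows in turn that the constant terms of [la] and of [lb] vanish; then divide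
    by [E]. *)
Lemma slow_growth_irrational (r : R -> R) eta : 0 < eta ->
  (forall M, exists d, 0 < d /\ forall E, 0 < E < d -> M <= r E) ->
  (forall eps, 0 < eps -> exists d, 0 < d /\ forall E, 0 < E < d -> E * r E <= eps) ->
  forall la lb, length la = length lb ->
  (forall E, 0 < E < eta -> horner la E * r E = horner lb E) ->
  List.Forall (eq 0) la /\ List.Forall (eq 0) lb.
Proof.
intros Heta Hinf Hslow.
induction la as [|a la IH]; intros [|b lb] Hlen Heq; try discriminate Hlen; [split; constructor|].
injection Hlen as Hlen.
destruct (horner_bounded la) as (Ca & HCa & Hla). destruct (horner_bounded lb) as (Cb & HCb & Hlb).
simpl in Heq.
assert (Ha : a = 0).
{ destruct (Req_dec a 0) as [|Hne]; [easy|exfalso].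
  assert (Hpos : 0 < Rabs a) by now apply Rabs_pos_lt.
  destruct (Hinf (2 * (Rabs b + Cb + 1) / Rabs a)) as (d & Hd & HM).
  destruct (choose_small ((1, eta) :: (1, d) :: (1, 1) :: (Ca * 2, Rabs a) :: nil)) as (E & HE & Hsm).
  { repeat constructor; simpl; lra. }
  specialize (Hsm E ltac:(lra)). rewrite !Forall_cons_iff in Hsm. simpl in Hsm.
  destruct Hsm as (H1 & H2 & H3 & H4 & _).
  specialize (HM E ltac:(lra)). specialize (Heq E ltac:(lra)).
  specialize (Hla E ltac:(lra)). specialize (Hlb E ltac:(lra)).
  assert (HM' : 2 * (Rabs b + Cb + 1) <= Rabs a * r E).
  { replace (2 * (Rabs b + Cb + 1)) with (Rabs a * (2 * (Rabs b + Cb + 1) / Rabs a)) by (field; lra).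
    apply Rmult_le_compat_l; lra. }
  assert (Hr : 0 < r E). { pose proof (Rabs_pos b). nra. }
  assert (Hl : Rabs a / 2 <= Rabs (a + E * horner la E)).
  { assert (Rabs (E * horner la E) <= E * Ca).
    { apply Rabs_mult_le; [rewrite Rabs_right; lra|easy]. }
    pose proof (Rabs_triang_inv a (- (E * horner la E))) as Ht. rewrite Rabs_Ropp in Ht.
    replace (a - - (E * horner la E)) with (a + E * horner la E) in Ht by ring. lra. }
  assert (Hrhs : Rabs (b + E * horner lb E) <= Rabs b + Cb).
  { eapply Rle_trans; [apply Rabs_triang|]. apply Rplus_le_compat_l.
    replace Cb with (1 * Cb) by ring. apply Rabs_mult_le; [apply Rabs_le; lra|easy]. }
  rewrite <- Heq, Rabs_mult, (Rabs_right (r E)) in Hrhs by lra. nra. }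
subst a.
assert (Hb : b = 0).
{ destruct (Req_dec b 0) as [|Hne]; [easy|exfalso].
  assert (Hpos : 0 < Rabs b) by now apply Rabs_pos_lt.
  destruct (Hinf 0) as (d0 & Hd0 & HM).
  destruct (Hslow (Rabs b / (4 * (Ca + 1)))) as (d & Hd & HS).
  { apply Rdiv_lt_0_compat; lra. }
  destruct (choose_small ((1, eta) :: (1, d) :: (1, d0) :: (1, 1) :: (Cb * 2, Rabs b) :: nil)) as (E & HE & Hsm).
  { repeat constructor; simpl; lra. }
  specialize (Hsm E ltac:(lra)). rewrite !Forall_cons_iff in Hsm. simpl in Hsm.
  destruct Hsm as (H1 & H2 & H3 & H4 & H5 & _).
  specialize (HM E ltac:(lra)). specialize (HS E ltac:(lra)). specialize (Heq E ltac:(lra)).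
  specialize (Hla E ltac:(lra)). specialize (Hlb E ltac:(lra)).
  assert (Hlhs : Rabs ((0 + E * horner la E) * r E) <= Ca * (E * r E)).
  { replace ((0 + E * horner la E) * r E) with (horner la E * (E * r E)) by ring.
    apply Rabs_mult_le; [easy|]. rewrite Rabs_right; [lra|]. apply Rle_ge, Rmult_le_pos; lra. }
  assert (Hl : Ca * (E * r E) <= Rabs b / 4).
  { apply Rle_trans with (Ca * (Rabs b / (4 * (Ca + 1)))); [apply Rmult_le_compat_l; lra|].
    replace (Rabs b / 4) with ((Ca + 1) * (Rabs b / (4 * (Ca + 1)))) by (field; lra).
    apply Rmult_le_compat_r; [|lra]. left. apply Rdiv_lt_0_compat; lra. }
  rewrite Heq in Hlhs.
  assert (Rabs (E * horner lb E) <= E * Cb).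
  { apply Rabs_mult_le; [rewrite Rabs_right; lra|easy]. }
  pose proof (Rabs_triang_inv b (- (E * horner lb E))) as Ht. rewrite Rabs_Ropp in Ht.
  replace (b - - (E * horner lb E)) with (b + E * horner lb E) in Ht by ring. lra. }
subst b.
destruct (IH lb Hlen) as [H1 H2]; [|split; now constructor].
intros E HE. specialize (Heq E HE). apply Rmult_eq_reg_l with E; [|lra]. lra.
Qed.

Fixpoint odd_harmonic (N : nat) : R :=
  match N with O => 0 | S N => odd_harmonic N + / (2 * INR N + 1) end.

Lemma odd_harmonic_nonneg N : 0 <= odd_harmonic N.
Proof.
induction N as [|N IH]; simpl; [lra|]. pose proof (pos_INR N).
assert (0 < / (2 * INR N + 1)) by (apply Rinv_0_lt_compat; lra). lra.
Qed.

(** Twice the sum is at least [ln (2 N + 1)]. *)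
Lemma odd_harmonic_unbounded M : exists N, M <= odd_harmonic N.
Proof.
assert (Hln : forall N, ln (2 * INR N + 1) <= 2 * odd_harmonic N).
{ induction N as [|N IH].
  - simpl. replace (2 * 0 + 1) with 1 by ring. rewrite ln_1. lra.
  - cbn [odd_harmonic]. rewrite S_INR. pose proof (pos_INR N) as HN.
    set (n := 2 * INR N + 1) in *.
    replace (2 * (INR N + 1) + 1) with (n * (1 + 2 * / n)) by (unfold n; field; lra).
    assert (Hn : 0 < / n) by (apply Rinv_0_lt_compat; unfold n; lra).
    rewrite ln_mult by (unfold n in *; lra).
    assert (ln (1 + 2 * / n) <= 2 * / n).
    { rewrite <- (ln_exp (2 * / n)) at 2. apply ln_le; [lra|]. left. apply exp_ineq1. lra. }
    lra. }
destruct (INR_unbounded (exp (2 * M))) as [N HN].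
exists N. specialize (Hln N).
assert (2 * M <= ln (2 * INR N + 1)).
{ rewrite <- (ln_exp (2 * M)). apply ln_le; [apply exp_pos|]. pose proof (pos_INR N). lra. }
lra.
Qed.

(** Up to errors in [kap], the difference [m_k - m_(k+1)] is at least
    [(m_0 - m_1) / (2 k + 1)]; their sum is at most [m_0]. *)
Lemma moment_sequence_growth (m : nat -> R) kap :
  0 <= kap -> (forall k, 0 <= m k) ->
  (forall k, (2 * INR k + 1) * (m k - m (S k)) - (2 * INR k + 1) * kap
             <= (2 * INR k + 3) * (m (S k) - m (S (S k)))) ->
  forall N, (m O - m 1%nat) * odd_harmonic N <= m O + INR N ^ 2 * kap.
Proof.
intros Hkap Hm Hrec N.
assert (Hd : forall k, (m O - m 1%nat) - INR k ^ 2 * kap <= (2 * INR k + 1) * (m k - m (S k))).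
{ induction k as [|k IH]; [simpl; lra|]. specialize (Hrec k). rewrite S_INR. nra. }
assert (Hs : (m O - m 1%nat) * odd_harmonic N <= m O - m N + INR N ^ 2 * kap).
{ induction N as [|N IH]; [simpl; lra|]. cbn [odd_harmonic]. rewrite S_INR.
  specialize (Hd N). pose proof (pos_INR N) as HN. set (n := INR N) in *.
  assert (Hi : 0 < / (2 * n + 1)) by (apply Rinv_0_lt_compat; lra).
  assert (Hstep : (m O - m 1%nat) * / (2 * n + 1) <= m N - m (S N) + n * kap).
  { apply Rmult_le_reg_r with (2 * n + 1); [lra|].
    rewrite Rmult_assoc, Rinv_l, Rmult_1_r by lra.
    assert (n ^ 2 * kap <= n * kap * (2 * n + 1)) by nra. lra. }
  nra. }
specialize (Hm N). lra.
Qed.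

Definition power_integral (s : bipoly) (x y : R -> R) (T : R) (k : nat) : R := integral x y T (s ^ k)%P.

Lemma power_integral_nonneg A h x y T p q s k : loop A h x y T p q ->
  (forall u w, oval A h u w -> 0 <= ev s u w) -> 0 <= power_integral s x y T k.
Proof.
intros Hl Hs. replace 0 with (integral x y T (Const 0)) by (rewrite integral_const; ring).
apply (loop_le _ _ _ _ _ _ _ _ _ Hl). intros u w Ho. simpl. apply pow_le. now apply Hs.
Qed.

Lemma power_integral_le A h x y T p q s k : loop A h x y T p q ->
  (forall u w, oval A h u w -> 0 <= ev s u w <= 1) -> power_integral s x y T k <= T.
Proof.
intros Hl Hs. replace T with (integral x y T (Const 1)) at 2 by (rewrite integral_const; ring).
apply (loop_le _ _ _ _ _ _ _ _ _ Hl). intros u w Ho. cbn [ev].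
rewrite <- (pow1 k). apply pow_incr. now apply Hs.
Qed.

Lemma power_integral_0 x y T s : 0 <= T -> power_integral s x y T 0 = T.
Proof.
intros HT. rewrite <- (Rmult_1_l T) at 2. rewrite <- (integral_const x y T 1).
apply integral_ext; [easy|]. intros t _. reflexivity.
Qed.

Lemma period_identity A h x y T p q : loop A h x y T p q ->
  3 * moment x y T 0 + coef_a A * integral x y T (X ^ 2)%P - 4 * h * T = 0.
Proof.
intros Hl.
pose proof (loop_exact A h x y T p q (X * Y)%P
  (Const 3 * (X ^ 0 * Y ^ 2) + (Const (coef_a A) * X ^ 2 + Const (- 4 * h)))%P Hl) as H.
rewrite !(loop_plus _ _ _ _ _ _ _ _ _ Hl), !(loop_scal _ _ _ _ _ _ _ _ _ Hl), integral_const in H.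
unfold moment. rewrite <- H; [ring|].
intros u w [Hh _]. rewrite <- Hh. simpl. rewrite damping_null. unfold Ham. field.
Qed.

(** A Picard-Fuchs relation, without derivatives in [h]: the factor of the period
    on the left vanishes at the level of the saddles. *)
Lemma picard_fuchs A h x y T p q : loop A h x y T p q ->
  4 * h * (4 * h + coef_b A) * T
  = (12 * h + 4 * coef_b A) * moment x y T 0 + 5 * coef_a A * moment x y T 2.
Proof.
intros Hl. pose proof (period_identity A h x y T p q Hl) as H0.
pose proof (loop_exact A h x y T p q
  (X ^ 3 * Y + Const (coef_a A * coef_b A) * (X * Y))%P
  (Const 5 * (X ^ 2 * Y ^ 2) + (Const (coef_a A * coef_b A) * (X ^ 0 * Y ^ 2)
   + Const (- (4 * h + coef_b A)) * X ^ 2))%P Hl) as H.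
rewrite !(loop_plus _ _ _ _ _ _ _ _ _ Hl), !(loop_scal _ _ _ _ _ _ _ _ _ Hl) in H.
fold (moment x y T 2) (moment x y T 0) in H.
assert (H2 : 5 * moment x y T 2 + (coef_a A * coef_b A * moment x y T 0 +
             - (4 * h + coef_b A) * integral x y T (X ^ 2)%P) = 0).
{ apply H. intros u w [Hh _]. rewrite <- Hh. simpl. rewrite damping_null. unfold Ham.
  destruct A; simpl; field. }
clear H. destruct A; simpl in *; nra.
Qed.

Lemma horner3 a b c E : horner (a :: b :: c :: nil) E = a + b * E + c * E ^ 2.
Proof. simpl. ring. Qed.

Lemma oval_abs_lt_1 h u w : oval TruncatedPendulum h u w -> u ^ 2 < 1.
Proof. intros [_ Hu]. apply Rabs_def2 in Hu. nra. Qed.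

(** At the distance [E = e^2] from the saddle connection, the period is at most
    of the order [1 / e], since [1 - x^2 >= 2 e] on the oval.  It is not bounded in
    terms of the area: this is the logarithmic divergence of
    [dx / (1 - x^2) = (1 + x^2 + x^4 + ...) dx], read off the moments of [x^2]. *)
Lemma pendulum_period e x y T p q (E := e ^ 2) :
  0 < e -> loop TruncatedPendulum (1 / 4 - E) x y T p q ->
  2 * e * T <= 3 * moment x y T 0 + 4 * E * T /\ forall N, 3 * moment x y T 0 * odd_harmonic N <= T + INR N ^ 2 * (4 * E * T).
Proof.
intros He Hl. pose proof (period_identity _ _ _ _ _ _ _ Hl) as Hper. simpl coef_a in Hper.
assert (HT : 0 < T) by apply Hl.
assert (HE : 0 < E) by (unfold E; nra).
set (s := (X ^ 2)%P) in *.
assert (Hs : forall u w, oval TruncatedPendulum (1 / 4 - E) u w -> 0 <= ev s u w <= 1).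
{ intros u w Ho. apply oval_abs_lt_1 in Ho. unfold s. simpl in *. nra. }
assert (H1 : power_integral s x y T 1 = integral x y T s).
{ apply (loop_ext _ _ _ _ _ _ _ _ _ Hl). intros. simpl. ring. }
split.
- assert (2 * e * T <= T - integral x y T s); [|lra].
  replace (2 * e * T) with (integral x y T (Const (2 * e))) by apply integral_const.
  replace (T - integral x y T s) with (integral x y T (Const 1 + Const (-1) * s)%P).
  + apply (loop_le _ _ _ _ _ _ _ _ _ Hl). intros u w Ho.
    pose proof (oval_abs_lt_1 _ _ _ Ho) as Hu. destruct Ho as [Hh _].
    unfold Ham, E in Hh. unfold s. simpl in *. nra.
  + rewrite (loop_plus _ _ _ _ _ _ _ _ _ Hl), (loop_scal _ _ _ _ _ _ _ _ _ Hl), integral_const.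
    ring.
- intros N.
  assert (Hgrow : (power_integral s x y T 0 - power_integral s x y T 1) * odd_harmonic N
                  <= power_integral s x y T 0 + INR N ^ 2 * (4 * E * T)).
  { apply moment_sequence_growth.
    - assert (0 < E * T) by now apply Rmult_lt_0_compat. lra.
    - intros k. apply (power_integral_nonneg _ _ _ _ _ _ _ _ _ Hl). intros u w Ho. now apply Hs.
    - intros k.
      pose proof (loop_exact _ _ _ _ _ _ _ (X ^ (2 * k + 1) * Y)%P
        (Const ((2 * INR k + 1) / 2) * (s ^ k) + (Const (- (2 * INR k + 1) / 2) * (s ^ S k)
         + (Const (- (2 * INR k + 3) / 2) * (s ^ S k) + (Const ((2 * INR k + 3) / 2) * (s ^ S (S k))
         + Const (- 2 * E * (2 * INR k + 1)) * (s ^ k)))))%P Hl) as H.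
      rewrite !(loop_plus _ _ _ _ _ _ _ _ _ Hl), !(loop_scal _ _ _ _ _ _ _ _ _ Hl) in H.
      fold (power_integral s x y T k) (power_integral s x y T (S k)) (power_integral s x y T (S (S k))) in H.
      pose proof (power_integral_le _ _ _ _ _ _ _ s k Hl Hs) as Hk. pose proof (pos_INR k) as Hk0.
      assert (E * (2 * INR k + 1) * power_integral s x y T k <= E * (2 * INR k + 1) * T).
      { apply Rmult_le_compat_l; [|easy]. apply Rmult_le_pos; lra. }
      match type of H with _ -> ?eq => assert (Heq : eq) end; [|nra].
      apply H. clear H. intros u w [Hh _]. cbn [ev lie]. rewrite damping_null.
      replace (Init.Nat.pred (2 * k + 1)) with (2 * k)%nat by lia.
      rewrite plus_INR, mult_INR. unfold s. cbn [ev].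
      rewrite pow_add, pow_mult.
      replace E with (1 / 4 - Ham TruncatedPendulum u w) by (rewrite Hh; ring).
      unfold Ham. simpl coef_a. simpl coef_b. simpl INR. cbn [pow].
      field. }
  rewrite power_integral_0, H1 in Hgrow by lra.
  replace (T - integral x y T s) with (3 * moment x y T 0 + 4 * E * T) in Hgrow by lra.
  pose proof (odd_harmonic_nonneg N) as HN.
  assert (0 <= 4 * E * T * odd_harmonic N).
  { apply Rmult_le_pos; [|easy]. apply Rmult_le_pos; lra. }
  lra.
Qed.

(** The same near the homoclinic loops.  The logarithmic divergence is now at
    [x = 0], and it is read off the moments of [1 - x^2 / 2], which is 1 there. *)
Lemma eight_period A e x y T p q (E := e ^ 2) :
  A = EightInteriorLeft \/ A = EightInteriorRight ->
  0 < e -> loop A (- E) x y T p q ->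
  2 * e * T <= 9 * moment x y T 0 + 12 * E * T /\
  forall N, 3 * moment x y T 0 * odd_harmonic N <= 2 * T + 2 * INR N ^ 2 * (4 * E * T).
Proof.
intros HA He Hl. pose proof (period_identity _ _ _ _ _ _ _ Hl) as Hper.
assert (Hab : coef_a A = -1 /\ coef_b A = 1) by (destruct HA as [-> | ->]; simpl; lra).
destruct Hab as [Ha Hb]. rewrite Ha in Hper.
assert (HT : 0 < T) by apply Hl.
assert (HE : 0 < E) by (unfold E; nra).
set (s := (Const 1 + Const (- (1 / 2)) * X ^ 2)%P) in *.
assert (Hs0 : forall u w, oval A (- E) u w -> u ^ 2 * ev s u w = w ^ 2 + 2 * E).
{ intros u w [Hh _]. unfold Ham in Hh. rewrite Ha, Hb in Hh. unfold s. simpl in *. lra. }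
assert (Hs : forall u w, oval A (- E) u w -> 0 <= ev s u w <= 1).
{ intros u w Ho. specialize (Hs0 u w Ho). split.
  - pose proof (pow2_ge_0 u). pose proof (pow2_ge_0 w).
    destruct (Rle_lt_dec 0 (ev s u w)); [easy|nra].
  - unfold s. simpl. nra. }
assert (H1 : power_integral s x y T 1 = T - / 2 * integral x y T (X ^ 2)%P).
{ unfold power_integral. rewrite (loop_ext _ _ _ _ _ _ _ (s ^ 1)%P s Hl) by (intros; simpl; ring).
  unfold s. rewrite (loop_plus _ _ _ _ _ _ _ _ _ Hl), (loop_scal _ _ _ _ _ _ _ _ _ Hl), integral_const.
  lra. }
split.
- (* [|x| >= e] and [|x|^3 <= (3/2) x^2] on the loop, while [x] and [x^3] have equal integrals *)
  set (sg := match A with EightInteriorLeft => -1 | _ => 1 end).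
  assert (Hsg : forall u w, oval A (- E) u w -> e <= sg * u <= 3 / 2).
  { intros u w Ho. pose proof (Hs0 u w Ho) as H0. pose proof (Hs u w Ho) as H01.
    pose proof (pow2_ge_0 w). pose proof (pow2_ge_0 u).
    assert (Hus : ev s u w = 1 - u ^ 2 / 2) by (unfold s; simpl; field).
    assert (Hu : 0 < sg * u) by (unfold sg; destruct HA as [-> | ->]; destruct Ho as [_ Ho]; simpl in *; lra).
    assert (Hsq : sg * sg = 1) by (unfold sg; destruct HA as [-> | ->]; simpl; lra).
    assert (Hu2 : (sg * u) ^ 2 = u ^ 2) by (replace ((sg * u) ^ 2) with (sg * sg * u ^ 2) by ring; rewrite Hsq; ring).
    assert (Hu2' : 2 * E <= u ^ 2 <= 2) by (split; nra).
    set (v := sg * u) in *. unfold E in *. split.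
    - destruct (Rle_lt_dec e v); [easy|]. nra.
    - destruct (Rle_lt_dec v (3 / 2)); [easy|]. nra. }
  assert (Hx3 : integral x y T (Const sg * X)%P = integral x y T (Const sg * X ^ 3)%P).
  { pose proof (loop_exact _ _ _ _ _ _ _ (Const sg * Y)%P
      (Const sg * X + Const (-1) * (Const sg * X ^ 3))%P Hl) as H.
    rewrite (loop_plus _ _ _ _ _ _ _ _ _ Hl), (loop_scal _ _ _ _ _ _ _ (-1) _ Hl) in H.
    assert (Heq : integral x y T (Const sg * X)%P + -1 * integral x y T (Const sg * X ^ 3)%P = 0);
      [|lra].
    apply H. intros u w _. simpl. rewrite Ha, Hb, damping_null. ring. }
  assert (He1 : e * T <= integral x y T (Const sg * X)%P).
  { rewrite <- (integral_const x y T e). apply (loop_le _ _ _ _ _ _ _ _ _ Hl).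
    intros u w Ho. apply (Hsg u w Ho). }
  assert (He2 : integral x y T (Const sg * X ^ 3)%P <= 3 / 2 * integral x y T (X ^ 2)%P).
  { rewrite <- (loop_scal _ _ _ _ _ _ _ _ _ Hl). apply (loop_le _ _ _ _ _ _ _ _ _ Hl).
    intros u w Ho. specialize (Hsg u w Ho). simpl. nra. }
  lra.
- intros N.
  assert (Hgrow : (power_integral s x y T 0 - power_integral s x y T 1) * odd_harmonic N
                  <= power_integral s x y T 0 + INR N ^ 2 * (4 * E * T)).
  { apply moment_sequence_growth.
    - assert (0 < E * T) by now apply Rmult_lt_0_compat. lra.
    - intros k. apply (power_integral_nonneg _ _ _ _ _ _ _ _ _ Hl). intros u w Ho. now apply Hs.
    - intros k.
      pose proof (loop_exact _ _ _ _ _ _ _ (X * Y * s ^ k)%P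
        (Const (- 2 * (2 * INR k + 1)) * (s ^ k) + (Const (2 * (2 * INR k + 1)) * (s ^ S k)
         + (Const (2 * (2 * INR k + 3)) * (s ^ S k) + (Const (- 2 * (2 * INR k + 3)) * (s ^ S (S k))
         + (Const (- 2 * E * (2 * INR k + 1)) * (s ^ k)
         + Const (4 * E * INR k) * (s ^ pred k))))))%P Hl) as H.
      rewrite !(loop_plus _ _ _ _ _ _ _ _ _ Hl), !(loop_scal _ _ _ _ _ _ _ _ _ Hl) in H.
      fold (power_integral s x y T k) (power_integral s x y T (S k)) (power_integral s x y T (S (S k))) (power_integral s x y T (pred k)) in H.
      pose proof (power_integral_le _ _ _ _ _ _ _ s (pred k) Hl Hs) as Hk.
      pose proof (power_integral_nonneg _ _ _ _ _ _ _ s k Hl (fun u w Ho => proj1 (Hs u w Ho))) as Hk1.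
      pose proof (pos_INR k) as Hk0.
      match type of H with _ -> ?eq => assert (Heq : eq) end.
      { apply H. clear H. intros u w Ho.
        assert (Hw : w ^ 2 = u ^ 2 * ev s u w - 2 * E) by (rewrite (Hs0 u w Ho); ring).
        assert (Hu : u ^ 2 = 2 * (1 - ev s u w)) by (unfold s; simpl; field).
        cbn [lie ev]. rewrite damping_null, Ha, Hb.
        replace (lie A null s u w) with (- (u * w)) by (unfold s; simpl; field).
        set (v := ev s u w) in *. 
        replace ((w * w + u * (- (-1 * u + 1 * u ^ 3) + 0 * w)) * v ^ k
                 + u * w * (INR k * v ^ Init.Nat.pred k * - (u * w)))
          with ((w ^ 2 + u ^ 2 - (u ^ 2) ^ 2) * v ^ k - u ^ 2 * w ^ 2 * (INR k * v ^ Init.Nat.pred k)) by ring.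
        rewrite Hw, Hu. clear.
        destruct k as [|k]; [simpl; ring|]. simpl Init.Nat.pred. rewrite S_INR. simpl pow. ring. }
      clear H.
      assert (E * INR k * power_integral s x y T (pred k) <= E * INR k * T).
      { apply Rmult_le_compat_l; [apply Rmult_le_pos; lra|easy]. }
      assert (0 <= E * (2 * INR k + 1) * power_integral s x y T k).
      { apply Rmult_le_pos; [apply Rmult_le_pos; lra|easy]. }
      assert (0 < E * T) by now apply Rmult_lt_0_compat.
      assert (0 <= E * T * INR k) by (apply Rmult_le_pos; lra).
      lra. }
  rewrite power_integral_0, H1 in Hgrow by lra.
  pose proof (odd_harmonic_nonneg N) as HN.
  replace (T - (T - / 2 * integral x y T (X ^ 2)%P)) with ((3 * moment x y T 0 + 4 * E * T) / 2) in Hgrow by lra.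
  assert (0 <= 4 * E * T * odd_harmonic N).
  { apply Rmult_le_pos; [|easy]. apply Rmult_le_pos; lra. }
  lra.
Qed.

(** At the high levels [h = s^2] of the unbounded annuli, [x^2] is at most of the
    order [s]; the lower bound comes from [2 h I_0 = 4 a I_2 + (7/2) I_4]. *)
Lemma unbounded_ratio A s x y T p q :
  A = GlobalCenter \/ A = EightExterior -> 4 <= s -> loop A (s ^ 2) x y T p q ->
  0 < moment x y T 0 /\
  s / 9 * moment x y T 0 <= moment x y T 2 <= 4 * s * moment x y T 0.
Proof.
intros HA Hs Hl. pose proof (period_identity _ _ _ _ _ _ _ Hl) as Hper.
assert (Hb : coef_b A = 1) by (destruct HA as [-> | ->]; easy).
assert (Ha : -1 <= coef_a A <= 1) by (destruct A; simpl; lra).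
assert (HT : 0 < T) by apply Hl.
assert (Hx2 : forall u w, oval A (s ^ 2) u w -> u ^ 2 <= 4 * s).
{ intros u w [Hh _]. unfold Ham in Hh. rewrite Hb in Hh.
  pose proof (pow2_ge_0 w). pose proof (pow2_ge_0 u).
  replace (u ^ 4) with (u ^ 2 * u ^ 2) in Hh by ring.
  set (v := u ^ 2) in *. destruct (Rle_lt_dec v (4 * s)); [easy|exfalso]. nra. }
assert (HI2 : moment x y T 2 <= 4 * s * moment x y T 0).
{ unfold moment. rewrite <- (loop_scal _ _ _ _ _ _ _ _ _ Hl). apply (loop_le _ _ _ _ _ _ _ _ _ Hl).
  intros u w Ho. specialize (Hx2 u w Ho). pose proof (pow2_ge_0 w). cbn [ev].
  replace (u ^ 0) with 1 by reflexivity. nra. }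
assert (HI4 : moment x y T 4 <= 4 * s * moment x y T 2).
{ unfold moment. rewrite <- (loop_scal _ _ _ _ _ _ _ _ _ Hl). apply (loop_le _ _ _ _ _ _ _ _ _ Hl).
  intros u w Ho. specialize (Hx2 u w Ho). pose proof (pow2_ge_0 w). pose proof (pow2_ge_0 u). cbn [ev].
  replace (u ^ 4) with (u ^ 2 * u ^ 2) by ring.
  assert (0 <= u ^ 2 * w ^ 2) by now apply Rmult_le_pos. nra. }
assert (HJ2 : integral x y T (X ^ 2)%P <= 4 * s * T).
{ rewrite <- (integral_const x y T (4 * s)). apply (loop_le _ _ _ _ _ _ _ _ _ Hl).
  intros u w Ho. exact (Hx2 u w Ho). }
assert (HJ0 : 0 <= integral x y T (X ^ 2)%P).
{ replace 0 with (integral x y T (Const 0)) by (rewrite integral_const; ring).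
  apply (loop_le _ _ _ _ _ _ _ _ _ Hl). intros u w Ho. exact (pow2_ge_0 u). }
assert (HI20 : 0 <= moment x y T 2).
{ replace 0 with (integral x y T (Const 0)) by (rewrite integral_const; ring).
  apply (loop_le _ _ _ _ _ _ _ _ _ Hl). intros u w Ho. cbn [ev].
  apply Rmult_le_pos; apply pow2_ge_0. }
assert (HI0 : 0 < moment x y T 0).
{ assert (0 < s * T) by (apply Rmult_lt_0_compat; lra). assert (4 * (s * T) <= s * (s * T)) by nra.
  destruct HA as [-> | ->]; simpl in Hper; lra. }
pose proof (moment_recurrence _ _ _ _ _ _ _ 0 Hl) as Hrec. rewrite Hb in Hrec. simpl in Hrec.
split; [easy|]. split; [|easy].
assert (Hmain : 2 * s ^ 2 * moment x y T 0 <= (4 + 14 * s) * moment x y T 2) by nra.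
assert (2 * s ^ 2 * moment x y T 0 <= 18 * s * moment x y T 2) by nra.
apply Rmult_le_reg_l with (18 * s); [lra|]. lra.
Qed.

Definition bounded (A : annulus) : Prop :=
  A = TruncatedPendulum \/ A = EightInteriorLeft \/ A = EightInteriorRight.

Definition saddle_level (A : annulus) : R :=
  match A with TruncatedPendulum => 1 / 4 | _ => 0 end.

Lemma saddle_period A e x y T p q : bounded A -> 0 < e <= 1 / 12 ->
  loop A (saddle_level A - e ^ 2) x y T p q ->
  0 < moment x y T 0 /\ e * T <= 9 * moment x y T 0 /\
  forall N, 3 * moment x y T 0 * odd_harmonic N <= 2 * T + 2 * INR N ^ 2 * (4 * e ^ 2 * T).
Proof.
intros HA He Hl. assert (HT : 0 < T) by apply Hl.
assert (H : 2 * e * T <= 9 * moment x y T 0 + 12 * e ^ 2 * T /\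
  forall N, 3 * moment x y T 0 * odd_harmonic N <= 2 * T + 2 * INR N ^ 2 * (4 * e ^ 2 * T)).
{ destruct HA as [-> | HA].
  - simpl saddle_level in Hl. destruct (pendulum_period e x y T p q ltac:(lra) Hl) as [H1 H2].
    assert (0 < e * e * T) by (apply Rmult_lt_0_compat; nra).
    split.
    + assert (0 <= moment x y T 0); [|nra].
      replace 0 with (integral x y T (Const 0)) by (rewrite integral_const; ring).
      apply (loop_le _ _ _ _ _ _ _ _ _ Hl). intros u w _. cbn [ev pow].
      rewrite Rmult_1_l. exact (pow2_ge_0 w).
    + intros N. specialize (H2 N). pose proof (pow2_ge_0 (INR N)).
      assert (0 <= INR N ^ 2 * (4 * e ^ 2 * T)) by (apply Rmult_le_pos; nra). lra.
  - replace (saddle_level A - e ^ 2) with (- e ^ 2) in Hl by (destruct HA as [-> | ->]; simpl; ring).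
    exact (eight_period A e x y T p q HA ltac:(lra) Hl). }
destruct H as [H1 H2].
assert (He1 : 12 * e ^ 2 * T <= e * T).
{ apply Rmult_le_compat_r; [lra|nra]. }
assert (0 < e * T) by (apply Rmult_lt_0_compat; lra).
split; [lra|]. split; [lra|easy].
Qed.

Lemma sqrt_sq E : 0 <= E -> sqrt E ^ 2 = E.
Proof. intros H. now apply pow2_sqrt. Qed.

(** On an unbounded annulus [I_2 / I_0] grows like [sqrt h], with [E = 1 / h].  On
    a bounded one the period over [I_0] tends to infinity, but slowly, at the
    saddle level, with [E] the distance to it; by [picard_fuchs], this quotient
    would be rational along with [I_2 / I_0].  Both contradict
    [slow_growth_irrational]. *)
Lemma integrals_independent A (I0 I2 : R -> R) (p2 p1 p0 q2 q1 q0 : R) :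
  (forall h, level A h -> exists x y T p q,
     loop A h x y T p q /\ moment x y T 0 = I0 h /\ moment x y T 2 = I2 h) ->
  (forall h, level A h ->
     (p2 * h ^ 2 + p1 * h + p0) * I2 h + (q2 * h ^ 2 + q1 * h + q0) * I0 h = 0) ->
  p2 = 0 /\ p1 = 0 /\ p0 = 0 /\ q2 = 0 /\ q1 = 0 /\ q0 = 0.
Proof.
intros Hloops Hrel.
assert (Hcases : (A = GlobalCenter \/ A = EightExterior) \/ bounded A)
  by (unfold bounded; destruct A; tauto).
destruct Hcases as [HA | HA].
- set (r := fun E => I2 (/ E) / I0 (/ E)).
  assert (Hfact : forall E, 0 < E < 1 / 16 -> exists s, 4 <= s /\ E * s ^ 2 = 1 /\ / E = s ^ 2 /\
            s / 9 <= r E <= 4 * s /\ level A (/ E) /\ 0 < I0 (/ E)).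
  { intros E HE. assert (HiE : 16 < / E).
    { replace 16 with (/ (1 / 16)) by field. apply Rinv_lt_contravar; [nra|lra]. }
    exists (sqrt (/ E)). rewrite sqrt_sq by lra.
    assert (Hs : 4 <= sqrt (/ E)).
    { replace 4 with (sqrt (4 ^ 2)) by (apply sqrt_pow2; lra). apply sqrt_le_1_alt. lra. }
    split; [easy|]. split; [field; lra|]. split; [easy|].
    assert (Hlev : level A (/ E)) by (destruct HA as [-> | ->]; simpl; lra).
    destruct (Hloops _ Hlev) as (x & y & T & p & q & Hl & H0 & H2).
    replace (/ E) with (sqrt (/ E) ^ 2) in Hl by (apply sqrt_sq; lra).
    destruct (unbounded_ratio A _ x y T p q HA Hs Hl) as [HI [Hlo Hhi]]. rewrite H0, H2 in *.
    split; [|now split]. unfold r. split.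
    - apply Rmult_le_reg_r with (I0 (/ E)); [easy|].
      replace (I2 (/ E) / I0 (/ E) * I0 (/ E)) with (I2 (/ E)) by (field; lra). easy.
    - apply Rmult_le_reg_r with (I0 (/ E)); [easy|].
      replace (I2 (/ E) / I0 (/ E) * I0 (/ E)) with (I2 (/ E)) by (field; lra). easy. }
  destruct (slow_growth_irrational r (1 / 16)) with
    (la := p2 :: p1 :: p0 :: nil) (lb := - q2 :: - q1 :: - q0 :: nil) as [Hp Hq].
  + lra.
  + intros M. set (K := 9 * (Rabs M + 1)).
    assert (HK : 9 <= K) by (unfold K; pose proof (Rabs_pos M); lra).
    exists (Rmin (1 / 16) (/ K ^ 2)).
    assert (HKi : 0 < / K ^ 2) by (apply Rinv_0_lt_compat; nra).
    split; [apply Rmin_glb_lt; lra|].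
    intros E HE. pose proof (Rmin_l (1 / 16) (/ K ^ 2)). pose proof (Rmin_r (1 / 16) (/ K ^ 2)).
    destruct (Hfact E) as (s & Hs & HEs & _ & Hr & _); [lra|].
    assert (HEK : E * K ^ 2 < 1).
    { replace 1 with (/ K ^ 2 * K ^ 2) by (field; lra). apply Rmult_lt_compat_r; [nra|lra]. }
    assert (K <= s). { destruct (Rle_lt_dec K s); [easy|]. assert (s ^ 2 < K ^ 2) by nra.
      assert (E * s ^ 2 < E * K ^ 2) by (apply Rmult_lt_compat_l; lra). lra. }
    pose proof (Rle_abs M). unfold K in *. lra.
  + intros eps Heps. exists (Rmin (1 / 16) (eps ^ 2 / 16)).
    split; [apply Rmin_glb_lt; nra|].
    intros E HE. pose proof (Rmin_l (1 / 16) (eps ^ 2 / 16)). pose proof (Rmin_r (1 / 16) (eps ^ 2 / 16)).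
    destruct (Hfact E) as (s & Hs & HEs & _ & Hr & _); [lra|].
    assert (Hes : 4 <= eps * s).
    { destruct (Rle_lt_dec 4 (eps * s)); [easy|exfalso].
      assert ((eps * s) ^ 2 < 16) by (assert (0 < eps * s) by (apply Rmult_lt_0_compat; lra); nra).
      assert (E * s ^ 2 < eps ^ 2 / 16 * s ^ 2) by (apply Rmult_lt_compat_r; [nra|lra]). nra. }
    assert (HE4 : E * (4 * s) <= eps).
    { apply Rmult_le_reg_r with s; [lra|]. nra. }
    assert (E * r E <= E * (4 * s)) by (apply Rmult_le_compat_l; lra). lra.
  + reflexivity.
  + intros E HE. destruct (Hfact E HE) as (s & Hs & HEs & HEi & Hr & Hlev & HI).
    specialize (Hrel _ Hlev). rewrite !horner3.
    assert (HI2 : I2 (/ E) = r E * I0 (/ E)) by (unfold r; field; lra).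
    rewrite HI2 in Hrel.
    assert (Hz : (p2 * (/ E) ^ 2 + p1 * / E + p0) * r E + (q2 * (/ E) ^ 2 + q1 * / E + q0) = 0).
    { apply Rmult_eq_reg_r with (I0 (/ E)); [|lra]. lra. }
    apply (Rmult_eq_compat_l (E ^ 2)) in Hz.
    replace (E ^ 2 * ((p2 * (/ E) ^ 2 + p1 * / E + p0) * r E + (q2 * (/ E) ^ 2 + q1 * / E + q0)))
      with ((p2 + p1 * E + p0 * E ^ 2) * r E + (q2 + q1 * E + q0 * E ^ 2)) in Hz by (field; lra).
    lra.
  + rewrite !Forall_cons_iff in Hp, Hq. intuition lra.
- set (h := fun E => saddle_level A - E).
  set (r := fun E => ((12 * h E + 4 * coef_b A) + 5 * coef_a A * (I2 (h E) / I0 (h E)))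
                     / (4 * h E * (4 * h E + coef_b A))).
  assert (Hlev : forall E, 0 < E < 1 / 4 -> level A (h E)).
  { intros E HE. unfold h. destruct HA as [-> | [-> | ->]]; simpl; lra. }
  assert (Hden : forall E, 0 < E < 1 / 4 -> 4 * h E * (4 * h E + coef_b A) <> 0).
  { intros E HE. unfold h. apply Rmult_integral_contrapositive.
    destruct HA as [-> | [-> | ->]]; simpl; split; lra. }
  assert (Hfact : forall E, 0 < E < 1 / 144 -> exists e, 0 < e <= 1 / 12 /\ e ^ 2 = E /\
     0 < I0 (h E) /\ 0 < r E /\ e * r E <= 9 /\
     forall N, 3 * odd_harmonic N <= (2 + 2 * INR N ^ 2 * (4 * E)) * r E).
  { intros E HE. exists (sqrt E). rewrite sqrt_sq by lra.
    assert (He : 0 < sqrt E <= 1 / 12).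
    { split; [apply sqrt_lt_R0; lra|].
      replace (1 / 12) with (sqrt ((1 / 12) ^ 2)) by (apply sqrt_pow2; lra).
      apply sqrt_le_1_alt. lra. }
    split; [easy|]. split; [easy|].
    destruct (Hloops _ (Hlev E ltac:(lra))) as (x & y & T & p & q & Hl & H0 & H2).
    pose proof (picard_fuchs _ _ _ _ _ _ _ Hl) as HPF.
    assert (HT : 0 < T) by apply Hl.
    unfold h in Hl. replace E with (sqrt E ^ 2) in Hl by (apply sqrt_sq; lra).
    destruct (saddle_period A _ x y T p q HA He Hl) as (HI & Hup & Hlow).
    rewrite sqrt_sq in Hlow by lra. rewrite H0, H2 in *.
    assert (HrT : T = r E * I0 (h E)).
    { specialize (Hden E ltac:(lra)). apply Rmult_eq_reg_l with (4 * h E * (4 * h E + coef_b A)); [|easy].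
      rewrite HPF. unfold r. field. split; [lra|].
      split; intros Hc; apply Hden; rewrite Hc; ring. }
    split; [easy|]. rewrite HrT in HT, Hup, Hlow.
    split; [destruct (Rlt_le_dec 0 (r E)); [easy|nra]|].
    split.
    - apply Rmult_le_reg_r with (I0 (h E)); [easy|]. lra.
    - intros N. apply Rmult_le_reg_r with (I0 (h E)); [easy|]. specialize (Hlow N). lra. }
  (* the coefficients of both sides in powers of [E], where
     [4 h (4 h + b) = - 8 al E + 16 E^2] and [12 h + 4 b = b0 - 12 E] *)
  set (P0 := p2 * saddle_level A ^ 2 + p1 * saddle_level A + p0).
  set (P1 := - 2 * saddle_level A * p2 - p1).
  set (R0 := q2 * saddle_level A ^ 2 + q1 * saddle_level A + q0).
  set (R1 := - 2 * saddle_level A * q2 - q1).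
  set (al := 4 * saddle_level A + coef_b A / 2).
  set (b0 := 12 * saddle_level A + 4 * coef_b A).
  destruct (slow_growth_irrational r (1 / 144)) with
    (la := 0 :: - 8 * al * P0 :: 16 * P0 - 8 * al * P1 :: 16 * P1 - 8 * al * p2 :: 16 * p2 :: nil)
    (lb := b0 * P0 - 5 * coef_a A * R0 :: b0 * P1 - 12 * P0 - 5 * coef_a A * R1
           :: b0 * p2 - 12 * P1 - 5 * coef_a A * q2 :: - 12 * p2 :: 0 :: nil) as [Hp Hq].
  + lra.
  + intros M. destruct (odd_harmonic_unbounded (2 * Rabs M + 1)) as [N HN].
    destruct (choose_small ((1, 1 / 144) :: (4 * INR N ^ 2, 1) :: nil)) as (d & Hd & Hsm).
    { repeat constructor; simpl; lra. }
    exists d. split; [easy|]. intros E HE. specialize (Hsm E ltac:(lra)).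
    rewrite !Forall_cons_iff in Hsm. cbn [fst snd] in Hsm. destruct Hsm as (H1 & H2 & _).
    destruct (Hfact E ltac:(lra)) as (e & He & HeE & HI & Hr & Hup & Hlow).
    specialize (Hlow N). pose proof (Rle_abs M). pose proof (Rabs_pos M).
    assert ((2 + 2 * INR N ^ 2 * (4 * E)) * r E <= 4 * r E) by (apply Rmult_le_compat_r; lra).
    lra.
  + intros eps Heps. exists (Rmin (1 / 144) ((eps / 9) ^ 2)).
    split; [apply Rmin_glb_lt; nra|]. intros E HE.
    pose proof (Rmin_l (1 / 144) ((eps / 9) ^ 2)). pose proof (Rmin_r (1 / 144) ((eps / 9) ^ 2)).
    destruct (Hfact E ltac:(lra)) as (e & He & HeE & HI & Hr & Hup & Hlow).
    assert (e <= eps / 9) by (destruct (Rle_lt_dec e (eps / 9)); [easy|nra]).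
    rewrite <- HeE. replace (e ^ 2 * r (e ^ 2)) with (e * (e * r (e ^ 2))) by ring.
    rewrite HeE. nra.
  + reflexivity.
  + intros E HE. destruct (Hfact E HE) as (e & _ & _ & HI & _).
    specialize (Hden E ltac:(lra)). specialize (Hrel _ (Hlev E ltac:(lra))).
    assert (Hrho : r E * (4 * h E * (4 * h E + coef_b A))
              = (12 * h E + 4 * coef_b A) + 5 * coef_a A * (I2 (h E) / I0 (h E))).
    { unfold r. field. split; [lra|]. split; intros Hc; apply Hden; rewrite Hc; ring. }
    set (w := I2 (h E) / I0 (h E)) in *.
    assert (Hw : I2 (h E) = w * I0 (h E)) by (unfold w; field; lra).
    assert (Hz : (p2 * h E ^ 2 + p1 * h E + p0) * w + (q2 * h E ^ 2 + q1 * h E + q0) = 0).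
    { apply Rmult_eq_reg_r with (I0 (h E)); [|lra]. rewrite Hw in Hrel. lra. }
    assert (Hfin : (p2 * h E ^ 2 + p1 * h E + p0) * (r E * (4 * h E * (4 * h E + coef_b A)))
       = (p2 * h E ^ 2 + p1 * h E + p0) * (12 * h E + 4 * coef_b A)
         - 5 * coef_a A * (q2 * h E ^ 2 + q1 * h E + q0)).
    { rewrite Hrho.
      replace (q2 * h E ^ 2 + q1 * h E + q0) with (- ((p2 * h E ^ 2 + p1 * h E + p0) * w)) by lra. ring. }
    clear - Hfin HA. unfold P0, P1, R0, R1, al, b0. unfold h in Hfin.
    destruct HA as [-> | [-> | ->]]; simpl in *; lra.
  + rewrite !Forall_cons_iff in Hp, Hq. unfold P0, P1, R0, R1, al, b0 in *.
    destruct HA as [-> | [-> | ->]]; simpl in *; intuition lra.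
Qed.

(** * Expansion of the displacement *)

(** Coordinates of the parameter in which [kernel_damping] is the direction of
    [L3]: the damping is the sum of [coord j * mono j] over all [j]. *)
Definition coord (A : annulus) (l : param -> R) (j : param) : R :=
  match j with
  | L2 => l L2 + 3 * coef_a A * l L3
  | L4 => l L4 + 3 * coef_b A * l L3
  | _ => l j
  end.

Definition mono (A : annulus) (j : param) : bipoly :=
  match j with
  | L1 => X ^ 0
  | L2 => X ^ 2
  | L3 => kernel_damping A
  | L4 => X ^ 4
  | L5 => Y ^ 4
  | L6 => X ^ 6
  end%P.

(** The sum over the directions transverse to [kernel_damping]. *)
Definition sum5 (f : param -> R) : R := f L1 + f L2 + f L4 + f L5 + f L6.

Lemma damping_coord A l u w :
  damping l u w = sum5 (fun j => coord A l j * ev (mono A j) u w) + l L3 * ev (kernel_damping A) u w.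
Proof. unfold damping, sum5, kernel_damping. simpl. ring. Qed.

Definition weight (A : annulus) (v : R) (j : param) : bipoly :=
  (mono A j * Y ^ 2 + (Const v * (mono A j * (cof1 * Y ^ 2))
                       + Const (v ^ 2) * (mono A j * (cof2 A * Y ^ 2))))%P.

(** The Hamiltonian corrected by the two steps of Francoise's algorithm. *)
Definition corrected (A : annulus) (v : R) : bipoly :=
  (HamP A + (Const (- v) * exact1 + Const (- v ^ 2) * exact2 A))%P.

Lemma lie_corrected A l u w :
  lie A l (corrected A (l L3)) u w =
  sum5 (fun j => coord A l j * ev (weight A (l L3) j) u w)
  + l L3 ^ 3 * ev (cof2 A * kernel_damping A * Y ^ 2)%P u w.
Proof.
pose proof (francoise_step1 A l u w) as H6. pose proof (francoise_step2 A l u w) as H7.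
pose proof (lie_HamP A l u w) as HH. rewrite (damping_coord A) in HH.
unfold corrected. cbn [lie].
replace (lie A l exact1 u w) with (ev (kernel_damping A) u w * w ^ 2 - ev cof1 u w * lie A l (HamP A) u w) by lra.
replace (lie A l (exact2 A) u w)
  with (ev cof1 u w * (ev (kernel_damping A) u w * w ^ 2) - ev (cof2 A) u w * lie A l (HamP A) u w) by lra.
rewrite HH. unfold sum5, weight. cbn [ev].
generalize (ev (mono A L1) u w) (ev (mono A L2) u w) (ev (mono A L4) u w)
  (ev (mono A L5) u w) (ev (mono A L6) u w) (ev (kernel_damping A) u w) (ev cof1 u w) (ev (cof2 A) u w).
intros. ring.
Qed.

(** The Melnikov integrals, taken along the perturbed orbit itself, so that the
    identity is exact.  No term linear or quadratic in [l L3] alone is left. *)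
Lemma displacement_identity A l x y T : 0 <= T -> solution A l x y T ->
  ev (corrected A (l L3)) (x T) (y T) - ev (corrected A (l L3)) (x 0) (y 0) =
  sum5 (fun j => coord A l j * integral x y T (weight A (l L3) j))
  + l L3 ^ 3 * integral x y T (cof2 A * kernel_damping A * Y ^ 2)%P.
Proof.
intros HT Hs.
rewrite <- (integral_lie A l x y T
  (Const (coord A l L1) * weight A (l L3) L1 + (Const (coord A l L2) * weight A (l L3) L2
   + (Const (coord A l L4) * weight A (l L3) L4 + (Const (coord A l L5) * weight A (l L3) L5
   + (Const (coord A l L6) * weight A (l L3) L6
   + Const (l L3 ^ 3) * (cof2 A * kernel_damping A * Y ^ 2))))))%P _ HT Hs).
- rewrite !(integral_plus A l) by easy. rewrite !(integral_scal A l) by easy. unfold sum5. ring.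
- intros t Ht. rewrite lie_corrected. unfold sum5.
  generalize (weight A (l L3) L1) (weight A (l L3) L2) (weight A (l L3) L4)
   (weight A (l L3) L5) (weight A (l L3) L6) (cof2 A * kernel_damping A * Y ^ 2)%P.
  intros. cbn [ev]. ring.
Qed.

Section Expansion.

Variables (A : annulus) (sx sy : R -> R) (h : R) (x y : R -> R) (T : R).
Hypothesis Hcs : cross_section A sx sy.
Hypothesis Hlev : level A h.
Hypothesis Hl : loop A h x y T (sx h) (sy h).

Lemma integral_close P eps : 0 < eps -> exists mu, 0 < mu /\ forall l h' x' y' T',
  (forall j, Rabs (l j) <= mu) -> returns A sx sy l h h' x' y' T' ->
  Rabs (integral x' y' T' P - integral x y T P) < eps.
Proof.
intros Heps. pose proof Hl as (HT & Hs & _).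
destruct (solution_bounded A null x y (2 * T) ltac:(lra) Hs) as (B & HB & HxB).
destruct (ev_lipschitz P (B + 1)) as (K & HK & HP).
destruct (choose_small ((1, 1) :: (K * (4 * T + 1), eps) :: nil)) as (z & Hz & Hsm).
{ repeat constructor; simpl; lra. }
specialize (Hsm z ltac:(lra)). rewrite !Forall_cons_iff in Hsm. simpl in Hsm.
destruct Hsm as (Hz1 & Hz2 & _).
destruct (return_close A sx sy h x y T Hcs Hlev Hl z Hz) as (mu & Hmu & Hclose).
exists mu. split; [easy|]. intros l h' x' y' T' Hlmu Hret.
destruct (Hclose l h' x' y' T' Hlmu Hret) as (HTT & HT2 & Hcl).
destruct Hret as (HT' & Hs' & _).
assert (Hex : ex_RInt (fun t => ev P (x t) (y t)) 0 T') by (apply (ev_integrable A null _ _ (2 * T)); [easy|lra|lra]).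
assert (Hex' : ex_RInt (fun t => ev P (x' t) (y' t)) 0 T') by (apply (ev_integrable A l _ _ T'); [easy|lra|lra]).
assert (H1 : Rabs (integral x' y' T' P - integral x y T' P) <= 2 * T * (K * (2 * z))).
{ unfold integral.
  change (Rabs (minus (RInt (fun t => ev P (x' t) (y' t)) 0 T') (RInt (fun t => ev P (x t) (y t)) 0 T'))
          <= 2 * T * (K * (2 * z))).
  rewrite <- (RInt_minus (V := R_CompleteNormedModule) _ _ 0 T' Hex' Hex).
  apply Rle_trans with ((T' - 0) * (K * (2 * z))).
  - apply abs_RInt_le_const; [lra| |].
    + now apply (ex_RInt_minus (V := R_CompleteNormedModule)).
    + intros t Ht. destruct (Hcl t Ht) as [Hx Hy]. destruct (HxB t ltac:(lra)) as [Hbx Hby].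
      assert (Hbx' : Rabs (x' t) <= B + 1).
      { replace (x' t) with (x t + (x' t - x t)) by ring. eapply Rle_trans; [apply Rabs_triang|]. lra. }
      assert (Hby' : Rabs (y' t) <= B + 1).
      { replace (y' t) with (y t + (y' t - y t)) by ring. eapply Rle_trans; [apply Rabs_triang|]. lra. }
      destruct (HP (x' t) (y' t) (x t) (y t)) as [Hd _]; try lra.
      eapply Rle_trans; [exact Hd|]. apply Rmult_le_compat_l; lra.
  - apply Rmult_le_compat_r; [|lra]. apply Rmult_le_pos; lra. }
assert (Hpiece : forall a b, 0 <= a <= b -> b <= 2 * T ->
          Rabs (integral x y b P - integral x y a P) <= (b - a) * K).
{ intros a b Hab Hb. unfold integral.
  assert (Ha1 : ex_RInt (fun t => ev P (x t) (y t)) 0 a) by (apply (ev_integrable A null _ _ (2 * T)); [easy|lra|lra]).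
  assert (Ha2 : ex_RInt (fun t => ev P (x t) (y t)) a b) by (apply (ev_integrable A null _ _ (2 * T)); [easy|lra|lra]).
  rewrite <- (RInt_Chasles (V := R_CompleteNormedModule) _ 0 a b Ha1 Ha2).
  unfold plus; simpl.
  rewrite Rplus_minus_l.
  apply abs_RInt_le_const; [lra|easy|].
  intros t Ht. destruct (HxB t ltac:(lra)) as [Hbx Hby].
  apply (HP (x t) (y t) (x t) (y t)); lra. }
assert (H2 : Rabs (integral x y T' P - integral x y T P) <= z * K).
{ apply Rabs_def2 in HTT. destruct (Rle_lt_dec T' T) as [Hle|Hlt].
  - rewrite Rabs_minus_sym. eapply Rle_trans; [apply Hpiece; lra|]. apply Rmult_le_compat_r; lra.
  - eapply Rle_trans; [apply Hpiece; lra|]. apply Rmult_le_compat_r; lra. }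
replace (integral x' y' T' P - integral x y T P) with
  ((integral x' y' T' P - integral x y T' P) + (integral x y T' P - integral x y T P)) by ring.
eapply Rle_lt_trans; [apply Rabs_triang|]. lra.
Qed.

Lemma weight_close j eps : 0 < eps -> exists mu, 0 < mu /\ forall l h' x' y' T',
  (forall j, Rabs (l j) <= mu) -> returns A sx sy l h h' x' y' T' ->
  Rabs (integral x' y' T' (weight A (l L3) j) - integral x y T (mono A j * Y ^ 2)%P) < eps.
Proof.
intros Heps.
destruct (integral_close (mono A j * Y ^ 2)%P (eps / 2)) as (m0 & Hm0 & H0); [lra|].
set (J1 := integral x y T (mono A j * (cof1 * Y ^ 2))%P).
set (J2 := integral x y T (mono A j * (cof2 A * Y ^ 2))%P).
destruct (integral_close (mono A j * (cof1 * Y ^ 2))%P 1) as (m1 & Hm1 & H1); [lra|].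
destruct (integral_close (mono A j * (cof2 A * Y ^ 2))%P 1) as (m2 & Hm2 & H2); [lra|].
fold J1 in H1. fold J2 in H2.
destruct (choose_small ((1, m0) :: (1, m1) :: (1, m2) :: (1, 1) ::
  (Rabs J1 + 1 + (Rabs J2 + 1), eps / 2) :: nil)) as (mu & Hmu & Hsm).
{ repeat constructor; simpl; lra. }
specialize (Hsm mu ltac:(lra)). rewrite !Forall_cons_iff in Hsm. simpl in Hsm.
destruct Hsm as (Ha & Hb & Hc & Hd & He & _).
exists mu. split; [easy|]. intros l h' x' y' T' Hlmu Hret.
assert (Hsmall : forall m, mu < m -> forall j, Rabs (l j) <= m).
{ intros m Hm k. specialize (Hlmu k). lra. }
specialize (H0 l h' x' y' T' (Hsmall m0 ltac:(lra)) Hret).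
specialize (H1 l h' x' y' T' (Hsmall m1 ltac:(lra)) Hret).
specialize (H2 l h' x' y' T' (Hsmall m2 ltac:(lra)) Hret).
destruct Hret as (HT' & Hs' & _).
unfold weight. rewrite !(integral_plus A l), !(integral_scal A l) by (easy || lra).
set (K1 := integral x' y' T' (mono A j * (cof1 * Y ^ 2))%P) in *.
set (K2 := integral x' y' T' (mono A j * (cof2 A * Y ^ 2))%P) in *.
set (v := l L3). assert (Hv : Rabs v <= mu) by apply Hlmu.
assert (HK1 : Rabs K1 <= Rabs J1 + 1).
{ replace K1 with (J1 + (K1 - J1)) by ring. eapply Rle_trans; [apply Rabs_triang|]. lra. }
assert (HK2 : Rabs K2 <= Rabs J2 + 1).
{ replace K2 with (J2 + (K2 - J2)) by ring. eapply Rle_trans; [apply Rabs_triang|]. lra. }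
assert (Hv1 : Rabs (v * K1) <= mu * (Rabs J1 + 1)) by now apply Rabs_mult_le.
assert (Hv2 : Rabs (v ^ 2 * K2) <= mu * (Rabs J2 + 1)).
{ apply Rabs_mult_le; [|easy]. replace (v ^ 2) with (v * v) by ring.
  eapply Rle_trans; [apply (Rabs_mult_le v v mu mu); easy|]. nra. }
match goal with |- Rabs (?u + (?v + ?w) - ?z) < _ => replace (u + (v + w) - z) with ((u - z) + (v + w)) by ring end.
eapply Rle_lt_trans; [apply Rabs_triang|].
pose proof (Rabs_triang (v * K1) (v ^ 2 * K2)). lra.
Qed.

Lemma return_level_close eps : 0 < eps -> exists mu, 0 < mu /\ forall l h' x' y' T',
  (forall j, Rabs (l j) <= mu) -> returns A sx sy l h h' x' y' T' -> Rabs (h' - h) < eps.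
Proof.
intros Heps. pose proof Hl as (HT & Hs & _ & _ & _ & _ & _ & Hov).
destruct (solution_bounded A null x y (2 * T) ltac:(lra) Hs) as (B & HB & HxB).
destruct (ev_lipschitz (HamP A) (B + 1)) as (K & HK & HP).
destruct (choose_small ((1, 1) :: (K * 2, eps) :: nil)) as (z & Hz & Hsm).
{ repeat constructor; simpl; lra. }
specialize (Hsm z ltac:(lra)). rewrite !Forall_cons_iff in Hsm. simpl in Hsm.
destruct Hsm as (Hz1 & Hz2 & _).
destruct (return_close A sx sy h x y T Hcs Hlev Hl z Hz) as (mu & Hmu & Hclose).
exists mu. split; [easy|]. intros l h' x' y' T' Hlmu Hret.
destruct (Hclose l h' x' y' T' Hlmu Hret) as (HTT & HT2 & Hcl).
destruct Hret as (HT' & Hs' & _ & _ & Hlev' & HxT & HyT & _).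
assert (Hh' : ev (HamP A) (x' T') (y' T') = h').
{ rewrite HxT, HyT, ev_HamP. apply (Hcs h' Hlev'). }
assert (Hh : ev (HamP A) (x T') (y T') = h).
{ rewrite ev_HamP. apply Hov. lra. }
rewrite <- Hh', <- Hh.
destruct (Hcl T') as [Hx Hy]; [lra|]. destruct (HxB T' ltac:(lra)) as [Hbx Hby].
assert (Hbx' : Rabs (x' T') <= B + 1).
{ replace (x' T') with (x T' + (x' T' - x T')) by ring. eapply Rle_trans; [apply Rabs_triang|]. lra. }
assert (Hby' : Rabs (y' T') <= B + 1).
{ replace (y' T') with (y T' + (y' T' - y T')) by ring. eapply Rle_trans; [apply Rabs_triang|]. lra. }
destruct (HP (x' T') (y' T') (x T') (y T')) as [Hd _]; try lra.
eapply Rle_lt_trans; [exact Hd|].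
assert (K * (Rabs (x' T' - x T') + Rabs (y' T' - y T')) <= K * (2 * z)) by (apply Rmult_le_compat_l; lra).
lra.
Qed.

Lemma section_poly_lipschitz P : exists d K, 0 < d /\ 0 <= K /\
  forall h', Rabs (h' - h) < d ->
    Rabs (ev P (sx h') (sy h') - ev P (sx h) (sy h)) <= K * Rabs (h' - h).
Proof.
destruct (section_lipschitz A sx sy h Hcs Hlev) as (d & L & Hd & HL & HsL).
destruct (ev_lipschitz P (Rabs (sx h) + Rabs (sy h) + L * d)) as (K & HK & HP).
exists d, (2 * K * L). split; [easy|]. split; [apply Rmult_le_pos; lra|].
intros h' Hh'. destruct (HsL h' Hh') as [Hx Hy].
assert (HLd : L * Rabs (h' - h) <= L * d) by (apply Rmult_le_compat_l; lra).
pose proof (Rabs_pos (sx h)). pose proof (Rabs_pos (sy h)).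
assert (0 <= L * d) by (apply Rmult_le_pos; lra).
assert (Hbx : Rabs (sx h') <= Rabs (sx h) + Rabs (sy h) + L * d).
{ replace (sx h') with (sx h + (sx h' - sx h)) by ring. eapply Rle_trans; [apply Rabs_triang|]. lra. }
assert (Hby : Rabs (sy h') <= Rabs (sx h) + Rabs (sy h) + L * d).
{ replace (sy h') with (sy h + (sy h' - sy h)) by ring. eapply Rle_trans; [apply Rabs_triang|]. lra. }
destruct (HP (sx h') (sy h') (sx h) (sy h)) as [Hd' _]; try lra.
eapply Rle_trans; [exact Hd'|].
replace (2 * K * L * Rabs (h' - h)) with (K * (2 * (L * Rabs (h' - h)))) by ring.
apply Rmult_le_compat_l; lra.
Qed.

Definition first_order (j : param) : R := integral x y T (mono A j * Y ^ 2)%P.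

Definition third_order : R := integral x y T (cof2 A * kernel_damping A * Y ^ 2)%P.

Lemma sum5_abs (f g : param -> R) eps : (forall j, Rabs (g j) <= eps) ->
  Rabs (sum5 (fun j => f j * g j)) <= eps * sum5 (fun j => Rabs (f j)).
Proof.
intros H. unfold sum5.
assert (Ht : forall j, Rabs (f j * g j) <= eps * Rabs (f j)).
{ intros j. rewrite Rmult_comm. apply Rabs_mult_le; [apply H|lra]. }
rewrite !Rmult_plus_distr_l.
repeat (eapply Rle_trans; [apply Rabs_triang|]; apply Rplus_le_compat; [|apply Ht]).
apply Ht.
Qed.

(** The expansion of the displacement on the generators of the Bautin ideal: the
    five coordinates transverse to [kernel_damping], and the cube of the sixth.
    In [displacement_identity] the integrals tend to those along the closed orbit;
    the endpoints of the perturbed orbit lie on the section at distance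
    [O(h' - h)], so that the two correction terms are negligible against [h' - h]. *)
Lemma displacement_expansion eps : 0 < eps -> exists mu, 0 < mu /\ forall l h' x' y' T',
  (forall j, Rabs (l j) <= mu) -> returns A sx sy l h h' x' y' T' ->
  Rabs (h' - h - (sum5 (fun j => coord A l j * first_order j) + l L3 ^ 3 * third_order))
  <= eps * (sum5 (fun j => Rabs (coord A l j)) + Rabs (l L3 ^ 3)).
Proof.
intros Heps.
set (eta := Rmin 1 (eps / 2)).
assert (Heta : 0 < eta) by (apply Rmin_glb_lt; lra).
assert (Heta1 : eta <= 1) by apply Rmin_l. assert (Heta2 : eta <= eps / 2) by apply Rmin_r.
destruct (weight_close L1 eta Heta) as (m1 & Hm1 & H1).
destruct (weight_close L2 eta Heta) as (m2 & Hm2 & H2).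
destruct (weight_close L3 eta Heta) as (m3 & Hm3 & H3).
destruct (weight_close L4 eta Heta) as (m4 & Hm4 & H4).
destruct (weight_close L5 eta Heta) as (m5 & Hm5 & H5).
destruct (weight_close L6 eta Heta) as (m6 & Hm6 & H6).
destruct (integral_close (cof2 A * kernel_damping A * Y ^ 2)%P eta Heta) as (m7 & Hm7 & H7).
destruct (section_poly_lipschitz exact1) as (d6 & K6 & Hd6 & HK6 & HQ6).
destruct (section_poly_lipschitz (exact2 A)) as (d7 & K7 & Hd7 & HK7 & HQ7).
destruct (return_level_close (Rmin d6 d7)) as (m8 & Hm8 & H8); [now apply Rmin_glb_lt|].
set (C0 := Rabs third_order + (Rabs (first_order L1) + Rabs (first_order L2)
  + Rabs (first_order L3) + Rabs (first_order L4) + Rabs (first_order L5) + Rabs (first_order L6))).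
assert (HC0 : Rabs third_order <= C0 /\ forall j, Rabs (first_order j) <= C0).
{ pose proof (Rabs_pos third_order). pose proof (Rabs_pos (first_order L1)).
  pose proof (Rabs_pos (first_order L2)). pose proof (Rabs_pos (first_order L3)).
  pose proof (Rabs_pos (first_order L4)). pose proof (Rabs_pos (first_order L5)).
  pose proof (Rabs_pos (first_order L6)). unfold C0. split; [lra|]. intros []; lra. }
destruct HC0 as [HCG HCF].
assert (HC0 : 0 <= C0) by (pose proof (Rabs_pos third_order); lra).
destruct (choose_small ((1, m1) :: (1, m2) :: (1, m3) :: (1, m4) :: (1, m5) :: (1, m6) :: (1, m7)
  :: (1, m8) :: (1, 1) :: (K6 + K7, 1 / 2) :: ((K6 + K7) * (4 * (C0 + 1)), eps) :: nil)) as (mu & Hmu & Hsm).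
{ repeat constructor; simpl; lra. }
specialize (Hsm mu ltac:(lra)). rewrite !Forall_cons_iff in Hsm. cbn [fst snd] in Hsm.
destruct Hsm as (S1 & S2 & S3 & S4 & S5 & S6 & S7 & S8 & S9 & S10 & S11 & _).
exists mu. split; [easy|]. intros l h' x' y' T' Hlmu Hret.
assert (Hsmall : forall m, mu < m -> forall j, Rabs (l j) <= m).
{ intros m Hm k. specialize (Hlmu k). lra. }
specialize (H1 l h' x' y' T' (Hsmall m1 ltac:(lra)) Hret).
specialize (H2 l h' x' y' T' (Hsmall m2 ltac:(lra)) Hret).
specialize (H3 l h' x' y' T' (Hsmall m3 ltac:(lra)) Hret).
specialize (H4 l h' x' y' T' (Hsmall m4 ltac:(lra)) Hret).
specialize (H5 l h' x' y' T' (Hsmall m5 ltac:(lra)) Hret).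
specialize (H6 l h' x' y' T' (Hsmall m6 ltac:(lra)) Hret).
specialize (H7 l h' x' y' T' (Hsmall m7 ltac:(lra)) Hret).
specialize (H8 l h' x' y' T' (Hsmall m8 ltac:(lra)) Hret).
destruct Hret as (HT' & Hs' & Hx0 & Hy0 & Hlev' & HxT & HyT & _).
pose proof (displacement_identity A l x' y' T' ltac:(lra) Hs') as Hid.
rewrite Hx0, Hy0, HxT, HyT in Hid. unfold corrected in Hid. cbn [ev] in Hid.
rewrite !ev_HamP in Hid.
rewrite (proj1 (proj1 (Hcs h Hlev))), (proj1 (proj1 (Hcs h' Hlev'))) in Hid.
pose proof (Rmin_l d6 d7). pose proof (Rmin_r d6 d7).
specialize (HQ6 h' ltac:(lra)). specialize (HQ7 h' ltac:(lra)).
set (D := h' - h) in *. set (v := l L3) in *.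
set (dQ6 := ev exact1 (sx h') (sy h') - ev exact1 (sx h) (sy h)) in *.
set (dQ7 := ev (exact2 A) (sx h') (sy h') - ev (exact2 A) (sx h) (sy h)) in *.
set (N := sum5 (fun j => Rabs (coord A l j)) + Rabs (v ^ 3)).
set (main := sum5 (fun j => coord A l j * first_order j) + v ^ 3 * third_order).
set (K := fun j => integral x' y' T' (weight A v j) - first_order j).
set (KG := integral x' y' T' (cof2 A * kernel_damping A * Y ^ 2)%P - third_order) in *.
assert (HK : forall j, Rabs (K j) <= eta) by (intros []; unfold K, first_order; lra).
assert (Hv : Rabs v <= mu) by apply Hlmu.
assert (HN : 0 <= N).
{ unfold N, sum5. pose proof (Rabs_pos (v ^ 3)). pose proof (Rabs_pos (coord A l L1)).
  pose proof (Rabs_pos (coord A l L2)). pose proof (Rabs_pos (coord A l L4)).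
  pose proof (Rabs_pos (coord A l L5)). pose proof (Rabs_pos (coord A l L6)). lra. }
assert (HD : D - main = (v * dQ6 + v ^ 2 * dQ7)
               + (sum5 (fun j => coord A l j * K j) + v ^ 3 * KG)).
{ unfold main, K, KG, D, dQ6, dQ7, sum5 in *. lra. }
assert (Herr : Rabs (sum5 (fun j => coord A l j * K j) + v ^ 3 * KG) <= eta * N).
{ eapply Rle_trans; [apply Rabs_triang|].
  pose proof (sum5_abs (coord A l) K eta HK) as Hs5.
  assert (Rabs (v ^ 3 * KG) <= Rabs (v ^ 3) * eta) by (apply Rabs_mult_le; [lra|unfold KG, third_order; lra]).
  unfold N. lra. }
assert (Hmain : Rabs main <= C0 * N).
{ eapply Rle_trans; [apply Rabs_triang|].
  pose proof (sum5_abs (coord A l) first_order C0 HCF) as Hs5.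
  assert (Rabs (v ^ 3 * third_order) <= Rabs (v ^ 3) * C0) by (apply Rabs_mult_le; lra).
  unfold N. lra. }
pose proof (Rabs_pos D) as HDp.
assert (Hcorr : Rabs (v * dQ6 + v ^ 2 * dQ7) <= (K6 + K7) * mu * Rabs D).
{ eapply Rle_trans; [apply Rabs_triang|].
  assert (Rabs (v * dQ6) <= mu * (K6 * Rabs D)) by now apply Rabs_mult_le.
  assert (Rabs (v ^ 2 * dQ7) <= mu * (K7 * Rabs D)).
  { apply Rabs_mult_le; [|easy]. replace (v ^ 2) with (v * v) by ring.
    eapply Rle_trans; [apply (Rabs_mult_le v v mu mu); easy|]. nra. }
  lra. }
assert (HDb : Rabs D <= 2 * (C0 + 1) * N).
{ replace D with (main + ((v * dQ6 + v ^ 2 * dQ7)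
               + (sum5 (fun j => coord A l j * K j) + v ^ 3 * KG))) at 1 by lra.
  assert (Rabs (main + ((v * dQ6 + v ^ 2 * dQ7)
     + (sum5 (fun j => coord A l j * K j) + v ^ 3 * KG))) <= C0 * N + ((K6 + K7) * mu * Rabs D + eta * N)).
  { eapply Rle_trans; [apply Rabs_triang|]. apply Rplus_le_compat; [easy|].
    eapply Rle_trans; [apply Rabs_triang|]. lra. }
  assert (Hh : (K6 + K7) * mu * Rabs D <= 1 / 2 * Rabs D) by (apply Rmult_le_compat_r; lra).
  assert (eta * N <= N) by nra.
  replace (main + ((v * dQ6 + v ^ 2 * dQ7)
               + (sum5 (fun j => coord A l j * K j) + v ^ 3 * KG))) with D in * by lra.
  lra. }
rewrite HD. eapply Rle_trans; [apply Rabs_triang|].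
assert ((K6 + K7) * mu * Rabs D <= (K6 + K7) * mu * (2 * (C0 + 1) * N)).
{ apply Rmult_le_compat_l; [|easy]. apply Rmult_le_pos; lra. }
assert ((K6 + K7) * (4 * (C0 + 1)) * mu * N <= eps * N) by (apply Rmult_le_compat_r; lra).
assert (eta * N <= eps / 2 * N) by (apply Rmult_le_compat_r; lra).
fold N. lra.
Qed.

End Expansion.

(** * The first nonzero coefficient *)

Lemma coord_pseries A lam c j : analytic_arc lam c ->
  locally 0 (fun e => is_pseries (fun k => coord A (fun i => c i k) j) e
                                 (coord A (fun i => lam i e) j)).
Proof.
intros Ha.
assert (Hcomb : forall i b, locally 0 (fun e =>
   is_pseries (fun k => c i k + b * c L3 k) e (lam i e + b * lam L3 e))).
{ intros i b. destruct (Ha i) as [_ Hi]. destruct (Ha L3) as [_ H3].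
  generalize (filter_and _ _ Hi H3). apply filter_imp. intros e [He He3].
  apply (is_pseries_plus (c i) (PS_scal b (c L3))); [easy|].
  apply (is_pseries_scal b (c L3)); [apply Rmult_comm|easy]. }
destruct j; [apply Ha|apply Hcomb|apply Ha|apply Hcomb|apply Ha|apply Ha].
Qed.

(** The coefficient of [e^N] in [(lam L3 e)^3] when [lam L3] has no terms of order
    [k] with [3 k < N].  Here [k] is [N / 3] rounded up, and the power of 0 is 1
    exactly when 3 divides [N]. *)
Definition cube_coef (c : param -> nat -> R) (N : nat) : R :=
  let k := ((N + 2) / 3)%nat in c L3 k ^ 3 * 0 ^ (3 * k - N).

Lemma ceil_third N : (N <= 3 * ((N + 2) / 3) /\ 3 * ((N + 2) / 3) <= N + 2)%nat.
Proof.
pose proof (Nat.div_mod_eq (N + 2) 3). pose proof (Nat.mod_upper_bound (N + 2) 3). lia.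
Qed.

Lemma cube_coef_multiple c m : cube_coef c (3 * m) = c L3 m ^ 3.
Proof.
unfold cube_coef. pose proof (ceil_third (3 * m)).
replace ((3 * m + 2) / 3)%nat with m by lia. replace (3 * m - 3 * m)%nat with 0%nat by lia.
simpl. ring.
Qed.

Lemma cube_coef_other c N : ~ (exists m, N = (3 * m)%nat) -> cube_coef c N = 0.
Proof.
intros H. unfold cube_coef. pose proof (ceil_third N).
assert (3 * ((N + 2) / 3) - N <> 0)%nat.
{ intros Hz. apply H. exists ((N + 2) / 3)%nat. lia. }
rewrite pow_i by lia. ring.
Qed.

Lemma cube_leading lam c N : analytic_arc lam c ->
  (forall k, (3 * k < N)%nat -> c L3 k = 0) ->
  filterlim (fun e => lam L3 e ^ 3 / e ^ N) (at_right 0) (locally (cube_coef c N)).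
Proof.
intros Ha Hz. set (k := ((N + 2) / 3)%nat). pose proof (ceil_third N) as Hk. fold k in Hk.
assert (H1 : filterlim (fun e => lam L3 e / e ^ k) (at_right 0) (locally (c L3 k))).
{ apply (pseries_leading (c L3)); [apply Ha|]. intros i Hi. apply Hz. lia. }
assert (H2 : filterlim (fun e : R => e ^ (3 * k - N)) (at_right 0) (locally (0 ^ (3 * k - N)))).
{ eapply filterlim_filter_le_1; [apply filter_le_within|].
  apply (ex_derive_continuous (fun e : R => e ^ (3 * k - N))). auto_derive. easy. }
assert (H3 : filterlim (fun e => (lam L3 e / e ^ k) * ((lam L3 e / e ^ k) * (lam L3 e / e ^ k))
               * e ^ (3 * k - N)) (at_right 0)
               (locally (c L3 k * (c L3 k * c L3 k) * 0 ^ (3 * k - N)))).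
{ eapply filterlim_comp_2; [|exact H2|apply (filterlim_mult (K := R_AbsRing))].
  eapply filterlim_comp_2; [exact H1| |apply (filterlim_mult (K := R_AbsRing))].
  eapply filterlim_comp_2; [exact H1|exact H1|apply (filterlim_mult (K := R_AbsRing))]. }
unfold cube_coef. fold k.
replace (c L3 k ^ 3) with (c L3 k * (c L3 k * c L3 k)) by ring.
revert H3. apply filterlim_ext_loc.
unfold at_right, within. exists (mkposreal 1 Rlt_0_1). intros e _ He.
assert (Hsplit : e ^ k * (e ^ k * e ^ k) = e ^ N * e ^ (3 * k - N)).
{ rewrite <- !pow_add. f_equal. lia. }
assert (e ^ k <> 0) by (apply pow_nonzero; lra).
assert (e ^ N <> 0) by (apply pow_nonzero; lra).
apply Rmult_eq_reg_r with (e ^ k * (e ^ k * e ^ k)); [|now repeat apply Rmult_integral_contrapositive_currified].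
rewrite Hsplit at 2. field. now split.
Qed.

Lemma filterlim_plus_R {F : (R -> Prop) -> Prop} {FF : Filter F} (f g : R -> R) a b :
  filterlim f F (locally a) -> filterlim g F (locally b) ->
  filterlim (fun e => f e + g e) F (locally (a + b)).
Proof.
intros Hf Hg. eapply filterlim_comp_2; [exact Hf|exact Hg|apply (filterlim_plus (V := R_NormedModule))].
Qed.

Lemma filterlim_mult_R {F : (R -> Prop) -> Prop} {FF : Filter F} (f g : R -> R) a b :
  filterlim f F (locally a) -> filterlim g F (locally b) ->
  filterlim (fun e => f e * g e) F (locally (a * b)).
Proof.
intros Hf Hg. eapply filterlim_comp_2; [exact Hf|exact Hg|apply (filterlim_mult (K := R_AbsRing))].
Qed.

Lemma filterlim_eps {F : (R -> Prop) -> Prop} {FF : Filter F} (f : R -> R) a eps :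
  filterlim f F (locally a) -> 0 < eps -> F (fun e => Rabs (f e - a) < eps).
Proof. intros Hf Heps. exact (proj1 (filterlim_locally f a) Hf (mkposreal eps Heps)). Qed.

Definition vanishing (A : annulus) (c : param -> nat -> R) (N : nat) : Prop :=
  (forall j k, j <> L3 -> (k < N)%nat -> coord A (fun i => c i k) j = 0) /\
  (forall k, (3 * k < N)%nat -> c L3 k = 0).

(** Divide [displacement_expansion] by [e^N] and let [e] tend to [0+]: the
    generators, divided by [e^N], have limits, so that the error tends to 0. *)
Lemma leading_coefficient A sx sy h x y T lam c d (M : nat -> R -> R) N :
  cross_section A sx sy -> level A h -> loop A h x y T (sx h) (sy h) ->
  analytic_arc lam c -> is_displacement A sx sy lam d ->
  locally 0 (fun e => is_pseries (fun k => M k h) e (d h e)) ->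
  (forall k, (k < N)%nat -> M k h = 0) -> vanishing A c N ->
  M N h = sum5 (fun j => coord A (fun i => c i N) j * first_order A x y T j)
          + cube_coef c N * third_order A x y T.
Proof.
intros Hcs Hlev Hl Ha Hd Hps HM [Hv1 Hv3].
set (F := first_order A x y T). set (G := third_order A x y T).
set (C := fun j => coord A (fun i => c i N) j).
assert (HdM : filterlim (fun e => d h e / e ^ N) (at_right 0) (locally (M N h)))
  by (now apply (pseries_leading (fun k => M k h))).
assert (Hcj : forall j, j <> L3 ->
  filterlim (fun e => coord A (fun i => lam i e) j / e ^ N) (at_right 0) (locally (C j))).
{ intros j Hj. apply (pseries_leading (fun k => coord A (fun i => c i k) j)).
  - now apply coord_pseries.
  - intros k Hk. now apply Hv1. }
pose proof (cube_leading lam c N Ha Hv3) as Hcube.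
assert (Hmain : filterlim (fun e => sum5 (fun j => coord A (fun i => lam i e) j / e ^ N * F j)
                    + lam L3 e ^ 3 / e ^ N * G) (at_right 0)
                    (locally (sum5 (fun j => C j * F j) + cube_coef c N * G))).
{ unfold sum5.
  do 5 (apply filterlim_plus_R;
    [|apply filterlim_mult_R; [first [exact Hcube | apply Hcj; discriminate] | apply filterlim_const]]).
  apply filterlim_mult_R; [apply Hcj; discriminate | apply filterlim_const]. }
assert (Hsize : filterlim (fun e => sum5 (fun j => Rabs (coord A (fun i => lam i e) j / e ^ N))
                    + Rabs (lam L3 e ^ 3 / e ^ N)) (at_right 0)
                    (locally (sum5 (fun j => Rabs (C j)) + Rabs (cube_coef c N)))).
{ assert (Habs : forall (f : R -> R) a, filterlim f (at_right 0) (locally a) ->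
     filterlim (fun e => Rabs (f e)) (at_right 0) (locally (Rabs a))).
  { intros f a Hf. eapply filterlim_comp; [exact Hf|]. apply continuous_Rabs. }
  unfold sum5.
  do 5 (apply filterlim_plus_R; [|apply Habs; first [exact Hcube | apply Hcj; discriminate]]).
  apply Habs, Hcj. discriminate. }
set (S := sum5 (fun j => Rabs (C j)) + Rabs (cube_coef c N)) in *.
assert (HS : 0 <= S).
{ unfold S, sum5. pose proof (Rabs_pos (C L1)). pose proof (Rabs_pos (C L2)). pose proof (Rabs_pos (C L4)).
  pose proof (Rabs_pos (C L5)). pose proof (Rabs_pos (C L6)). pose proof (Rabs_pos (cube_coef c N)). lra. }
assert (Hclose : filterlim (fun e => d h e / e ^ N
    - (sum5 (fun j => coord A (fun i => lam i e) j / e ^ N * F j) + lam L3 e ^ 3 / e ^ N * G))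
    (at_right 0) (locally 0)).
{ apply filterlim_locally. intros eps.
  destruct (displacement_expansion A sx sy h x y T Hcs Hlev Hl (eps / (2 * (S + 1)))) as (mu & Hmu & Hexp).
  { apply Rdiv_lt_0_compat; [apply cond_pos|lra]. }
  assert (Hlam : at_right 0 (fun e => forall j, Rabs (lam j e) <= mu)).
  { assert (Hj : forall j, at_right 0 (fun e => Rabs (lam j e) <= mu)).
    { intros j. destruct (Ha j) as [Hc0 Hj].
      pose proof (pseries_leading (c j) (lam j) 0 Hj) as Hlim. rewrite Hc0 in Hlim.
      specialize (Hlim ltac:(intros; lia)).
      generalize (filterlim_eps _ _ _ Hlim Hmu). apply filter_imp. intros e He.
      left. replace (lam j e) with (lam j e / e ^ 0 - 0) by (simpl; field). exact He. }
    pose proof (filter_and _ _ (Hj L1) (filter_and _ _ (Hj L2) (filter_and _ _ (Hj L3)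
      (filter_and _ _ (Hj L4) (filter_and _ _ (Hj L5) (Hj L6)))))) as Hall.
    revert Hall. apply filter_imp. intros e (E1 & E2 & E3 & E4 & E5 & E6) []; easy. }
  assert (Hret : at_right 0 (fun e => first_return A sx sy (fun j => lam j e) h (h + d h e))).
  { apply (filter_le_within _ _). exact (Hd h Hlev). }
  assert (HS1 : at_right 0 (fun e => sum5 (fun j => Rabs (coord A (fun i => lam i e) j / e ^ N))
                    + Rabs (lam L3 e ^ 3 / e ^ N) < S + 1)).
  { generalize (filterlim_eps _ _ _ Hsize Rlt_0_1). apply filter_imp. intros e He.
    apply Rabs_def2 in He. lra. }
  assert (Hpos : at_right 0 (fun e => 0 < e)).
  { exists (mkposreal 1 Rlt_0_1). intros e _ He. exact He. }
  generalize (filter_and _ _ Hlam (filter_and _ _ Hret (filter_and _ _ HS1 Hpos))).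
  apply filter_imp. intros e (He1 & (x' & y' & T' & HR) & He3 & He4).
  specialize (Hexp (fun j => lam j e) (h + d h e) x' y' T' He1 HR).
  match goal with |- ball _ _ ?z => change (Rabs (z - 0) < eps) end.
  assert (HeN : 0 < e ^ N) by now apply pow_lt.
  set (Z := sum5 (fun j => Rabs (coord A (fun i => lam i e) j / e ^ N)) + Rabs (lam L3 e ^ 3 / e ^ N)) in *.
  assert (HZ : sum5 (fun j => Rabs (coord A (fun i => lam i e) j)) + Rabs (lam L3 e ^ 3) = Z * e ^ N).
  { unfold Z, sum5, Rdiv. rewrite !Rabs_mult, !(Rabs_right (/ e ^ N)) by (left; now apply Rinv_0_lt_compat).
    field. lra. }
  cbv beta in Hexp. rewrite HZ in Hexp.
  apply Rmult_lt_reg_r with (e ^ N); [easy|].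
  match goal with |- Rabs ?z * ?p < _ =>
    replace (Rabs z * p) with (Rabs (z * p)) by (rewrite Rabs_mult, (Rabs_right p); lra) end.
  replace ((d h e / e ^ N - (sum5 (fun j => coord A (fun i => lam i e) j / e ^ N * F j)
             + lam L3 e ^ 3 / e ^ N * G) - 0) * e ^ N) with
    (h + d h e - h - (sum5 (fun j => coord A (fun i => lam i e) j * F j) + lam L3 e ^ 3 * G))
    by (unfold sum5; field; lra).
  eapply Rle_lt_trans; [exact Hexp|].
  rewrite <- Rmult_assoc. apply Rmult_lt_compat_r; [easy|].
  pose proof (cond_pos eps) as Hep.
  assert (0 < eps / (2 * (S + 1))) by (apply Rdiv_lt_0_compat; lra).
  apply Rle_lt_trans with (eps / (2 * (S + 1)) * (S + 1)); [apply Rmult_le_compat_l; lra|].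
  replace (eps / (2 * (S + 1)) * (S + 1)) with (eps / 2) by (field; lra). lra. }
pose proof (filterlim_plus_R _ _ _ _ Hclose Hmain) as Hsum. rewrite Rplus_0_l in Hsum.
assert (HdM' : filterlim (fun e => d h e / e ^ N) (at_right 0)
                 (locally (sum5 (fun j => C j * F j) + cube_coef c N * G))).
{ revert Hsum. apply filterlim_ext. intros e. ring. }
exact (filterlim_locally_unique (V := R_NormedModule) _ _ _ HdM HdM').
Qed.

Lemma expand_integrals A h x y T p q (C : param -> R) g : loop A h x y T p q ->
  sum5 (fun j => C j * first_order A x y T j) + g * third_order A x y T =
  (- (32 / 13) * g * h ^ 2
   + (- (320 / 231) * coef_a A * C L5 + 4 / 3 * coef_b A * C L6 - 1448 / 1001 * coef_b A * g) * h
   + (C L2 - 8 / 7 * (coef_a A * coef_b A) * C L4 - 40 / 231 * (coef_a A * coef_b A) * C L5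
      + 32 / 21 * C L6 - 192 / 1001 * g)) * moment x y T 2
  + ((240 / 77 * C L5 + 640 / 1001 * (coef_a A * coef_b A) * g) * h ^ 2
     + (4 / 7 * coef_b A * C L4 + 20 / 231 * coef_b A * C L5 - 16 / 21 * coef_a A * C L6
        + 96 / 1001 * coef_a A * g) * h
     + C L1) * moment x y T 0.
Proof.
intros Hl. unfold sum5, first_order, third_order, mono.
rewrite (third_order_integral A h x y T p q Hl), (moment_y4 A h x y T p q Hl).
fold (moment x y T 0) (moment x y T 2) (moment x y T 4) (moment x y T 6).
rewrite (moment4 A h x y T p q Hl), (moment6 A h x y T p q Hl). ring.
Qed.

(** Induction on the order: a vanishing coefficient of the displacement is a
    combination of the six independent functions [h^i I_0] and [h^i I_2], whose
    coefficients form a triangular system in the generators. *)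
Lemma generators_vanish A lam c sx sy d (M : nat -> R -> R) I0 I2 n :
  analytic_arc lam c -> cross_section A sx sy -> is_displacement A sx sy lam d ->
  (forall h, level A h -> locally 0 (fun e => is_pseries (fun k => M k h) e (d h e))) ->
  (forall k h, (k < n)%nat -> level A h -> M k h = 0) ->
  (forall h, level A h -> exists x y T, loop A h x y T (sx h) (sy h) /\
     moment x y T 0 = I0 h /\ moment x y T 2 = I2 h) ->
  forall N, (N <= n)%nat -> vanishing A c N.
Proof.
intros Ha Hcs Hd Hps HM Hloops. induction N as [|N IH]; intros HN.
{ split; intros; lia. }
specialize (IH ltac:(lia)).
set (C := fun j => coord A (fun i => c i N) j). set (g := cube_coef c N).
assert (Hzero : C L1 = 0 /\ C L2 = 0 /\ C L4 = 0 /\ C L5 = 0 /\ C L6 = 0 /\ g = 0).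
{ destruct (integrals_independent A I0 I2
    (- (32 / 13) * g)
    (- (320 / 231) * coef_a A * C L5 + 4 / 3 * coef_b A * C L6 - 1448 / 1001 * coef_b A * g)
    (C L2 - 8 / 7 * (coef_a A * coef_b A) * C L4 - 40 / 231 * (coef_a A * coef_b A) * C L5
      + 32 / 21 * C L6 - 192 / 1001 * g)
    (240 / 77 * C L5 + 640 / 1001 * (coef_a A * coef_b A) * g)
    (4 / 7 * coef_b A * C L4 + 20 / 231 * coef_b A * C L5 - 16 / 21 * coef_a A * C L6
        + 96 / 1001 * coef_a A * g)
    (C L1)) as (E1 & E2 & E3 & E4 & E5 & E6).
  - intros h Hlev. destruct (Hloops h Hlev) as (x & y & T & H). now exists x, y, T, (sx h), (sy h).
  - intros h Hlev. destruct (Hloops h Hlev) as (x & y & T & Hl & <- & <-).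
    rewrite <- (expand_integrals A h x y T _ _ C g Hl).
    unfold C, g. rewrite <- (leading_coefficient A sx sy h x y T lam c d M N); try easy.
    + apply HM; [lia|easy].
    + now apply Hps.
    + intros k Hk. apply HM; [lia|easy].
  - assert (g = 0) by lra. assert (C L5 = 0) by (rewrite H in E4; lra).
    rewrite H, H0 in *. destruct A; simpl in *; repeat split; lra. }
destruct Hzero as (Z1 & Z2 & Z4 & Z5 & Z6 & Zg). destruct IH as [IH1 IH3]. split.
- intros j k Hj Hk. destruct (Nat.eq_dec k N) as [->|Hne]; [|apply IH1; [easy|lia]].
  destruct j; easy.
- intros k Hk. destruct (Nat.eq_dec (3 * k) N) as [<-|Hne]; [|apply IH3; lia].
  unfold g in Zg. rewrite cube_coef_multiple in Zg.
  destruct (Req_dec (c L3 k) 0) as [|Hn]; [easy|]. now apply (pow_nonzero _ 3) in Hn.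
Qed.

Definition coordE (A : annulus) (n : nat) (j : param) : coef_expr :=
  match j with
  | L2 => Add (Coef L2 n) (Mul (Cst (3 * coef_a A)) (Coef L3 n))
  | L4 => Add (Coef L4 n) (Mul (Cst (3 * coef_b A)) (Coef L3 n))
  | _ => Coef j n
  end.

Lemma eval_coordE c A n j : eval_coef c (coordE A n j) = coord A (fun i => c i n) j.
Proof. now destruct j. Qed.

Definition cubeE (k : nat) : coef_expr := Mul (Coef L3 k) (Mul (Coef L3 k) (Coef L3 k)).

Lemma eval_cubeE c k : eval_coef c (cubeE k) = c L3 k ^ 3.
Proof. simpl. ring. Qed.

Theorem theorem2 (A : annulus) (n : nat) (hn : (1 <= n)%nat) :
  exists p21 p11 p01 q21 q11 q01 p10 p00 q20 q10 q00 : coef_expr,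
  forall (lam : param -> R -> R) (c : param -> nat -> R)
         (sx sy : R -> R) (d : R -> R -> R) (M : nat -> R -> R)
         (I0 I2 : R -> R),
    analytic_arc lam c ->
    cross_section A sx sy ->
    is_displacement A sx sy lam d ->
    first_coefficient A d M n ->
    (forall h, level A h -> is_oval_integral A 0 h (I0 h)) ->
    (forall h, level A h -> is_oval_integral A 2 h (I2 h)) ->
    ((exists m : nat, n = (3 * m)%nat) ->
       forall h, level A h ->
         M n h =
           (eval_coef c p21 * h ^ 2 + eval_coef c p11 * h + eval_coef c p01) * I2 h
           + (eval_coef c q21 * h ^ 2 + eval_coef c q11 * h + eval_coef c q01) * I0 h) /\
    (~ (exists m : nat, n = (3 * m)%nat) ->
       forall h, level A h ->
         M n h =
           (eval_coef c p10 * h + eval_coef c p00) * I2 h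
           + (eval_coef c q20 * h ^ 2 + eval_coef c q10 * h + eval_coef c q00) * I0 h).
Proof.
set (a := coef_a A). set (b := coef_b A). set (C := coordE A n). set (g := cubeE (n / 3)).
set (p10 := Add (Mul (Cst (- (320 / 231) * a)) (C L5)) (Mul (Cst (4 / 3 * b)) (C L6))).
set (p00 := Add (Add (C L2) (Mul (Cst (- (8 / 7) * (a * b))) (C L4)))
                (Add (Mul (Cst (- (40 / 231) * (a * b))) (C L5)) (Mul (Cst (32 / 21)) (C L6)))).
set (q20 := Mul (Cst (240 / 77)) (C L5)).
set (q10 := Add (Mul (Cst (4 / 7 * b)) (C L4))
                (Add (Mul (Cst (20 / 231 * b)) (C L5)) (Mul (Cst (- (16 / 21) * a)) (C L6)))).
exists (Mul (Cst (- (32 / 13))) g), (Add p10 (Mul (Cst (- (1448 / 1001) * b)) g)),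
  (Add p00 (Mul (Cst (- (192 / 1001))) g)), (Add q20 (Mul (Cst (640 / 1001 * (a * b))) g)),
  (Add q10 (Mul (Cst (96 / 1001 * a)) g)), (C L1), p10, p00, q20, q10, (C L1).
intros lam c sx sy d M I0 I2 Ha Hcs Hd (Hps & HM & _) HI0 HI2.
assert (Hloops : forall h, level A h -> exists x y T, loop A h x y T (sx h) (sy h) /\
     moment x y T 0 = I0 h /\ moment x y T 2 = I2 h).
{ intros h Hlev. apply loop_of_integrals; [now apply HI0|now apply HI2|]. apply (Hcs h Hlev). }
pose proof (generators_vanish A lam c sx sy d M I0 I2 n Ha Hcs Hd Hps HM Hloops n (Nat.le_refl n)) as Hvan.
assert (Hform : forall h, level A h -> exists x y T, loop A h x y T (sx h) (sy h) /\
  moment x y T 0 = I0 h /\ moment x y T 2 = I2 h /\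
  M n h = sum5 (fun j => coord A (fun i => c i n) j * first_order A x y T j)
          + cube_coef c n * third_order A x y T).
{ intros h Hlev. destruct (Hloops h Hlev) as (x & y & T & Hl & H0 & H2).
  exists x, y, T. repeat (split; [easy|]).
  apply (leading_coefficient A sx sy h x y T lam c d M n); try easy.
  - now apply Hps.
  - intros k Hk. now apply HM. }
assert (HC : forall j, eval_coef c (C j) = coord A (fun i => c i n) j) by apply eval_coordE.
unfold p10, p00, q20, q10. cbn [eval_coef]. rewrite !HC.
split; intros Hn h Hlev; destruct (Hform h Hlev) as (x & y & T & Hl & <- & <- & ->);
  rewrite (expand_integrals A h x y T _ _ _ _ Hl); fold a b.
- destruct Hn as [m Hm].
  replace (eval_coef c g) with (cube_coef c n); [ring|].
  unfold g. rewrite eval_cubeE, Hm, cube_coef_multiple. do 2 f_equal.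
  rewrite Nat.mul_comm. symmetry. now apply Nat.div_mul.
- rewrite (cube_coef_other c n Hn). ring.
Qed.
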